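(* Let $\alpha\in(0,2)$ and $X\sim\mathcal{S}(\alpha,\beta,m_1,m_2)$. For a function $g$ on $\mathbb{R}$ put $$\mathcal{A}^{\alpha}_{X}(g)(x)=(-x+\beta)g(x)+\int_{\mathbb{R}}u\left(g(x+u)-g(x)\mathbf{1}_{\{|u|\leq1\}}(u)\right)\nu_{\alpha}(du),$$ and, for $h$ as below, define $g_h^\alpha:\mathbb{R}\to\mathbb{R}$ by $$g^{\alpha}_{h}(x)=-\int_{0}^{\infty}e^{-t}\int_{\mathbb{R}}h'(u+xe^{-t})\,F_{X_{(t)}}(du)\,dt .$$ (i) If $\alpha\in(0,1]$ and $h\in\mathcal{H}_\delta$ with $0<\delta<\alpha$, then $g=g_h^\alpha$ solves the Stein equation $\mathcal{A}^\alpha_X(g)(x)=h(x)-\mathbb{E}h(X)$, $x\in\mathbb{R}$. (ii) If $\alpha\in(1,2)$ and $h\in\mathcal{H}_2$, then $g=g_h^\alpha$ solves the Stein equation $\mathcal{A}^\alpha_X(g)(x)=h(x)-\mathbb{E}h(X)$, $x\in\mathbb{R}$.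
   Context: For $\alpha\in(0,2)$, $\beta\in\mathbb{R}$, $m_1,m_2\in[0,\infty)$ with $m_1+m_2>0$, $X\sim\mathcal{S}(\alpha,\beta,m_1,m_2)$ means that $\phi_\alpha(z):=\mathbb{E}(e^{izX})=e^{\eta_\alpha(z)}$, $z\in\mathbb{R}$, where $$\eta_\alpha(z)=iz\beta+\int_{\mathbb{R}}\left(e^{izu}-1-izu\mathbf{1}_{\{|u|\le1\}}(u)\right)\nu_\alpha(du),\qquad \nu_{\alpha}(du)=\left(\frac{m_1}{u^{1+\alpha}}\mathbf{1}_{(0,\infty)}(u)+\frac{m_2}{|u|^{1+\alpha}}\mathbf{1}_{(-\infty,0)}(u)\right)du.$$ For $t\ge 0$, $F_{X_{(t)}}$ denotes the probability distribution with characteristic function $\phi_t(z)=\phi_\alpha(z)/\phi_\alpha(e^{-t}z)$ (a characteristic function, by self-decomposability of $X$). $\mathcal{H}_\delta$ is the set of differentiable $h:\mathbb{R}\to\mathbb{R}$ with $|h^{(k)}(v)-h^{(k)}(x)|\le d_\delta(v,x)$ for $k=0,1$ and all $v,x$, where $d_\delta(v,x)=|v-x|\wedge|v-x|^\delta$, $h^{(0)}=h$, $h^{(1)}=h'$. $\mathcal{H}_2$ is the set of twice continuously differentiable $h:\mathbb{R}\to\mathbb{R}$ with $\|h^{(k)}\|\le 1$ for $k=0,1,2$, where $\|f\|=\sup_{x\in\mathbb{R}}|f(x)|$. *)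

(* Defs.v *)
From HB Require Import structures.
From mathcomp Require Import all_boot all_order all_algebra.
From mathcomp Require Import all_classical all_reals all_analysis.
From mathcomp Require Import measurable_realfun.
From mathcomp.real_closed Require Import complex.

Set Implicit Arguments.
Unset Strict Implicit.
Unset Printing Implicit Defensive.

Import Order.TTheory GRing.Theory Num.Theory.
Import numFieldNormedType.Exports.

Local Open Scope classical_set_scope.
Local Open Scope ring_scope.
Local Open Scope complex_scope.

Section complex_valued.
Context {R : realType}.

Definition cexp (w : R[i]) : R[i] :=
  (expR (complex.Re w))%:C * (cos (complex.Im w) +i* sin (complex.Im w)).

Definition Cintegral d (T : measurableType d)
    (mu : {measure set T -> \bar R}) (D : set T) (f : T -> R[i]) : R[i] :=
  (\int[mu]_(x in D) complex.Re (f x)) +i* (\int[mu]_(x in D) complex.Im (f x)).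

Definition char_fun d (T : measurableType d) (P : probability T R)
    (Y : T -> R) (z : R) : R[i] :=
  Cintegral P setT (fun w => cexp ('i * (z * Y w)%:C)).

End complex_valued.

Section levy_measure.
Context {R : realType}.
Variables (alpha : R) (m1 m2 : {nonneg R}).

Definition levy_density (u : R) : R :=
  m1%:num / (u `^ (1 + alpha)) * \1_(`]0, +oo[%classic) u
  + m2%:num / (`|u| `^ (1 + alpha)) * \1_(`]-oo, 0[%classic) u.

Lemma levy_density_ge0 u : 0 <= levy_density u.
Proof. by rewrite addr_ge0// mulr_ge0// divr_ge0// powR_ge0. Qed.

Lemma measurable_levy_density : measurable_fun setT levy_density.
Proof.
have mp : measurable_fun [set: R] (fun u : R => (u `^ (1 + alpha))^-1).
  under eq_fun do rewrite -powRN.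
  exact: measurable_powR.
have mpn : measurable_fun [set: R] (fun u : R => (`|u| `^ (1 + alpha))^-1).
  exact: measurableT_comp mp (@normr_measurable R setT).
apply: measurable_funD; apply: measurable_funM.
- exact: measurable_funM.
- exact: measurable_indic.
- exact: measurable_funM.
- exact: measurable_indic.
Qed.

Definition levy_measure (A : set R) : \bar R :=
  (\int[lebesgue_measure]_(u in A) (levy_density u)%:E)%E.

Let levy_measure0 : levy_measure set0 = 0%E.
Proof. by rewrite /levy_measure integral_set0. Qed.

Let levy_measure_ge0 A : (0 <= levy_measure A)%E.
Proof. by apply: integral_ge0 => u _; rewrite lee_fin levy_density_ge0. Qed.

Let levy_measure_sigma_additive : semi_sigma_additive levy_measure.
Proof.
move=> A mA tA mUA; rewrite /levy_measure ge0_integral_bigcup//; last 2 first.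
- by apply/measurable_EFinP; apply: measurable_funTS; exact: measurable_levy_density.
- by move=> u _; rewrite lee_fin levy_density_ge0.
apply: is_cvg_ereal_nneg_natsum_cond => n _ _.
by apply: integral_ge0 => u _; rewrite lee_fin levy_density_ge0.
Qed.

HB.instance Definition _ := isMeasure.Build _ _ _ levy_measure
  levy_measure0 levy_measure_ge0 levy_measure_sigma_additive.

End levy_measure.

Section stable.
Context {R : realType}.

Definition stable_exponent (alpha beta : R) (m1 m2 : {nonneg R}) (z : R)
    : R[i] :=
  'i * (z * beta)%:C
  + Cintegral (levy_measure alpha m1 m2) setT
      (fun u => cexp ('i * (z * u)%:C) - 1
                - 'i * (z * u * \1_[set v | `|v| <= 1] u)%:C).

Definition is_stable (alpha beta : R) (m1 m2 : {nonneg R})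
    d (T : measurableType d) (P : probability T R) (X : T -> R) : Prop :=
  forall z, char_fun P X z = cexp (stable_exponent alpha beta m1 m2 z).

(* [F t] is the law F_{X_(t)}: its characteristic function is
   phi(z) / phi(e^{-t} z), where phi is the characteristic function of X. *)
Definition self_decomp_laws d (T : measurableType d) (P : probability T R)
    (X : T -> R) (F : R -> probability R R) : Prop :=
  forall t, 0 <= t -> forall z,
    char_fun (F t) id z = char_fun P X z / char_fun P X (expR (- t) * z).

End stable.

Section test_functions.
Context {R : realType}.

Definition d_delta (delta v x : R) : R :=
  Num.min `|v - x| (`|v - x| `^ delta).

Definition H_delta (delta : R) : set (R -> R) := [set h : R -> R |
  (forall x, derivable h x 1) /\
  (forall k, (k <= 1)%N -> forall v x,
     `|derive1n k h v - derive1n k h x| <= d_delta delta v x)].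

Definition sup_norm (f : R -> R) : \bar R :=
  ereal_sup [set (`|f x|)%:E | x in setT].

Definition H_2 : set (R -> R) := [set h : R -> R |
  [/\ forall x, derivable h x 1,
      forall x, derivable (derive1 h) x 1,
      continuous (derive1n 2 h) &
      forall k, (k <= 2)%N -> (sup_norm (derive1n k h) <= 1)%E]].

End test_functions.

Section stein.
Context {R : realType}.

Definition stein_integrand (g : R -> R) (x u : R) : R :=
  u * (g (x + u) - g x * \1_[set v | `|v| <= 1] u).

Definition stein_op (alpha beta : R) (m1 m2 : {nonneg R}) (g : R -> R)
    (x : R) : R :=
  (- x + beta) * g x
  + \int[levy_measure alpha m1 m2]_(u in setT) stein_integrand g x u.

Definition stein_sol (F : R -> probability R R) (h : R -> R) (x : R) : R :=
  - \int[lebesgue_measure]_(t in `[0, +oo[)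
      (expR (- t) * \int[F t]_(u in setT) derive1 h (u + x * expR (- t))).

(* [Rintegral] is total, so the existence of the integrals has to be
   stated separately, here and in [solves_stein]. *)
Definition stein_sol_defined (F : R -> probability R R) (h : R -> R) : Prop :=
  forall x,
    (forall t, 0 <= t ->
       (F t).-integrable setT (fun u => (derive1 h (u + x * expR (- t)))%:E)) /\
    lebesgue_measure.-integrable `[0, +oo[ (fun t : R =>
      (expR (- t) * \int[F t]_(u in setT) derive1 h (u + x * expR (- t)))%:E).

Definition solves_stein (alpha beta : R) (m1 m2 : {nonneg R})
    d (T : measurableType d) (P : probability T R) (X : T -> R)
    (h g : R -> R) : Prop :=
  P.-integrable setT (fun w => (h (X w))%:E) /\
  forall x,
    (levy_measure alpha m1 m2).-integrable setT
      (fun u => (stein_integrand g x u)%:E) /\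
    stein_op alpha beta m1 m2 g x = h x - fine 'E_P[h \o X].

End stein.

(* Main.v *)
Require Import Defs.
From HB Require Import structures.
From mathcomp Require Import all_boot all_order all_algebra.
From mathcomp Require Import all_classical all_reals all_analysis.
From mathcomp Require Import measurable_realfun.
From mathcomp Require Import ring lra.
From mathcomp.real_closed Require Import complex.

Set Implicit Arguments.
Unset Strict Implicit.
Unset Printing Implicit Defensive.

Import Order.TTheory GRing.Theory Num.Theory.
Import numFieldNormedType.Exports.

Local Open Scope classical_set_scope.
Local Open Scope ring_scope.

(** Write g for the function g_h of the statement, with s = exp (- t), and let
    [stein_incr F h x] be the function v |-> - int_0^oo int (h (u + (x + v) s) -
    h (u + x s)) F_t(du) dt, whose derivative at v is g (x + v). The theorem
    follows from the identity, called [stein_identity] below,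

      h x - E h(X) = (- x + beta - (m1 - m2)) g x
        + alpha * int (stein_incr F h x u - u 1_{|u| <= 1} g x) nu(du),

    in which only the bounded function g x and an increment of order |u|^delta,
    with delta < alpha, meet the Levy measure. On each half-line nu has a
    density proportional to |u|^(- 1 - alpha), and integrating by parts there
    ([levy_by_parts]) turns the integral into the one of the Stein operator: the
    truncation at |u| = 1 leaves the boundary terms - m1 g x and m2 g x, which
    make up the drift correction - (m1 - m2) g x. The integral of the Stein
    operator converges because the identity itself bounds |y g y| by a constant
    plus a multiple of |y|^delta ([stein_sol_decay]).

    The identity is first proved for h x = cos (z x + th). The substitution
    u -> s u expresses the characteristic exponent at s z by the one at z
    ([cosint_scale], [sinint_scale]), so that the mean of h (u + x s) under F_t
    is an explicit am t * cos (ph x t). Its derivative in t is alpha times the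
    nu-integral of the compensated increments minus (x - beta + m1 - m2) s times
    the mean of h' (u + x s). Integrating over [0, +oo[ gives the identity, since
    the mean is h x at t = 0 and tends to E h(X) ([stein_identity_cos_at]).

    It then spreads to every test function. Call h [tame] when h' is bounded
    and Lipschitz and h is delta-Hoelder; the right-hand side of the identity is
    dominated in terms of the tameness constant, so the identity passes to
    linear combinations, and to pointwise limits of uniformly tame functions
    whose means E h(X) converge ([stein_identity_lin], [stein_identity_lim]). A
    bounded tame h is reached in two limits: h (sin (w x) / w) is a limit of
    Bernstein polynomials in (1 + sin (w x)) / 2, which are trigonometric
    polynomials, tame uniformly in the degree, and sin (w x) / w tends to x with
    w -> 0. An unbounded h is the limit of its truncations M sin (h / M). Here the
    integrability of h(X) has to be established: at x = 0 the identity for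
    sqrt (1 + (M sin (h / M))^2) bounds the mean of this function independently
    of M, and Fatou's lemma concludes ([integrable_tame]). Finally the functions
    of the class H_delta are tame with exponent delta, and those of H_2 with any
    exponent in [0, 1], so that 1/2 < alpha serves in the second case. *)

(** * Domination for real-valued integrals *)

Section real_valued_integration.
Context d (T : measurableType d) (R : realType).
Variables (mu : {measure set T -> \bar R}) (D : set T).
Hypothesis mD : measurable D.
Implicit Types f g : T -> R.

Lemma dominated_integrableR f g : measurable_fun D f ->
  mu.-integrable D (EFin \o g) -> (forall x, D x -> `|f x| <= g x) ->
  mu.-integrable D (EFin \o f).
Proof.
move=> mf ig fg; apply: (le_integrable mD _ _ ig).
  exact/measurable_EFinP.
by move=> x Dx /=; rewrite lee_fin (le_trans (fg x Dx))// ler_norm.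
Qed.

Lemma ler_norm_Rintegral f g : measurable_fun D f ->
  mu.-integrable D (EFin \o g) -> (forall x, D x -> `|f x| <= g x) ->
  `|\int[mu]_(x in D) f x| <= \int[mu]_(x in D) g x.
Proof.
move=> mf ig fg; have fi := dominated_integrableR mf ig fg.
apply: le_trans (le_normr_Rintegral mD fi) _.
apply: le_Rintegral => //.
by have := integrable_norm fi; apply: eq_integrable => // x _ /=.
Qed.

Lemma cvg_dominated_Rintegral (f_ : (T -> R)^nat) f g :
  (forall n, measurable_fun D (f_ n)) ->
  (forall x, D x -> f_ n x @[n --> \oo] --> f x) ->
  mu.-integrable D (EFin \o g) ->
  (forall n x, D x -> `|f_ n x| <= g x) ->
  mu.-integrable D (EFin \o f) /\
  \int[mu]_(x in D) f_ n x @[n --> \oo] --> \int[mu]_(x in D) f x.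
Proof.
move=> mf_ cf ig fg.
have mf : measurable_fun D f by exact: measurable_fun_cvg cf.
have fgl x : D x -> `|f x| <= g x.
  move=> Dx; apply: cvgr_to_le (cvg_norm (cf _ Dx)) _.
  by apply: nearW => n; exact: fg.
have fi := dominated_integrableR mf ig fgl.
split => //; apply: fine_cvg; rewrite fineK; last exact: integrable_fin_num.
apply: (@dominated_cvg _ _ _ mu D mD _ _ (EFin \o g)) => //.
- by move=> n; exact/measurable_EFinP.
- by move=> x Dx /=; apply: cvg_EFin; [exact: nearW|exact: cf].
Qed.

End real_valued_integration.

(** * The fundamental theorem of calculus by exhaustion *)

(** The two improper cases used later, a ray and an interval open at 0, are both
    increasing unions of segments inside an open ray where F is a primitive. *)
Section exhaustion.
Context {R : realType}.
Notation mu := (@lebesgue_measure R).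
Variables (a b : nat -> R) (D : set R) (c : R).
Hypothesis ab : forall n, a n < b n.
Hypothesis ca : forall n, c < a n.
Hypothesis nda : {homo a : m n / (m <= n)%N >-> (n <= m)}.
Hypothesis ndb : {homo b : m n / (m <= n)%N >-> (m <= n)}.
Hypothesis DE : D = \bigcup_n `[a n, b n]%classic.
Variables F f : R -> R.
Hypothesis dF : forall x, c < x -> is_derive x 1 F (f x).
Hypothesis cf : forall x, c < x -> {for x, continuous f}.

Let mD : measurable D.
Proof. by rewrite DE; exact: bigcup_measurable. Qed.

Let cfab n : {within `[a n, b n], continuous f}.
Proof.
apply: continuous_in_subspaceT => x; rewrite inE/= in_itv/= => /andP[ax _].
by apply: cf; rewrite (lt_le_trans (ca n)).
Qed.

Let FTC n : (\int[mu]_(x in `[a n, b n]) (f x)%:E = (F (b n))%:E - (F (a n))%:E)%E.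
Proof.
have cF x : c < x -> {for x, continuous F}.
  move=> cx; apply/differentiable_continuous/derivable1_diffP.
  by have [] := dF cx.
apply: continuous_FTC2 => //.
- split.
  + move=> x; rewrite in_itv/= => /andP[ax _].
    by have [] := dF (lt_trans (ca n) ax).
  + by apply: cvg_at_right_filter; apply: cF.
  + by apply: cvg_at_left_filter; apply: cF; rewrite (lt_trans (ca n)).
- move=> x; rewrite in_itv/= => /andP[ax _].
  by rewrite derive1E; have [_ ->] := dF (lt_trans (ca n) ax).
Qed.

Let homoI : {homo (fun n => `[a n, b n]%classic) : n m / (n <= m)%N >-> (n <= m)%O}.
Proof.
move=> n m nm; apply/subsetPset => x/=; rewrite !in_itv/= => /andP[ax xb].
by rewrite (le_trans (nda nm))// (le_trans xb)// ndb.
Qed.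

Let mf : measurable_fun D f.
Proof.
rewrite DE; apply/measurable_fun_bigcup => // n.
by apply: subspace_continuous_measurable_fun => //; exact: cfab.
Qed.

(** By monotone convergence along the segments: a bounded primitive of a
    nonnegative function makes it integrable. *)
Lemma ge0_FTC_exhaustion_integrable M :
  (forall x, D x -> 0 <= f x) -> (forall n, F (b n) - F (a n) <= M) ->
  mu.-integrable D (EFin \o f).
Proof.
move=> f0 FM; apply/integrableP; split; first exact/measurable_EFinP.
have mI n : measurable_fun `[a n, b n] (fun x => `|(f x)%:E|%E).
  apply: measurableT_comp => //; apply/measurable_EFinP.
  apply: measurable_funS mf => //; by rewrite DE => x xn; exists n.
have cvgI := @ge0_nondecreasing_set_cvg_integral _ _ _ _ _ mu homoI
  (fun n => measurable_itv _) mI (fun n x _ => abse_ge0 _).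
apply: (@le_lt_trans _ _ M%:E); last exact: ltry.
rewrite {1}DE -(cvg_lim _ cvgI)//; apply: lime_le; first by apply/cvg_ex; eexists; exact: cvgI.
apply: nearW => n; rewrite [leLHS](_ : _ = (\int[mu]_(x in `[a n, b n]) (f x)%:E)%E).
  by rewrite FTC -EFinB lee_fin.
apply: eq_integral => x /set_mem xI; rewrite gee0_abs// lee_fin f0//.
by rewrite DE; exists n.
Qed.

(** Dominated convergence of the integrals over the segments; integrability is a
    hypothesis because f may change sign. *)
Lemma FTC_exhaustion l L : mu.-integrable D (EFin \o f) ->
  F (a n) @[n --> \oo] --> l -> F (b n) @[n --> \oo] --> L ->
  \int[mu]_(x in D) f x = L - l.
Proof.
move=> fi Fl FL.
pose f_ n := f \_ `[a n, b n].
have [| |||_ cvgI] := @cvg_dominated_Rintegral _ _ _ mu D mD f_ f (fun x => `|f x|).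
- move=> n; apply/measurable_restrict => //.
  by apply: measurable_funS mf => //; exact: subIsetl.
- move=> x; rewrite {1}DE => -[n _ xn].
  apply: cvg_near_cst; exists n => // m /= nm.
  by rewrite /f_ patchE mem_set//; exact: (subsetPset _ _ (homoI nm)).
- by have := integrable_norm fi; apply: eq_integrable.
- by move=> n x _; rewrite /f_ patchE; case: ifP => // _; rewrite normr0.
have E n : \int[mu]_(x in D) f_ n x = F (b n) - F (a n).
  rewrite -Rintegral_mkcondr (_ : D `&` _ = `[a n, b n]%classic).
    by rewrite /Rintegral FTC.
  by apply/setIidr; by rewrite DE => x xn; exists n.
move: cvgI; rewrite (funext E) => cvgI.
exact: cvg_unique cvgI (cvgB FL Fl).
Qed.

End exhaustion.

Section half_line_exhaustion.
Context {R : realType}.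
Notation mu := (@lebesgue_measure R).
Variables (F f : R -> R) (c : R).
Hypothesis dF : forall x, c < x -> is_derive x 1 F (f x).
Hypothesis cf : forall x, c < x -> {for x, continuous f}.

Let bnd_cvg (a : R) : c < a ->
  [/\ forall n, a < a + n.+1%:R, forall n : nat, c < a,
    {homo (fun n => a + n.+1%:R) : m n / (m <= n)%N >-> (m <= n)} &
   `[a, +oo[%classic = \bigcup_n `[a, a + n.+1%:R]%classic].
Proof.
move=> ca; split => //.
- by move=> n; rewrite ltrDl.
- by move=> m n mn; rewrite lerD2l ler_nat ltnS.
- apply/seteqP; split => x /=; rewrite in_itv/= ?andbT.
    move=> ax; have [n xn] : exists n, x - a <= n%:R.
      by exists (Num.trunc `|x - a|).+1; apply/(le_trans (ler_norm _))/ltW/truncnS_gt.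
    exists n => //=; rewrite in_itv/= ax/= -lerBlDl (le_trans xn)//.
    by rewrite ler_nat.
  by move=> [n _] /=; rewrite in_itv/= => /andP[].
Qed.

Lemma ge0_FTCy_integrable a M : c < a ->
  (forall x, a <= x -> 0 <= f x) -> (forall x, a <= x -> F x <= M) ->
  mu.-integrable `[a, +oo[ (EFin \o f).
Proof.
move=> ca f0 FM; have [ab ca' ndb DE] := bnd_cvg ca.
apply: (@ge0_FTC_exhaustion_integrable _ (fun=> a) _ _ c ab ca' _ ndb DE F f
  dF cf (M - F a)) => //.
- by move=> x; rewrite /= in_itv/= andbT; exact: f0.
- by move=> n; rewrite lerB// FM// lerDl.
Qed.

Lemma FTCy a L : c < a -> mu.-integrable `[a, +oo[ (EFin \o f) ->
  F (a + n.+1%:R) @[n --> \oo] --> L ->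
  \int[mu]_(x in `[a, +oo[) f x = L - F a.
Proof.
move=> ca fi FL; have [ab ca' ndb DE] := bnd_cvg ca.
apply: (@FTC_exhaustion _ (fun=> a) _ _ c ab ca' _ ndb DE F f dF cf (F a) L fi) => //.
exact: cvg_cst.
Qed.

End half_line_exhaustion.

Section origin_exhaustion.
Context {R : realType}.
Notation mu := (@lebesgue_measure R).
Variables (F f : R -> R).
Hypothesis dF : forall x : R, 0 < x -> is_derive x 1 F (f x).
Hypothesis cf : forall x : R, 0 < x -> {for x, continuous f}.

Let bnd_cvg :
  [/\ forall n, (n.+2%:R)^-1 < 1 :> R, forall n, 0 < (n.+2%:R)^-1 :> R,
    {homo (fun n => (n.+2%:R)^-1 : R) : m n / (m <= n)%N >-> (n <= m)} &
   `]0%R, 1%R]%classic = \bigcup_n `[(n.+2%:R)^-1 : R, 1]%classic].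
Proof.
split.
- by move=> n; rewrite invf_lt1// ltr1n.
- by move=> n; rewrite invr_gt0.
- by move=> m n mn; rewrite lef_pV2 ?posrE// ler_nat !ltnS.
- apply/seteqP; split => x /=; rewrite in_itv/=.
    move=> /andP[x0 x1]; have [n xn] : exists n, x^-1 <= n%:R.
      by exists (Num.trunc `|x^-1|).+1; apply/(le_trans (ler_norm _))/ltW/truncnS_gt.
    exists n => //=; rewrite in_itv/= x1 andbT -[leRHS]invrK lef_pV2 ?posrE ?invr_gt0//.
    by rewrite (le_trans xn)// ler_nat (leq_trans _ (leqnSn _)).
  move=> [n _] /=; rewrite in_itv/= => /andP[+ ->]; rewrite andbT.
  by apply: lt_le_trans; rewrite invr_gt0.
Qed.

Lemma ge0_FTC0_integrable m : (forall x, 0 < x <= 1 -> 0 <= f x) ->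
  (forall x, 0 < x <= 1 -> m <= F x) ->
  mu.-integrable `]0, 1] (EFin \o f).
Proof.
move=> f0 Fm; have [ab ca nda DE] := bnd_cvg.
apply: (@ge0_FTC_exhaustion_integrable _ _ (fun=> 1) _ 0 ab ca nda _ DE F f
  dF cf (F 1 - m)) => //.
by move=> n; rewrite lerB// Fm// ca ltW.
Qed.

Lemma FTC0 l : mu.-integrable `]0, 1] (EFin \o f) ->
  F (n.+2%:R^-1) @[n --> \oo] --> l ->
  \int[mu]_(x in `]0, 1]) f x = F 1 - l.
Proof.
move=> fi Fl; have [ab ca nda DE] := bnd_cvg.
apply: (@FTC_exhaustion _ _ (fun=> 1) _ 0 ab ca nda _ DE F f dF cf l (F 1) fi) => //.
exact: cvg_cst.
Qed.

End origin_exhaustion.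

(** * Densities and changes of variables *)
Section density.
Local Open Scope ereal_scope.
Context {R : realType}.
Notation mu := (@lebesgue_measure R).
Variables (nu : {measure set R -> \bar R}) (g : R -> R).
Hypothesis g0 : forall x, (0 <= g x)%R.
Hypothesis mg : measurable_fun setT g.
Hypothesis nuE : forall A, measurable A -> nu A = \int[mu]_(x in A) (g x)%:E.
Implicit Type f : R -> \bar R.

Import HBNNSimple.

Let indic_density (A : set R) : measurable A ->
  \int[mu]_x ((\1_A x)%:E * (g x)%:E) = nu A.
Proof.
move=> mA; rewrite nuE// [RHS]integral_mkcond; apply: eq_integral => x _.
by rewrite patchE indicE; case: (x \in A); rewrite ?mul1e ?mul0e.
Qed.

(** Both sides agree on indicators by the definition of nu, hence on simple
    functions, and monotone convergence along a sequence of simple functions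
    settles the general case. *)
Lemma ge0_integral_density f : (forall x, 0 <= f x) -> measurable_fun setT f ->
  \int[nu]_x f x = \int[mu]_x (f x * (g x)%:E).
Proof.
move=> f0 mf; pose h := nnsfun_approx measurableT mf.
have hf x : (h n x)%:E @[n --> \oo] --> f x.
  exact: (@cvg_nnsfun_approx _ _ _ _ measurableT f mf (fun x _ => f0 x) x).
have hnd x : {homo (fun n => (h n x)) : m n / (m <= n)%N >-> (m <= n)%R}.
  by move=> m n mn; exact/lefP/nd_nnsfun_approx.
have mh n : measurable_fun setT (fun x => (h n x)%:E) by exact/measurable_EFinP.
have mgE : measurable_fun setT (fun x => (g x)%:E) by exact/measurable_EFinP.
have mhg n : measurable_fun setT (fun x => (h n x)%:E * (g x)%:E).
  exact: emeasurable_funM.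
transitivity (limn (fun n => \int[nu]_x (h n x)%:E)).
  rewrite -monotone_convergence//.
  - by apply: eq_integral => x _; exact/esym/cvg_lim.
  - by move=> n x _; rewrite lee_fin.
  - by move=> x _ m n mn; rewrite lee_fin hnd.
transitivity (limn (fun n => \int[mu]_x ((h n x)%:E * (g x)%:E))); last first.
  rewrite -monotone_convergence//.
  - apply: eq_integral => x _; apply/cvg_lim => //; exact: cvgeZr.
  - by move=> n x _; rewrite mule_ge0 ?lee_fin.
  - by move=> x _ m n mn; rewrite lee_wpmul2r ?lee_fin// hnd.
congr (limn _); apply/funext => n.
have sumE x : (h n x)%:E = \sum_(y \in range (h n)) (y * \1_(h n @^-1` [set y]) x)%:E.
  by rewrite fimfunE -fsumEFin.
transitivity (\sum_(y \in range (h n)) (y%:E * nu (h n @^-1` [set y]))).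
  under eq_integral do rewrite sumE.
  rewrite ge0_integral_fsum//; last by move=> y x _; exact: nnfun_muleindic_ge0.
  - apply: eq_fsbigr => y _.
    under eq_integral do rewrite EFinM.
    by rewrite integralZl_indic_nnsfun// integral_indic// setIT.
  - move=> y; apply/measurable_EFinP; exact: measurable_funM.
transitivity (\int[mu]_x \sum_(y \in range (h n))
    (y%:E * ((\1_(h n @^-1` [set y]) x)%:E * (g x)%:E))); last first.
  apply: eq_integral => x _; rewrite sumE ge0_mule_fsuml//.
    by apply: eq_fsbigr => y _; rewrite EFinM muleA.
  by move=> y; exact: nnfun_muleindic_ge0.
have mig y : measurable_fun [set: R]
    (fun x => (\1_(h n @^-1` [set y]) x)%:E * (g x)%:E).
  by apply: emeasurable_funM; exact/measurable_EFinP.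
have mig2 y : measurable_fun [set: R]
    (fun x => y%:E * ((\1_(h n @^-1` [set y]) x)%:E * (g x)%:E)).
  exact: measurable_funeM.
rewrite ge0_integral_fsum//.
- apply: eq_fsbigr => y /set_mem[x _ <-].
  rewrite ge0_integralZl//; [by rewrite indic_density|exact: (mig (h n x))
    |by move=> z _; rewrite mule_ge0// lee_fin|by rewrite lee_fin].
- move=> y x _; rewrite -!EFinM lee_fin mulrA mulr_ge0//.
  by have := nnfun_muleindic_ge0 (h n) y x; rewrite lee_fin.
Qed.

Lemma integral_density f : measurable_fun setT f ->
  \int[nu]_x f x = \int[mu]_x (f x * (g x)%:E).
Proof.
move=> mf; rewrite [LHS]integralE [RHS]integralE.
rewrite !ge0_integral_density//; [|exact: measurable_funeneg|exact: measurable_funepos].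
congr (_ - _); apply: eq_integral => x _.
  by rewrite funeposE funeposE maxe_pMl ?lee_fin// mul0e.
by rewrite !funenegE -mulNe maxe_pMl ?lee_fin// mul0e.
Qed.

Lemma integrable_density f : measurable_fun setT f ->
  nu.-integrable setT f <-> mu.-integrable setT (fun x => f x * (g x)%:E).
Proof.
move=> mf; have mfg : measurable_fun setT (fun x => f x * (g x)%:E).
  by apply: emeasurable_funM => //; exact/measurable_EFinP.
have E : \int[nu]_x `|f x| = \int[mu]_x `|f x * (g x)%:E|.
  rewrite ge0_integral_density//; last exact: measurableT_comp.
  by apply: eq_integral => x _; rewrite abseM (@gee0_abs _ (g x)%:E)// lee_fin.
by split => /integrableP[_ fi]; apply/integrableP; split; rewrite // ?E// -E.
Qed.

End density.

Section transport.
Context d (T : measurableType d) (R : realType).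
Variables (mu : {measure set T -> \bar R}) (D D' : set T) (phi : T -> T) (c : R).
Hypothesis mD' : measurable D'.
Hypothesis c0 : 0 <= c.
Hypothesis ge0_transport : forall f : T -> \bar R,
  (forall x, 0 <= f x)%E -> measurable_fun setT f ->
  (\int[mu]_(x in D) f x = c%:E * \int[mu]_(x in D') f (phi x))%E.

(** The positive and negative parts are transported separately; this serves for
    dilations and for the reflection of the half-line. *)
Lemma integrable_transport (f : T -> R) : measurable_fun setT f ->
  mu.-integrable D' (EFin \o (f \o phi)) ->
  mu.-integrable D (EFin \o f) /\
  \int[mu]_(x in D) f x = c * \int[mu]_(x in D') f (phi x).
Proof.
move=> mf fi; have mfe : measurable_fun setT (EFin \o f) by exact/measurable_EFinP.
split.
  apply/integrableP; split; first exact: measurable_funTS.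
  rewrite (ge0_transport (f := fun x => `|(f x)%:E|%E))//; last exact: measurableT_comp.
  move/integrableP : fi => [_ fi].
  by rewrite lte_mul_pinfty.
rewrite /Rintegral [X in fine X]integralE [X in _ = _ * fine X]integralE.
rewrite [X in fine (X - _)%E](@ge0_transport ((EFin \o f)^\+)%E)//; last exact: measurable_funepos.
rewrite [X in fine (_ - X)%E](@ge0_transport ((EFin \o f)^\-)%E)//; last exact: measurable_funeneg.
rewrite [X in fine (_ * X - _)%E](_ : _ =
    \int[mu]_(x in D') (EFin \o (f \o phi))^\+ x)%E; last first.
  by apply: eq_integral => x _; rewrite !funeposE.
rewrite [X in fine (_ - _ * X)%E](_ : _ =
    \int[mu]_(x in D') (EFin \o (f \o phi))^\- x)%E; last first.
  by apply: eq_integral => x _; rewrite !funenegE.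
have /fineK <- : (\int[mu]_(x in D') (EFin \o (f \o phi))^\+ x \is a fin_num)%E.
  exact: integrable_pos_fin_num fi.
have /fineK <- : (\int[mu]_(x in D') (EFin \o (f \o phi))^\- x \is a fin_num)%E.
  exact: integrable_neg_fin_num fi.
by rewrite -!EFinM -!EFinB/= mulrBr.
Qed.

End transport.

Section dilation.
Local Open Scope ereal_scope.
Context {R : realType}.
Notation mu := (@lebesgue_measure R).
Variable s : R.
Hypothesis s0 : (0 < s)%R.

Let phi : measurableTypeR R -> measurableTypeR R := ( *%R s).
Let mphi : measurable_fun setT phi.
Proof. by apply: measurable_funM => //; exact: measurable_cst. Qed.

Let m : {measure set (measurableTypeR R) -> \bar R} :=
  mscale (NngNum (ltW s0))
    (measure_function_pushforward__canonical__measure_function_Measure mu mphi).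

Let dilation_itv : phi @^-1` `]0%R, +oo[%classic = `]0%R, +oo[%classic.
Proof. by apply/seteqP; split => x /=; rewrite !in_itv/= !andbT pmulr_rgt0. Qed.

Let dilation_measure (A : set (measurableTypeR R)) : measurable A -> mu A = m A.
Proof.
apply: lebesgue_measure_unique => _ [[a b]] _ <-.
rewrite /m /= /mscale /= /pushforward.
have -> : phi @^-1` `]a, b]%classic = `](a / s)%R, (b / s)%R]%classic.
  by apply/seteqP; split => x /=; rewrite !in_itv/= ltr_pdivrMr// ler_pdivlMr// mulrC.
rewrite !lebesgue_measure_itv/= !lte_fin ltr_pM2r ?invr_gt0//.
case: ifPn => _; last by rewrite mule0.
by rewrite -!EFinB -EFinM; congr (_%:E); field; rewrite gt_eqF.
Qed.

Lemma ge0_integral_dilation (f : R -> \bar R) : (forall x, 0 <= f x) ->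
  measurable_fun setT f ->
  \int[mu]_(x in `]0%R, +oo[) f x = s%:E * \int[mu]_(x in `]0%R, +oo[) f (s * x)%R.
Proof.
move=> f0 mf.
transitivity (\int[m]_(x in `]0%R, +oo[) f x).
  by apply: eq_measure_integral => A mA _; exact: dilation_measure.
rewrite ge0_integral_mscale//=; last exact: measurable_funTS.
congr (_ * _); rewrite (ge0_integral_pushforward mphi)//=; last exact: measurable_funTS.
by rewrite dilation_itv.
Qed.

Lemma integral_dilation (f : R -> R) : measurable_fun setT f ->
  mu.-integrable `]0%R, +oo[ (fun x => (f (s * x))%:E) ->
  mu.-integrable `]0%R, +oo[ (EFin \o f) /\
  (\int[mu]_(x in `]0%R, +oo[) f x = s * \int[mu]_(x in `]0%R, +oo[) f (s * x))%R.
Proof.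
move=> mf fi; apply: (@integrable_transport _ _ R mu `]0%R, +oo[ `]0%R, +oo[ ( *%R s) s _ _ _ f mf fi) => //.
  exact: ltW.
exact: ge0_integral_dilation.
Qed.

End dilation.

(** * Integrability of powers and exponentials *)
Section power_integrals.
Context {R : realType}.
Notation mu := (@lebesgue_measure R).

Lemma continuous_powR_gt0 (p x : R) : 0 < x -> {for x, continuous (fun u => u `^ p)}.
Proof.
by move=> x0; apply/differentiable_continuous/derivable1_diffP; have [] := is_derive1_powR p x0.
Qed.

Let dpow (p : R) : p != -1 -> forall x : R, 0 < x ->
  is_derive x 1 (fun u => (p + 1)^-1 * u `^ (p + 1)) (x `^ p).
Proof.
move=> p1 x x0; have h := is_derive1_powR (p + 1) x0.
have p10 : p + 1 != 0 by rewrite addr_eq0.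
by apply: is_derive_eq; rewrite /GRing.scale /= addrK mulrA mulVf// mul1r.
Qed.

Lemma integrable_powR0 (p : R) : -1 < p ->
  mu.-integrable `]0%R, 1%R] (fun u => (u `^ p)%:E).
Proof.
move=> p1; apply: (@ge0_FTC0_integrable _ _ _ (@dpow p _) _ 0).
- by rewrite gt_eqF.
- exact: continuous_powR_gt0.
- by move=> x _; exact: powR_ge0.
- move=> x _; rewrite mulr_ge0// ?powR_ge0// invr_ge0; lra.
Qed.

Lemma integrable_powRy (p : R) : p < -1 ->
  mu.-integrable `[1%R, +oo[ (fun u => (u `^ p)%:E).
Proof.
move=> p1; apply: (@ge0_FTCy_integrable _ _ _ 0 (@dpow p _) _ 1 0).
- by rewrite lt_eqF.
- exact: continuous_powR_gt0.
- by [].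
- by move=> x _; exact: powR_ge0.
- move=> x _; rewrite nmulr_rle0 ?powR_ge0// invr_lt0; lra.
Qed.

Lemma integrable_expRN (p : R) : 0 < p ->
  mu.-integrable `[0%R, +oo[ (fun u => (expR (- (p * u)))%:E).
Proof.
move=> p0.
have dE (x : R) : -1 < x ->
    is_derive x 1 (fun u => - p^-1 * expR (- (p * u))) (expR (- (p * x))).
  move=> _; apply: is_derive_eq; rewrite /GRing.scale/=.
  by field; rewrite gt_eqF.
apply: (@ge0_FTCy_integrable _ _ _ (-1) dE _ 0 0) => //.
- move=> x _; apply: continuous_comp; last exact: continuous_expR.
  by apply: continuousN; apply: continuousM; [exact: cst_continuous|exact: cvg_id].
- by move=> x _; rewrite mulNr oppr_le0 mulr_ge0 ?expR_ge0// invr_ge0 ltW.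
Qed.

End power_integrals.

Section reflection.
Context {R : realType}.
Notation mu := (@lebesgue_measure R).

Lemma integral_reflection (f : R -> R) : measurable_fun setT f ->
  mu.-integrable `]0%R, +oo[ (fun x => (f (- x))%:E) ->
  mu.-integrable `]-oo, 0%R[ (EFin \o f) /\
  \int[mu]_(x in `]-oo, 0%R[) f x = \int[mu]_(x in `]0%R, +oo[) f (- x).
Proof.
move=> mf fi; rewrite -[RHS]mul1r.
apply: (@integrable_transport _ _ R mu `]-oo, 0%R[ `]0%R, +oo[ -%R 1 _ _ _ f mf fi) => // {mf fi}f f0 mf.
rewrite mul1e (_ : `]0%R, +oo[%classic =
    (-%R : _ -> measurableTypeR R) @^-1` `]-oo, 0%R[); last first.
  by apply/seteqP; split => x /=; rewrite !in_itv/= ?andbT oppr_lt0.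
rewrite -ge0_integral_pushforward//=; last exact: measurable_funS mf.
by apply: eq_measure_integral => //= A mA AS; exact/esym/lebesgue_measureN.
Qed.

End reflection.

Section integrable_union.
Context d (T : measurableType d) (R : realType).
Variables (mu : {measure set T -> \bar R}) (A B : set T).

Lemma integrable_setUR (f : T -> R) : measurable A -> measurable B ->
  [disjoint A & B] ->
  mu.-integrable A (EFin \o f) -> mu.-integrable B (EFin \o f) ->
  mu.-integrable (A `|` B) (EFin \o f).
Proof.
move=> mA mB AB /integrableP[mfA fA] /integrableP[mfB fB].
have mf : measurable_fun (A `|` B) (EFin \o f) by exact/measurable_funU.
apply/integrableP; split => //.
rewrite ge0_integral_setU//; last exact: measurableT_comp.
exact: lte_add_pinfty.
Qed.

End integrable_union.

(** * Integration against the stable Levy measure *)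
Section levy_integrals.
Context {R : realType}.
Variables (alpha dlt : R) (m1 m2 : {nonneg R}).
Hypothesis alpha02 : 0 < alpha < 2.
Hypothesis dlt0 : 0 < dlt.
Hypothesis dltalpha : dlt < alpha.
Hypothesis dlt1 : dlt <= 1.
Notation mu := (@lebesgue_measure R).
Notation nu := (levy_measure alpha m1 m2).
Notation half := (`]0%R, +oo[%classic : set R).

Definition levy_weight (u : R) : R := u `^ (- (1 + alpha)).

(** The universal dominating function: quadratic near 0, as needed with
    alpha < 2, and of order |u|^dlt with dlt < alpha at infinity. *)
Definition levy_dom (u : R) : R := Num.min (u ^+ 2) (`|u| `^ dlt).

Lemma levy_weight_ge0 u : 0 <= levy_weight u. Proof. exact: powR_ge0. Qed.

Lemma levy_dom_ge0 u : 0 <= levy_dom u.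
Proof. by rewrite le_min sqr_ge0 powR_ge0. Qed.

Lemma levy_domN u : levy_dom (- u) = levy_dom u.
Proof. by rewrite /levy_dom sqrrN normrN. Qed.

Lemma levy_dom_small u : `|u| <= 1 -> levy_dom u = u ^+ 2.
Proof.
move=> u1; apply/min_idPl; have [->|u0] := eqVneq u 0.
  by rewrite expr0n/= powR_ge0.
rewrite -[leLHS]ger0_norm ?sqr_ge0// normrX -powR_mulrn//.
by apply: ger_powR; [rewrite normr_gt0 u0|rewrite (le_trans dlt1)// ler1n].
Qed.

Lemma levy_dom_large u : 1 <= `|u| -> levy_dom u = `|u| `^ dlt.
Proof.
move=> u1; apply/min_idPr.
rewrite -[leRHS]ger0_norm ?sqr_ge0// normrX -powR_mulrn//.
by apply: ler_powR => //; rewrite (le_trans dlt1)// ler1n.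
Qed.

Lemma le_levy_dom (k C u : R) : 0 <= C ->
  (`|u| <= 1 -> `|k| <= C * u ^+ 2) -> (1 < `|u| -> `|k| <= C * `|u| `^ dlt) ->
  `|k| <= C * levy_dom u.
Proof.
move=> C0 ks kl; have [u1|u1] := leP `|u| 1.
  by rewrite levy_dom_small// ks.
by rewrite levy_dom_large ?(ltW u1)// kl.
Qed.

Lemma measurable_levy_dom : measurable_fun setT levy_dom.
Proof.
apply: measurable_minr; first exact: measurable_funX.
by apply: (measurableT_comp (measurable_powR _)).
Qed.

Lemma measurable_levy_weight : measurable_fun setT levy_weight.
Proof. exact: measurable_powR. Qed.

Lemma integrable_levy_dom : mu.-integrable half (fun u => (levy_dom u * levy_weight u)%:E).
Proof.
have mdw (D : set R) : measurable_fun D (fun u => levy_dom u * levy_weight u).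
  apply: measurable_funTS; apply: measurable_funM.
    exact: measurable_levy_dom.
  exact: measurable_levy_weight.
have -> : half = `]0%R, 1%R] `|` `]1%R, +oo[.
  by rewrite -itv_bndbnd_setU//= bnd_simp.
apply: integrable_setUR => //.
- apply/disj_setPS => x [] /=; rewrite !in_itv/= => /andP[_ x1] /andP[]; rewrite ltNge x1//.
- have p1 : -1 < 1 - alpha by move: alpha02 => ?; lra.
  apply: (dominated_integrableR _ _ (integrable_powR0 p1)) => //; first exact: mdw.
  move=> u; rewrite /= in_itv/= => /andP[u0 u1].
  rewrite ger0_norm ?mulr_ge0 ?levy_dom_ge0 ?levy_weight_ge0// levy_dom_small ?gtr0_norm//.
  rewrite -powR_mulrn ?(ltW u0)// -powRD; last by rewrite (gt_eqF u0) implybT.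
  have -> : 2%:R - (1 + alpha) = 1 - alpha by ring.
  exact: lexx.
- have p1 : dlt - (1 + alpha) < -1 by move: dltalpha => ?; lra.
  have ip : mu.-integrable `]1%R, +oo[ (fun u => (u `^ (dlt - (1 + alpha)))%:E).
    apply: integrableS (integrable_powRy p1) => //.
    by apply: subset_itvr; rewrite bnd_simp.
  apply: (dominated_integrableR _ _ ip) => //; first exact: mdw.
  move=> u; rewrite /= in_itv/= andbT => u1; have u0 : 0 < u by lra.
  rewrite ger0_norm ?mulr_ge0 ?levy_dom_ge0 ?levy_weight_ge0// levy_dom_large ?gtr0_norm// ?(ltW u1)//.
  by rewrite -powRD ?lexx// (gt_eqF u0) implybT.
Qed.

End levy_integrals.

Section integrable_linear.
Context d (T : measurableType d) (R : realType).
Variables (mu : {measure set T -> \bar R}) (D : set T).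
Hypothesis mD : measurable D.
Implicit Types f g : T -> R.

Lemma integrableZlR f (k : R) : mu.-integrable D (EFin \o f) ->
  mu.-integrable D (fun x => (k * f x)%:E).
Proof. by move=> fi; have := integrableZl mD k fi; apply: eq_integrable. Qed.

Lemma integrableDR f g : mu.-integrable D (EFin \o f) ->
  mu.-integrable D (EFin \o g) -> mu.-integrable D (fun x => (f x + g x)%:E).
Proof. by move=> fi gi; have := integrableD mD fi gi; apply: eq_integrable. Qed.

Lemma integrable_patchR f : mu.-integrable D (EFin \o f) ->
  mu.-integrable setT (EFin \o (f \_ D)).
Proof.
by move=> fi; rewrite -restrict_EFin; apply/integrable_restrict => //; rewrite setTI.
Qed.

End integrable_linear.

Section levy_split.
Context {R : realType}.
Variables (alpha dlt : R) (m1 m2 : {nonneg R}).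
Hypothesis alpha02 : 0 < alpha < 2.
Hypothesis dlt0 : 0 < dlt.
Hypothesis dltalpha : dlt < alpha.
Hypothesis dlt1 : dlt <= 1.
Notation mu := (@lebesgue_measure R).
Notation nu := (levy_measure alpha m1 m2).
Notation half := (`]0%R, +oo[%classic).
Notation wt := (levy_weight alpha).
Notation dom := (levy_dom dlt).

Lemma half_integrable (k : R -> R) C : measurable_fun setT k ->
  (forall u, 0 < u -> `|k u| <= C * dom u) ->
  mu.-integrable half (fun u => (k u * wt u)%:E).
Proof.
move=> mk kC.
have ig : mu.-integrable half (fun u => (C * (dom u * wt u))%:E).
  by apply: integrableZlR => //; exact: integrable_levy_dom.
apply: (dominated_integrableR _ _ ig) => //.
  apply: measurable_funTS; apply: measurable_funM => //.
  exact: measurable_levy_weight.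
move=> u; rewrite /= in_itv/= andbT => u0.
by rewrite normrM (ger0_norm (levy_weight_ge0 _ _)) mulrA ler_wpM2r ?levy_weight_ge0// kC.
Qed.

(** Integrals against the Levy measure are handled as Lebesgue integrals over
    ]0, +oo[ with weight u^(- 1 - alpha), the negative jumps being reflected. *)
Lemma levy_split (k : R -> R) C : measurable_fun setT k ->
  (forall u, `|k u| <= C * dom u) ->
  nu.-integrable setT (EFin \o k) /\
  \int[nu]_u k u = m1%:num * (\int[mu]_(u in half) (k u * wt u))
                 + m2%:num * (\int[mu]_(u in half) (k (- u) * wt u)).
Proof.
move=> mk kC.
have mkN : measurable_fun setT (fun u : R => k (- u)).
  by apply: (measurableT_comp mk); exact: measurable_funN.
pose q u := k u * wt (- u).
have mq : measurable_fun setT q.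
  apply: measurable_funM => //.
  by apply: (measurableT_comp (measurable_levy_weight _)); exact: measurable_funN.
have kdE u : k u * levy_density alpha m1 m2 u =
    m1%:num * ((fun v => k v * wt v) \_ half) u
    + m2%:num * (q \_ `]-oo, 0%R[) u.
  rewrite /levy_density !indicE !patchE /q /levy_weight !powRN.
  rewrite mulrDr; congr (_ + _).
    by case: ifP => _; rewrite ?mulr1 ?mulr0// mulrCA.
  case: ifPn => [/set_mem/=|_]; last by rewrite !mulr0.
  by rewrite in_itv/= => u0; rewrite ltr0_norm// mulr1 mulrCA.
have ip : mu.-integrable half (fun u => (k u * wt u)%:E).
  by apply: (half_integrable (C := C)).
have iq' : mu.-integrable half (fun u => (q (- u))%:E).
  have : mu.-integrable half (fun u => (k (- u) * wt u)%:E).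
    by apply: (half_integrable (C := C)) => // u _; rewrite -(levy_domN dlt u).
  by apply: eq_integrable => // u _; rewrite /q opprK.
have [iq qE] := integral_reflection mq iq'.
have ip3 : mu.-integrable setT (EFin \o ((fun v => k v * wt v) \_ half)).
  exact: integrable_patchR.
have iq3 : mu.-integrable setT (EFin \o (q \_ `]-oo, 0%R[)).
  exact: integrable_patchR.
have ip2 := integrableZlR measurableT m1%:num ip3.
have iq2 := integrableZlR measurableT m2%:num iq3.
have dens A : measurable A ->
    nu A = (\int[mu]_(u in A) (levy_density alpha m1 m2 u)%:E)%E by [].
have mke : measurable_fun setT (EFin \o k) by exact/measurable_EFinP.
split.
  apply/(integrable_density (levy_density_ge0 alpha m1 m2)
      (measurable_levy_density alpha m1 m2) dens mke).
  apply: eq_integrable (integrableDR _ ip2 iq2) => // u _.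
  by rewrite /= -EFinM kdE.
rewrite {1}/Rintegral (integral_density (levy_density_ge0 alpha m1 m2)
      (measurable_levy_density alpha m1 m2) dens mke)/=.
under eq_integral do rewrite -EFinM kdE.
rewrite -/(Rintegral _ _ _) (RintegralD _ ip2 iq2)//.
rewrite (RintegralZl _ measurableT ip3) (RintegralZl _ measurableT iq3).
rewrite -!Rintegral_mkcond qE; congr (_ + _ * _).
by apply: eq_Rintegral => u _; rewrite /q opprK.
Qed.

Lemma integrable_levy_dom_nu : nu.-integrable setT (fun u => (dom u)%:E).
Proof.
apply: (levy_split (C := 1) (measurable_levy_dom _) _).1 => u.
by rewrite mul1r ger0_norm// levy_dom_ge0.
Qed.

End levy_split.

(** * First-order Taylor bounds *)
Section calculus.
Context {R : realType}.
Implicit Types f : R -> R.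

Lemma ler_lipschitz f (f' : R -> R) (C : R) : (forall x : R, is_derive x 1 f (f' x)) ->
  (forall x, `|f' x| <= C) -> forall x y, `|f y - f x| <= C * `|y - x|.
Proof.
move=> df f'C.
suff H x y : x < y -> `|f y - f x| <= C * `|y - x|.
  move=> x y; case: (ltgtP x y) => [| |->]; [exact: H| |by rewrite !subrr normr0 mulr0].
  by move/H; rewrite distrC (distrC y).
move=> xy; have [|c _ ->] := @MVT R f f' x y xy (fun z _ => df z).
  apply: derivable_within_continuous => z _.
  by have [] := df z.
by rewrite normrM ler_wpM2r.
Qed.

Lemma ler_taylor1 f (f' : R -> R) (C : R) : (forall x : R, is_derive x 1 f (f' x)) ->
  (forall x y, `|f' y - f' x| <= C * `|y - x|) ->
  forall x v, `|f (x + v) - f x - v * f' x| <= C * v ^+ 2.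
Proof.
move=> df f'C x v.
have C0 : 0 <= C by have := f'C 0 1; rewrite subr0 normr1 mulr1; exact: le_trans.
suff [c cv ->] : exists2 c, `|c - x| <= `|v| & f (x + v) - f x = f' c * v.
  rewrite [v * _]mulrC -mulrBl normrM -[v ^+ 2]ger0_norm ?sqr_ge0// normrX expr2 mulrA.
  by rewrite ler_wpM2r// (le_trans (f'C _ _))// ler_wpM2l.
have cf a b : {within `[a, b], continuous f}.
  by apply: derivable_within_continuous => z _; have [] := df z.
case: (ltgtP 0 v) => [v0|v0|<-].
- have [|c] := @MVT R f f' x (x + v) _ (fun z _ => df z) (cf _ _); first by rewrite ltrDl.
  rewrite in_itv/= => /andP[xc cx] ->; exists c; last by rewrite addrAC subrr add0r.
  by rewrite !gtr0_norm ?subr_gt0//; lra.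
- have [|c] := @MVT R f f' (x + v) x _ (fun z _ => df z) (cf _ _); first by rewrite gtrDl.
  rewrite in_itv/= => /andP[xc cx] E; exists c.
    by rewrite !ltr0_norm ?subr_lt0//; lra.
  by apply: oppr_inj; rewrite opprB E; ring.
- by exists x; rewrite ?subrr ?normr0// addr0 subrr mulr0.
Qed.

Lemma cos_le1n (x : R) : `|cos x| <= 1.
Proof. by rewrite ler_norml cos_geN1 cos_le1. Qed.

Lemma sin_le1n (x : R) : `|sin x| <= 1.
Proof. by rewrite ler_norml sin_geN1 sin_le1. Qed.

Lemma lipschitz_sin (x y : R) : `|sin y - sin x| <= `|y - x|.
Proof.
by rewrite -[leRHS]mul1r; apply: (ler_lipschitz (@is_derive_sin R)); exact: cos_le1n.
Qed.

Lemma lipschitz_cos (x y : R) : `|cos y - cos x| <= `|y - x|.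
Proof.
rewrite -[leRHS]mul1r; apply: (ler_lipschitz (@is_derive_cos R)) => z.
by rewrite normrN sin_le1n.
Qed.

Lemma ler_norm_sinB (x : R) : `|sin x - x| <= x ^+ 2.
Proof.
have := @ler_taylor1 sin cos 1 (@is_derive_sin R) _ 0 x.
rewrite add0r sin0 cos0 mulr1 subr0 mul1r; apply=> a b.
by rewrite mul1r lipschitz_cos.
Qed.

Lemma ler_norm_cosB1 (x : R) : `|cos x - 1| <= x ^+ 2.
Proof.
have := @ler_taylor1 cos (fun x => - sin x) 1 (@is_derive_cos R) _ 0 x.
rewrite add0r sin0 cos0 oppr0 mulr0 subr0 mul1r; apply=> a b.
by rewrite mul1r -opprB opprK addrC -opprB normrN opprB lipschitz_sin.
Qed.

End calculus.

(** * Scaling of the characteristic exponent *)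
Section levy_symbol.
Context {R : realType}.
Variable alpha : R.
Hypothesis alpha02 : 0 < alpha < 2.
Notation mu := (@lebesgue_measure R).
Notation half := (`]0%R, +oo[%classic).
Notation wt := (levy_weight alpha).
Notation trunc := (\1_[set v : R | `|v| <= 1] : R -> R).

Definition cosint (z : R) : R := \int[mu]_(u in half) ((cos (z * u) - 1) * wt u).

Definition sinint (z : R) : R :=
  \int[mu]_(u in half) ((sin (z * u) - z * u * trunc u) * wt u).

Lemma truncE (s u : R) : \1_[set v : R | `|v| <= s] u = (`|u| <= s)%R%:R :> R.
Proof.
rewrite indicE; case: (boolP (`|u| <= s)) => us; first by rewrite mem_set.
by rewrite memNset//; exact/negP.
Qed.

Lemma measurable_trunc (s : R) : measurable_fun setT (\1_[set v : R | `|v| <= s] : R -> R).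
Proof.
apply: measurable_indic; rewrite (_ : [set _ | _] = `[- s, s]%classic)//.
by apply/seteqP; split => x /=; rewrite in_itv/= ler_norml.
Qed.

(** Interpolation between a bound and a Lipschitz bound: min (1, |y|) is at most
    |y|^dlt. *)
Lemma ler_powR_interpolate (dlt M y : R) : 0 <= dlt <= 1 -> 1 <= M ->
  forall r : R, `|r| <= M -> `|r| <= `|y| -> `|r| <= M * `|y| `^ dlt.
Proof.
move=> /andP[d0 d1] M1 r rM ry; have [y1|y1] := leP `|y| 1.
  have [y0|y0] := eqVneq y 0.
    by move: ry; rewrite y0 normr0 => /le_trans; apply; rewrite mulr_ge0// ?powR_ge0// (le_trans ler01).
  rewrite (le_trans ry)// -[leLHS]mul1r ler_pM// ger1_powR// ?normr_gt0 ?y0//.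
rewrite (le_trans rM)// -[leLHS]mulr1 ler_wpM2l ?(le_trans ler01 M1)//.
by rewrite -(powRr0 `|y|) ler_powR ?(ltW y1).
Qed.

Lemma levy_dom_cos (dlt z u : R) : 0 < dlt -> dlt <= 1 ->
  `|cos (z * u) - 1| <= (z ^+ 2 + 2 * `|z| `^ dlt) * levy_dom dlt u.
Proof.
move=> d0 d1; apply: le_levy_dom => //.
- by rewrite addr_ge0 ?sqr_ge0// mulr_ge0// powR_ge0.
- move=> _; rewrite (le_trans (ler_norm_cosB1 _))// exprMn ler_wpM2r ?sqr_ge0//.
  by rewrite lerDl mulr_ge0// powR_ge0.
- move=> _; apply: (@le_trans _ _ (2 * `|z * u| `^ dlt)).
    apply: ler_powR_interpolate; rewrite ?d1 ?(ltW d0) ?ler1n//.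
      by rewrite (le_trans (ler_normB _ _))// normr1 -[leRHS]/(1 + 1) lerD2r cos_le1n.
    by rewrite -cos0 (le_trans (lipschitz_cos _ _))// subr0.
  rewrite normrM powRM// mulrA ler_wpM2r ?powR_ge0// lerDr ?sqr_ge0//.
Qed.

Lemma levy_dom_sin (dlt z u : R) : 0 < dlt -> dlt <= 1 ->
  `|sin (z * u) - z * u * trunc u| <= (z ^+ 2 + 2 * `|z| `^ dlt) * levy_dom dlt u.
Proof.
move=> d0 d1; rewrite truncE; apply: le_levy_dom => //.
- by rewrite addr_ge0 ?sqr_ge0// mulr_ge0// powR_ge0.
- move=> ->; rewrite mulr1 (le_trans (ler_norm_sinB _))// exprMn ler_wpM2r ?sqr_ge0//.
  by rewrite lerDl mulr_ge0// powR_ge0.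
- move=> u1; rewrite (leNgt `|u| 1) u1/= mulr0 subr0.
  apply: (@le_trans _ _ (2 * `|z * u| `^ dlt)).
    apply: ler_powR_interpolate; rewrite ?d1 ?(ltW d0) ?ler1n//.
      by rewrite (le_trans (sin_le1n _))// ler1n.
    by rewrite -[sin _]subr0 -[X in _ - X]sin0 (le_trans (lipschitz_sin _ _))// subr0.
  rewrite normrM powRM// mulrA ler_wpM2r ?powR_ge0// lerDr ?sqr_ge0//.
Qed.

Lemma measurable_cosint z : measurable_fun setT (fun u : R => cos (z * u) - 1).
Proof.
apply: measurable_funB => //.
apply: (measurableT_comp (continuous_measurable_fun (@continuous_cos R))).
exact: measurable_funM.
Qed.

Lemma measurable_sinint s z :
  measurable_fun setT (fun u : R => sin (z * u) - z * u * \1_[set v : R | `|v| <= s] u).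
Proof.
apply: measurable_funB; last first.
  by apply: measurable_funM; [exact: measurable_funM|exact: measurable_trunc].
apply: (measurableT_comp (continuous_measurable_fun (@continuous_sin R))).
exact: measurable_funM.
Qed.

Let dlt : R := Num.min 1 (alpha / 2).
Let dlt0 : 0 < dlt. Proof. by move: alpha02 => ?; rewrite lt_min ltr01/=; lra. Qed.
Let dlt1 : dlt <= 1. Proof. by rewrite ge_min lexx. Qed.
Let dltalpha : dlt < alpha.
Proof. by move: alpha02 => ?; rewrite gt_min; apply/orP; right; lra. Qed.

Let integrable_cos z : mu.-integrable half (fun u => ((cos (z * u) - 1) * wt u)%:E).
Proof.
apply: (half_integrable alpha02 dltalpha dlt1
  (k := fun u => cos (z * u) - 1) (C := z ^+ 2 + 2 * `|z| `^ dlt)).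
  exact: measurable_cosint.
by move=> u _; exact: levy_dom_cos.
Qed.

Let integrable_sin z :
  mu.-integrable half (fun u => ((sin (z * u) - z * u * trunc u) * wt u)%:E).
Proof.
apply: (half_integrable alpha02 dltalpha dlt1
  (k := fun u => sin (z * u) - z * u * trunc u) (C := z ^+ 2 + 2 * `|z| `^ dlt)).
  exact: measurable_sinint.
by move=> u _; exact: levy_dom_sin.
Qed.

Let wtM (s u : R) : 0 < s -> 0 < u -> wt (s * u) = s^-1 * s `^ (- alpha) * wt u.
Proof.
move=> s0 u0; rewrite /levy_weight powRM ?(ltW s0) ?(ltW u0)//; congr (_ * _).
rewrite opprD powRD; last by rewrite (gt_eqF s0) implybT.
by rewrite powR_inv1 ?(ltW s0).
Qed.

Lemma cosint_scale (s z : R) : 0 < s -> cosint (s * z) = s `^ alpha * cosint z.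
Proof.
move=> s0.
have E (u : R) : u \in half -> (cos (z * (s * u)) - 1) * wt (s * u) =
    s^-1 * s `^ (- alpha) * ((cos (s * z * u) - 1) * wt u).
  by rewrite inE/= in_itv/= andbT => u0; rewrite wtM// mulrCA !mulrA (mulrC z s).
have mf : measurable_fun setT (fun u => (cos (z * u) - 1) * wt u).
  by apply: measurable_funM; [exact: measurable_cosint|exact: measurable_levy_weight].
have fi : mu.-integrable half (fun u => ((cos (z * (s * u)) - 1) * wt (s * u))%:E).
  have : mu.-integrable half (fun u => (s^-1 * s `^ (- alpha) *
      ((cos (s * z * u) - 1) * wt u))%:E).
    exact: integrableZlR (integrable_cos (s * z)).
  by apply: eq_integrable => // u /E ->.
rewrite [in RHS]/cosint (integral_dilation s0 mf fi).2 (@eq_Rintegral _ _ _ mu half _ _ E).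
rewrite (RintegralZl _ _ (integrable_cos (s * z))); last by [].
rewrite -/(cosint _) powRN !mulrA -(mulrA (s `^ alpha)) divff ?gt_eqF// mulr1 mulfV ?mul1r//.
by rewrite gt_eqF// powR_gt0.
Qed.

(** V is a primitive of s^(- alpha): a power, or the logarithm when alpha = 1.
    Keeping it abstract treats all alpha at once. *)
Variable V : R -> R.
Hypothesis dV : forall s : R, 0 < s -> is_derive s 1 V (s `^ (- alpha)).

Let intV (a b : R) : 0 < a -> a < b ->
  mu.-integrable `]a, b] (fun v => (v `^ (- alpha))%:E) /\
  \int[mu]_(v in `]a, b]) (v `^ (- alpha)) = V b - V a.
Proof.
move=> a0 ab.
have cV x : 0 < x -> {for x, continuous V}.
  by move=> x0; apply/differentiable_continuous/derivable1_diffP; have [] := dV x0.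
have cf : {within `[a, b], continuous (fun v => v `^ (- alpha))}.
  apply: continuous_in_subspaceT => x; rewrite inE/= in_itv/= => /andP[ax _].
  by apply: continuous_powR_gt0; rewrite (lt_le_trans a0).
have fi : mu.-integrable `]a, b] (fun v => (v `^ (- alpha))%:E).
  apply: integrableS (continuous_compact_integrable _ cf) => //.
    by apply: subset_itvr; rewrite bnd_simp.
  exact: segment_compact.
split=> //; rewrite Rintegral_itv_obnd_cbnd// /Rintegral (continuous_FTC2 ab cf (F := V))//.
- split.
  + by move=> x; rewrite in_itv/= => /andP[ax _]; have [] := dV (lt_trans a0 ax).
  + by apply: cvg_at_right_filter; apply: cV.
  + by apply: cvg_at_left_filter; apply: cV; rewrite (lt_trans a0).
- move=> x; rewrite in_itv/= => /andP[ax _].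
  by rewrite derive1E; have [_ ->] := dV (lt_trans a0 ax).
Qed.

Let vwt v : 0 < v -> v * wt v = v `^ (- alpha).
Proof.
move=> v0; rewrite /levy_weight opprD powRD; last by rewrite (gt_eqF v0) implybT.
by rewrite powR_inv1 ?(ltW v0)// mulrA divff ?gt_eqF// mul1r.
Qed.

Let k (s z v : R) := sin (z * v) - z * v * \1_[set w : R | `|w| <= s] v.

(** After the dilation u -> s u the compensator is cut at s instead of 1. *)
Let cut_integral (s z : R) :
  0 < s -> mu.-integrable half (fun u => (k s z u * wt u)%:E) /\
  \int[mu]_(u in half) (k s z u * wt u) = s `^ (- alpha) * sinint (s * z).
Proof.
move=> s0.
have E (u : R) : u \in half -> k s z (s * u) * wt (s * u) =
    s^-1 * s `^ (- alpha) * ((sin (s * z * u) - s * z * u * trunc u) * wt u).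
  rewrite inE/= in_itv/= andbT => u0.
  rewrite wtM// /k !truncE normrM (gtr0_norm s0) -ler_pdivlMl// mulVf ?gt_eqF//.
  by rewrite mulrCA !mulrA (mulrC z s).
have mf : measurable_fun setT (fun u => k s z u * wt u).
  by apply: measurable_funM; [exact: measurable_sinint|exact: measurable_levy_weight].
have fi : mu.-integrable half (fun u => (k s z (s * u) * wt (s * u))%:E).
  have : mu.-integrable half (fun u => (s^-1 * s `^ (- alpha) *
      ((sin (s * z * u) - s * z * u * trunc u) * wt u))%:E).
    exact: integrableZlR (integrable_sin (s * z)).
  by apply: eq_integrable => // u /E ->.
split; first exact: (integral_dilation s0 mf fi).1.
rewrite (integral_dilation s0 mf fi).2 (@eq_Rintegral _ _ _ mu half _ _ E).
rewrite (RintegralZl _ _ (integrable_sin (s * z))); last by [].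
by rewrite -/(sinint _) !mulrA divff ?gt_eqF// mul1r.
Qed.

Let integrable_cut (s : R) : 0 < s -> mu.-integrable half
  (fun v => (v * (trunc v - \1_[set w : R | `|w| <= s] v) * wt v)%:E).
Proof.
move=> s0; have [ik _] := cut_integral 1 s0.
have := integrableB _ ik (integrable_sin 1) => /(_ (measurable_itv _)).
by apply: eq_integrable => // v _; rewrite -EFinB; congr (_%:E); rewrite /k; ring.
Qed.

(** The two cuts differ on the interval between s and 1, where v times the weight
    is v^(- alpha). *)
Let intVind (s : R) : 0 < s ->
  \int[mu]_(v in half) (v * (trunc v - \1_[set w : R | `|w| <= s] v) * wt v) = V 1 - V s.
Proof.
move=> s0.
have Hc (a b : R) : 0 < a -> a < b -> \int[mu]_(v in half)
   (v * (\1_[set w : R | `|w| <= b] v - \1_[set w : R | `|w| <= a] v) * wt v) = V b - V a.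
  move=> a0 ab; rewrite -(intV a0 ab).2.
  have -> : `]a, b]%classic = half `&` `]a, b].
    apply/esym/setIidr => x /=; rewrite !in_itv/= andbT => /andP[ax _].
    exact: lt_trans ax.
  rewrite Rintegral_mkcondr; apply: eq_Rintegral => v; rewrite inE/= in_itv/= andbT => v0.
  rewrite !truncE patchE gtr0_norm// -vwt//.
  case: ifPn => [/set_mem|]/=.
    by rewrite in_itv/= => /andP[av ->]; rewrite (leNgt v a) av/= subr0 mulr1.
  rewrite notin_setE/= in_itv/= => /negP; rewrite negb_and -leNgt.
  case: (leP v a) => [va _|_ /= /negbTE ->]; last by rewrite subrr mulr0 mul0r.
  by rewrite (le_trans va (ltW ab)) subrr mulr0 mul0r.
case: (ltgtP s 1) => [s1|s1|->].
- exact: Hc.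
- rewrite -opprB -(Hc _ _ _ s1)// -[LHS]opprK; congr (- _).
  rewrite -mulN1r -(RintegralZl _ _ (integrable_cut s0))//.
  by apply: eq_Rintegral => v _; ring.
- rewrite subrr; under eq_Rintegral do rewrite subrr mulr0 mul0r.
  by rewrite Rintegral_cst// mul0r.
Qed.

(** Up to the factor s^alpha, dilating changes the cut-off from 1 to s, which
    adds the drift z (V 1 - V s). *)
Lemma sinint_scale (s z : R) : 0 < s ->
  sinint (s * z) = s `^ alpha * (sinint z + z * (V 1 - V s)).
Proof.
move=> s0; have [ik] := cut_integral z s0.
have -> : \int[mu]_(u in half) (k s z u * wt u) = sinint z + z * (V 1 - V s).
  apply/eqP; rewrite -(intVind s0) addrC -subr_eq; apply/eqP.
  rewrite /sinint -(RintegralB _ ik (integrable_sin z)); last by [].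
  rewrite -(RintegralZl _ _ (integrable_cut s0)); last by [].
  by apply: eq_Rintegral => v _; rewrite /k; ring.
move=> ->; rewrite mulrA -powRD ?subrr ?powRr0 ?mul1r//.
by rewrite (gt_eqF s0) implybT.
Qed.

End levy_symbol.

Section levy_symbol_bound.
Context {R : realType}.
Variables (alpha dlt : R) (m1 m2 : {nonneg R}).
Hypothesis alpha02 : 0 < alpha < 2.
Hypothesis dlt0 : 0 < dlt.
Hypothesis dltalpha : dlt < alpha.
Hypothesis dlt1 : dlt <= 1.
Notation mu := (@lebesgue_measure R).
Notation nu := (levy_measure alpha m1 m2).
Notation half := (`]0%R, +oo[%classic).
Notation wt := (levy_weight alpha).
Notation trunc := (\1_[set v : R | `|v| <= 1] : R -> R).

Lemma levy_cosint z :
  nu.-integrable setT (fun u => (cos (z * u) - 1)%:E) /\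
  \int[nu]_u (cos (z * u) - 1) = (m1%:num + m2%:num) * cosint alpha z.
Proof.
have [i ->] := levy_split m1 m2 alpha02 dltalpha dlt1 (measurable_cosint z)
  (fun u => levy_dom_cos z u dlt0 dlt1).
split; first exact: i.
rewrite mulrDl; congr (_ + _ * _).
by apply: eq_Rintegral => u _; rewrite mulrN cosN.
Qed.

Lemma levy_sinint z :
  nu.-integrable setT (fun u => (sin (z * u) - z * u * trunc u)%:E) /\
  \int[nu]_u (sin (z * u) - z * u * trunc u) =
  (m1%:num - m2%:num) * sinint alpha z.
Proof.
have [i ->] := levy_split m1 m2 alpha02 dltalpha dlt1 (measurable_sinint 1 z)
  (fun u => levy_dom_sin z u dlt0 dlt1).
split; first exact: i.
have iS : mu.-integrable half (fun u => ((sin (z * u) - z * u * trunc u) * wt u)%:E).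
  apply: (half_integrable alpha02 dltalpha dlt1 (C := z ^+ 2 + 2 * `|z| `^ dlt)
    (k := fun u => sin (z * u) - z * u * trunc u)).
    exact: measurable_sinint.
  by move=> u _; exact: levy_dom_sin.
rewrite mulrBl; congr (_ + _).
rewrite -mulrN; congr (_ * _); rewrite /sinint -mulN1r -(RintegralZl _ _ iS); last by [].
by apply: eq_Rintegral => u _; rewrite mulrN sinN !truncE normrN; ring.
Qed.

Lemma sinint_bound z : `|sinint alpha z| <= (z ^+ 2 + 2 * `|z| `^ dlt) *
  \int[mu]_(u in half) (levy_dom dlt u * wt u).
Proof.
have id := integrable_levy_dom alpha02 dltalpha dlt1.
rewrite -(RintegralZl _ _ id)//; apply: ler_norm_Rintegral => //.
- apply: measurable_funTS; apply: measurable_funM; first exact: measurable_sinint.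
  exact: measurable_levy_weight.
- exact: integrableZlR.
move=> u _; rewrite normrM (ger0_norm (levy_weight_ge0 _ _)) mulrA.
by rewrite ler_wpM2r ?levy_weight_ge0// levy_dom_sin.
Qed.

End levy_symbol_bound.

(** * Laws of X and of the self-decomposability remainders *)
Lemma integrable_bounded d (T : measurableType d) (R : realType)
    (Q : probability T R) (f : T -> R) (C : R) :
  measurable_fun setT f -> (forall x, `|f x| <= C) ->
  Q.-integrable setT (EFin \o f).
Proof.
move=> mf fC; apply: (dominated_integrableR _ mf (g := cst C)) => //.
exact: finite_measure_integrable_cst.
Qed.

Section characteristic_exponent.
Context {R : realType}.
Variables (alpha beta : R) (m1 m2 : {nonneg R}).
Hypothesis alpha02 : 0 < alpha < 2.
Notation nu := (levy_measure alpha m1 m2).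
Notation trunc := (\1_[set v : R | `|v| <= 1] : R -> R).

Definition exponent_re (z : R) : R := (m1%:num + m2%:num) * cosint alpha z.

Definition exponent_im (z : R) : R :=
  z * beta + (m1%:num - m2%:num) * sinint alpha z.

Lemma cexpM (x y : R[i]) : cexp x = cexp y * cexp (x - y).
Proof.
case: x => a b; case: y => c d.
have [p ->] : exists p, a = c + p by exists (a - c); rewrite addrC subrK.
have [q ->] : exists q, b = d + q by exists (b - d); rewrite addrC subrK.
apply/eqP; rewrite eq_complex /= /cexp/= !(addrAC _ _ (- _)) !subrr !add0r.
rewrite expRD cosD sinD !mul0r !subr0 !addr0.
by apply/andP; split; apply/eqP; ring.
Qed.

Lemma cexp_neq0 (x : R[i]) : cexp x != 0.
Proof.
apply/eqP => E; have : cexp 0 = 0 :> R[i] by rewrite (cexpM 0 x) E mul0r.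
rewrite /cexp /= expR0 cos0 sin0 => /eqP; rewrite eq_complex /=.
by rewrite !mul1r !mul0r subr0 oner_eq0.
Qed.

Lemma cexp_div (x y : R[i]) : cexp x / cexp y = cexp (x - y).
Proof. by rewrite (cexpM x y) mulrAC divff ?mul1r// cexp_neq0. Qed.

Lemma cexp_i (r : R) : cexp ('i * r%:C)%C = (cos r +i* sin r)%C.
Proof.
apply/eqP; rewrite eq_complex /cexp /= !mul0r !mul1r !subr0 !addr0 !add0r expR0.
by rewrite !mul1r !eqxx.
Qed.

Lemma stable_exponentE z :
  stable_exponent alpha beta m1 m2 z = (exponent_re z +i* exponent_im z)%C.
Proof.
pose dlt : R := Num.min 1 (alpha / 2).
have dlt0 : 0 < dlt by move: alpha02 => ?; rewrite lt_min ltr01/=; lra.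
have dlt1 : dlt <= 1 by rewrite ge_min lexx.
have dltalpha : dlt < alpha.
  by move: alpha02 => ?; rewrite gt_min; apply/orP; right; lra.
have rE (u : R) : complex.Re (cexp ('i * (z * u)%:C) - 1
    - 'i * (z * u * \1_[set v | `|v| <= 1] u)%:C)%C = cos (z * u) - 1.
  by rewrite cexp_i /= !mul0r !mul1r !subr0.
have iE (u : R) : complex.Im (cexp ('i * (z * u)%:C) - 1
    - 'i * (z * u * \1_[set v | `|v| <= 1] u)%:C)%C = sin (z * u) - z * u * trunc u.
  by rewrite cexp_i /= !mul0r !mul1r !subr0 !add0r.
have reE : \int[nu]_u complex.Re (cexp ('i * (z * u)%:C) - 1
    - 'i * (z * u * \1_[set v | `|v| <= 1] u)%:C)%C = exponent_re z.
  under eq_Rintegral do rewrite rE.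
  exact: (levy_cosint m1 m2 alpha02 dlt0 dltalpha dlt1 z).2.
have imE : \int[nu]_u complex.Im (cexp ('i * (z * u)%:C) - 1
    - 'i * (z * u * \1_[set v | `|v| <= 1] u)%:C)%C =
    (m1%:num - m2%:num) * sinint alpha z.
  under eq_Rintegral do rewrite iE.
  exact: (levy_sinint m1 m2 alpha02 dlt0 dltalpha dlt1 z).2.
rewrite /stable_exponent /Cintegral reE imE.
apply/eqP; rewrite eq_complex /= !mul0r !mul1r subr0 !add0r.
by rewrite !eqxx.
Qed.

Variables (d : measure_display) (T : measurableType d) (P : probability T R).
Variables (X : {RV P >-> R}) (F : R -> probability R R).
Hypothesis hX : is_stable alpha beta m1 m2 P X.
Hypothesis hF : self_decomp_laws P X F.

Let sincos_law d' (T' : measurableType d') (Q : probability T' R) (Y : T' -> R)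
    (z a b : R) : char_fun Q Y z = cexp (a +i* b)%C ->
  \int[Q]_w cos (z * Y w) = expR a * cos b /\
  \int[Q]_w sin (z * Y w) = expR a * sin b.
Proof.
have rE : complex.Re (char_fun Q Y z) = \int[Q]_w cos (z * Y w).
  transitivity (\int[Q]_w complex.Re (cexp ('i * (z * Y w)%:C))%C) => //.
  by apply: eq_Rintegral => w _; rewrite cexp_i.
have iE : complex.Im (char_fun Q Y z) = \int[Q]_w sin (z * Y w).
  transitivity (\int[Q]_w complex.Im (cexp ('i * (z * Y w)%:C))%C) => //.
  by apply: eq_Rintegral => w _; rewrite cexp_i.
by rewrite -rE -iE => ->; rewrite /cexp /= !mul0r subr0 addr0.
Qed.

(** Only the means of cos (z Y + th) are ever used, and the phase th carries the
    sine along with the cosine. *)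
Let cos_law d' (T' : measurableType d') (Q : probability T' R) (Y : T' -> R)
    (z a b th : R) : measurable_fun setT Y -> char_fun Q Y z = cexp (a +i* b)%C ->
  \int[Q]_w cos (z * Y w + th) = expR a * cos (b + th).
Proof.
move=> mY /sincos_law[cE sE].
have mzY : measurable_fun setT (fun w => z * Y w) by exact: measurable_funM.
have ic : Q.-integrable setT (EFin \o (fun w => cos (z * Y w))).
  apply: (@integrable_bounded _ _ _ _ _ 1); last by move=> w; exact: cos_le1n.
  exact: (measurableT_comp (continuous_measurable_fun (@continuous_cos R))).
have iS : Q.-integrable setT (EFin \o (fun w => sin (z * Y w))).
  apply: (@integrable_bounded _ _ _ _ _ 1); last by move=> w; exact: sin_le1n.
  exact: (measurableT_comp (continuous_measurable_fun (@continuous_sin R))).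
under eq_Rintegral do rewrite cosD mulrC [X in _ - X]mulrC.
rewrite (RintegralB measurableT (integrableZlR measurableT (cos th) ic)
  (integrableZlR measurableT (sin th) iS)).
rewrite (RintegralZl _ measurableT ic) (RintegralZl _ measurableT iS) cE sE cosD.
ring.
Qed.

Lemma cos_law_X z th :
  \int[P]_w cos (z * X w + th) = expR (exponent_re z) * cos (exponent_im z + th).
Proof. by apply: cos_law => //; rewrite hX stable_exponentE. Qed.

Lemma cos_law_F t z th : 0 <= t ->
  \int[F t]_u cos (z * u + th) =
  expR (exponent_re z - exponent_re (expR (- t) * z)) *
  cos (exponent_im z - exponent_im (expR (- t) * z) + th).
Proof.
move=> t0; apply: (@cos_law _ _ _ id) => //.
by rewrite hF// !hX !stable_exponentE cexp_div.
Qed.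

End characteristic_exponent.

(** * Tame functions and the Stein transform *)
Section tame.
Context {R : realType}.
Variable dlt : R.
Implicit Types (C : R) (f : R -> R).

(** A single constant C bounds everything, so that a family is uniformly tame
    when it shares C. The test functions of the theorem are tame, and the
    condition is stable under the approximations below. *)
Definition tame C f : Prop := [/\ forall x : R, derivable f x 1,
  forall x, `|derive1 f x| <= C,
  forall x y, `|derive1 f y - derive1 f x| <= C * `|y - x| &
  forall x y, `|f y - f x| <= C * `|y - x| `^ dlt].

Lemma tame_ge0 C f : tame C f -> 0 <= C.
Proof. by case=> _ h _ _; exact: le_trans (h 0). Qed.

Lemma tame_le C C' f : C <= C' -> tame C f -> tame C' f.
Proof.
move=> CC' [df f1 f2 f3]; split => // x.
- exact: le_trans (f1 x) CC'.
- by move=> y; rewrite (le_trans (f2 x y))// ler_wpM2r.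
- by move=> y; rewrite (le_trans (f3 x y))// ler_wpM2r// powR_ge0.
Qed.

Lemma tame_is_derive C f : tame C f -> forall x : R, is_derive x 1 f (derive1 f x).
Proof. by case=> df _ _ _ x; rewrite derive1E; exact/derivableP. Qed.

Lemma tame_continuous C f : tame C f -> continuous f.
Proof. by case=> df _ _ _ x; exact/differentiable_continuous/derivable1_diffP. Qed.

Lemma lipschitz_continuous C f : (forall x y, `|f y - f x| <= C * `|y - x|) -> continuous f.
Proof.
move=> fC x.
have C0 : 0 <= C by have := fC 0 1; rewrite subr0 normr1 mulr1; exact: le_trans.
have C1 : 0 < C + 1 by rewrite ltr_wpDl.
apply/cvgrPdist_le => /= e e0; near=> y.
rewrite distrC (le_trans (fC _ _))// (@le_trans _ _ ((C + 1) * `|y - x|))//.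
  by rewrite ler_wpM2r// lerDl.
rewrite -ler_pdivlMl// distrC.
by near: y; apply: cvgr_dist_le => //; rewrite mulr_gt0// invr_gt0.
Unshelve. all: by end_near. Qed.

Lemma tame_continuous_derive C f : tame C f -> continuous (derive1 f).
Proof. by case=> _ _ /lipschitz_continuous. Qed.

Lemma tame_taylor C f : tame C f ->
  forall x v, `|f (x + v) - f x - v * (derive1 f) x| <= C * v ^+ 2.
Proof. by move=> tf; apply: ler_taylor1; [exact: tame_is_derive tf|case: tf]. Qed.

End tame.

(** A quadratic remainder identifies the derivative; the derivative of
    [stein_incr] is obtained in this way, without differentiating under the
    integral sign. *)
Lemma quadratic_is_derive {R : realType} (G : R -> R) (C l x : R) :
  (forall v, `|G (x + v) - G x - v * l| <= C * v ^+ 2) -> is_derive x 1 G l.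
Proof.
move=> GC.
have C0 : 0 <= C by have := GC 1; rewrite expr1n mulr1; exact: le_trans.
have C1 : 0 < C + 1 by rewrite ltr_wpDl.
suff cG : h^-1 *: ((G \o shift x) (h *: (1 : R)) - G x) @[h --> (0 : R)^'] --> l.
  by apply: DeriveDef; [apply/cvg_ex; exists l|exact: cvg_lim].
apply/cvgrPdist_le => /= e e0; near=> h.
have h0 : h != 0 by near: h; exact: nbhs_dnbhs_neq.
rewrite [h *: 1]mulr1 [_ *: _]/(_ * _) (addrC h) distrC.
have -> : h^-1 * (G (x + h) - G x) - l = h^-1 * (G (x + h) - G x - h * l).
  by rewrite [RHS]mulrBr mulrA mulVf// mul1r.
rewrite normrM normfV ler_pdivrMl ?normr_gt0//.
rewrite (le_trans (GC _))// -[h ^+ 2]ger0_norm ?sqr_ge0// normrX expr2 mulrA mulrC.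
rewrite ler_wpM2l// (@le_trans _ _ ((C + 1) * `|h|))//.
  by rewrite ler_wpM2r// lerDl.
rewrite -ler_pdivlMl//.
near: h; apply: dnbhs0_le; rewrite mulr_gt0// invr_gt0//.
Unshelve. all: by end_near. Qed.

Section stein_transforms.
Context {R : realType}.
Notation mu := (@lebesgue_measure R).
Notation ray := (`[0%R, +oo[%classic : set R).
Notation trunc := (\1_[set v : R | `|v| <= 1] : R -> R).
Variables (dlt : R) (F : R -> probability R R).
Hypothesis dlt0 : 0 < dlt.
Hypothesis dlt1 : dlt <= 1.

Definition mean_derive (f : R -> R) (x t : R) : R :=
  \int[F t]_u derive1 f (u + x * expR (- t)).

Definition mean_incr (f : R -> R) (x v t : R) : R :=
  \int[F t]_u (f (u + (x + v) * expR (- t)) - f (u + x * expR (- t))).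

(** The increment from x to x + v of a primitive of [stein_sol F f]. The primitive
    itself, a time integral of means of f, need not exist: only differences
    decay in t. *)
Definition stein_incr (f : R -> R) (x v : R) : R :=
  - \int[mu]_(t in ray) mean_incr f x v t.

(** The laws F t are prescribed one t at a time, so the measurability in t of these
    means has to be proved, along with the Stein identity: the means are explicit
    for cosines, and measurability passes to limits. *)
Definition measurable_means (f : R -> R) : Prop :=
  (forall x, measurable_fun ray (mean_derive f x)) /\
  (forall x v, measurable_fun ray (mean_incr f x v)).

Definition time_mass : R := \int[mu]_(t in ray) expR (- (dlt * t)).

Lemma integrable_time : mu.-integrable ray (fun t => (expR (- (dlt * t)))%:E).
Proof. exact: integrable_expRN. Qed.

Lemma time_mass_ge0 : 0 <= time_mass.
Proof. by apply: Rintegral_ge0 => t _; exact: expR_ge0. Qed.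

Lemma expR_time (t : R) : 0 <= t -> expR (- t) <= expR (- (dlt * t)).
Proof. by move=> t0; rewrite ler_expR lerN2 ler_piMl. Qed.

Lemma time_integral_bound (q : R -> R) K : measurable_fun ray q ->
  (forall t, 0 <= t -> `|q t| <= K * expR (- (dlt * t))) ->
  mu.-integrable ray (EFin \o q) /\
  `|\int[mu]_(t in ray) q t| <= K * time_mass.
Proof.
move=> mq qK.
have ig : mu.-integrable ray (EFin \o (fun t => K * expR (- (dlt * t)))).
  exact: integrableZlR integrable_time.
have qK' t : ray t -> `|q t| <= K * expR (- (dlt * t)).
  by rewrite /= in_itv/= andbT; exact: qK.
split; first exact: dominated_integrableR ig qK'.
rewrite /time_mass -(RintegralZl _ _ integrable_time)//.
exact: ler_norm_Rintegral ig qK'.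
Qed.

Variables (C : R) (f : R -> R).
Hypothesis tf : tame dlt C f.

Let C0 : 0 <= C. Proof. exact: tame_ge0 tf. Qed.

Let mshift (g : R -> R) (y : R) : continuous g -> measurable_fun setT (fun u : R => g (u + y)).
Proof.
move=> cg; apply: (measurableT_comp (continuous_measurable_fun cg)).
exact: measurable_funD.
Qed.

Let mean_le (Q : probability R R) (q : R -> R) (K : R) : measurable_fun setT q ->
  (forall u, `|q u| <= K) -> `|\int[Q]_u q u| <= K.
Proof.
move=> mq qK; have -> : K = \int[Q]_(u in setT) cst K u.
  rewrite Rintegral_cst// -[LHS]mulr1; congr (_ * _).
  exact/esym/(congr1 fine (@probability_setT _ _ R Q)).
apply: ler_norm_Rintegral => //.
exact: finite_measure_integrable_cst.
Qed.

Lemma mean_deriveP x t :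
  (F t).-integrable setT (fun u => (derive1 f (u + x * expR (- t)))%:E) /\
  `|mean_derive f x t| <= C.
Proof.
have m := mshift (x * expR (- t)) (tame_continuous_derive tf).
have b (u : R) : `|derive1 f (u + x * expR (- t))| <= C by case: tf.
split; [exact: integrable_bounded m b|exact: mean_le m b].
Qed.

(** The Hoelder bound contracts at rate exp (- dlt t), which is what makes the
    time integral of the increments converge. *)
Lemma mean_incrP x v t :
  (F t).-integrable setT
    (fun u => (f (u + (x + v) * expR (- t)) - f (u + x * expR (- t)))%:E) /\
  `|mean_incr f x v t| <= C * `|v| `^ dlt * expR (- (dlt * t)).
Proof.
have m : measurable_fun setT
    (fun u : R => f (u + (x + v) * expR (- t)) - f (u + x * expR (- t))).
  by apply: measurable_funB; apply: mshift; exact: tame_continuous tf.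
suff b (u : R) : `|f (u + (x + v) * expR (- t)) - f (u + x * expR (- t))| <=
    C * `|v| `^ dlt * expR (- (dlt * t)).
  by split; [exact: integrable_bounded m b|exact: mean_le m b].
case: tf => _ _ _ /(_ (u + x * expR (- t)) (u + (x + v) * expR (- t))).
move=> /le_trans; apply.
have -> : u + (x + v) * expR (- t) - (u + x * expR (- t)) = v * expR (- t) by ring.
rewrite -mulrA ler_wpM2l// normrM powRM//.
by rewrite (ger0_norm (expR_ge0 _)) -expRM mulNr (mulrC t).
Qed.

Lemma mean_incr_add x v w t :
  mean_incr f x (v + w) t = mean_incr f x v t + mean_incr f (x + v) w t.
Proof.
rewrite /mean_incr -RintegralD//; [|exact: (mean_incrP _ _ _).1|exact: (mean_incrP _ _ _).1].
by apply: eq_Rintegral => u _; rewrite (addrA x); ring.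
Qed.

(** The remainder is of order (v exp (- t))^2, of which only the weaker factor
    exp (- dlt t) is kept. *)
Lemma mean_taylor x v t : 0 <= t ->
  `|mean_incr f x v t - v * (expR (- t) * mean_derive f x t)| <=
  C * v ^+ 2 * expR (- (dlt * t)).
Proof.
move=> t0; have [i1 _] := mean_incrP x v t; have [i2 _] := mean_deriveP x t.
rewrite /mean_derive mulrA -RintegralZl// -RintegralB//; last exact: integrableZlR.
apply: mean_le.
  apply: measurable_funB; last by apply: measurable_funM => //; apply: mshift; exact: tame_continuous_derive tf.
  by apply: measurable_funB; apply: mshift; exact: tame_continuous tf.
move=> u; have := tame_taylor tf (u + x * expR (- t)) (v * expR (- t)).
have -> : u + x * expR (- t) + v * expR (- t) = u + (x + v) * expR (- t) by ring.
move=> /le_trans; apply; rewrite exprMn mulrA ler_wpM2l ?(mulr_ge0 C0 (sqr_ge0 _))//.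
rewrite (le_trans _ (expR_time t0))// expr2 ger_pMr ?expR_gt0//.
by rewrite -expR0 ler_expR oppr_le0.
Qed.

Lemma mean_derive_lipschitz x y t : 0 <= t ->
  `|mean_derive f y t - mean_derive f x t| <= C * `|y - x|.
Proof.
move=> t0; have [i1 _] := mean_deriveP y t; have [i2 _] := mean_deriveP x t.
rewrite /mean_derive -RintegralB//; apply: mean_le.
  by apply: measurable_funB; apply: mshift; exact: tame_continuous_derive tf.
move=> u; case: tf => _ _ /(_ (u + x * expR (- t)) (u + y * expR (- t))) + _.
move=> /le_trans; apply; rewrite ler_wpM2l//.
have -> : u + y * expR (- t) - (u + x * expR (- t)) = (y - x) * expR (- t) by ring.
rewrite normrM (ger0_norm (expR_ge0 _)) ler_piMr//.
by rewrite -expR0 ler_expR oppr_le0.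
Qed.

Hypothesis mf : measurable_means f.
Notation g := (stein_sol F f).
Notation K := time_mass.

Lemma stein_solE x : g x = - \int[mu]_(t in ray) (expR (- t) * mean_derive f x t).
Proof. by []. Qed.

Let integrand_measurable x : measurable_fun ray (fun t => expR (- t) * mean_derive f x t).
Proof.
apply: measurable_funM; last exact: mf.1.
by apply: measurable_funTS; apply: measurableT_comp => //; exact: measurable_funN.
Qed.

Let weighted_bound (q c t : R) : 0 <= t -> `|q| <= c ->
  `|expR (- t) * q| <= c * expR (- (dlt * t)).
Proof.
move=> t0 qc; rewrite normrM (ger0_norm (expR_ge0 _)) mulrC.
by rewrite ler_pM ?expR_ge0// expR_time.
Qed.

Lemma stein_solP x :
  mu.-integrable ray (fun t => (expR (- t) * mean_derive f x t)%:E) /\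
  `|g x| <= C * K.
Proof.
have [|i b] := @time_integral_bound _ C (integrand_measurable x).
  by move=> t t0; apply: weighted_bound => //; exact: (mean_deriveP _ _).2.
by split => //; rewrite stein_solE normrN.
Qed.

Lemma stein_incrP x v :
  mu.-integrable ray (fun t => (mean_incr f x v t)%:E) /\
  `|stein_incr f x v| <= C * K * `|v| `^ dlt.
Proof.
have [|i b] := @time_integral_bound _ (C * `|v| `^ dlt) (mf.2 x v).
  by move=> t t0; exact: (mean_incrP _ _ _).2.
by split => //; rewrite normrN mulrAC.
Qed.

Lemma stein_incr_add x v w :
  stein_incr f x (v + w) = stein_incr f x v + stein_incr f (x + v) w.
Proof.
rewrite /stein_incr -opprD -RintegralD//; [|exact: (stein_incrP _ _).1|exact: (stein_incrP _ _).1].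
by congr (- _); apply: eq_Rintegral => t _; exact: mean_incr_add.
Qed.

Lemma stein_taylor x v : `|stein_incr f x v - v * g x| <= C * K * v ^+ 2.
Proof.
have [i1 _] := stein_incrP x v; have [i2 _] := stein_solP x.
have := @time_integral_bound (fun t => mean_incr f x v t - v * (expR (- t) * mean_derive f x t))
  (C * v ^+ 2) _ (fun t t0 => mean_taylor x v t0).
move=> -[|_].
  by apply: measurable_funB; [exact: mf.2|exact: measurable_funM].
rewrite RintegralB//; last exact: integrableZlR.
by rewrite RintegralZl// stein_solE /stein_incr mulrN opprK mulrAC -normrN opprB addrC.
Qed.

Lemma stein_sol_lipschitz x y : `|g y - g x| <= C * K * `|y - x|.
Proof.
have [i1 _] := stein_solP y; have [i2 _] := stein_solP x.
have := @time_integral_bound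
  (fun t => expR (- t) * mean_derive f y t - expR (- t) * mean_derive f x t)
  (C * `|y - x|).
move=> -[| |_].
- exact: measurable_funB.
- by move=> t t0; rewrite -mulrBr weighted_bound// mean_derive_lipschitz.
rewrite (RintegralB _ i1 i2); last by [].
rewrite !stein_solE mulrAC; apply: le_trans.
by rewrite -normrN opprB opprK addrC.
Qed.

Lemma stein_sol_continuous : continuous g.
Proof. exact: lipschitz_continuous stein_sol_lipschitz. Qed.

Lemma is_derive_stein_incr (x w : R) : is_derive w 1 (stein_incr f x) (g (x + w)).
Proof.
apply: (@quadratic_is_derive _ _ (C * K)) => v.
have -> : stein_incr f x (w + v) - stein_incr f x w = stein_incr f (x + w) v.
  by rewrite stein_incr_add [X in X - _]addrC addrK.
exact: stein_taylor.
Qed.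

Lemma continuous_stein_incr x : continuous (stein_incr f x).
Proof.
move=> w; apply/differentiable_continuous/derivable1_diffP.
by have [] := is_derive_stein_incr x w.
Qed.

Lemma measurable_compensated x :
  measurable_fun setT (fun u => stein_incr f x u - u * trunc u * g x).
Proof.
apply: measurable_funB.
  exact: continuous_measurable_fun (@continuous_stein_incr x).
apply: measurable_funM => //; apply: measurable_funM => //.
exact: measurable_trunc.
Qed.

(** The Taylor bound covers the small jumps and the Hoelder bound the large ones,
    so the compensated increment is integrable against the Levy measure. *)
Lemma levy_dom_compensated x u :
  `|stein_incr f x u - u * trunc u * g x| <= C * K * levy_dom dlt u.
Proof.
have CK : 0 <= C * K by rewrite mulr_ge0// time_mass_ge0.
rewrite truncE; apply: le_levy_dom => //.
- by move=> ->; rewrite mulr1 stein_taylor.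
- move=> u1; rewrite (leNgt `|u| 1) u1 /= mulr0 mul0r subr0.
  exact: (stein_incrP x u).2.
Qed.

End stein_transforms.

(** * Exchanging the time and jump integrals *)
Section levy_Fubini.
Context {R : realType}.
Notation mu := (@lebesgue_measure R).
Notation ray := (`[0%R, +oo[%classic : set R).
Variables (alpha dlt : R) (m1 m2 : {nonneg R}).
Hypothesis alpha02 : 0 < alpha < 2.
Hypothesis dlt0 : 0 < dlt.
Hypothesis dltalpha : dlt < alpha.
Hypothesis dlt1 : dlt <= 1.
Notation nu := (levy_measure alpha m1 m2).
Notation dens := (levy_density alpha m1 m2).
Notation dom := (levy_dom dlt).

Let densP (A : set R) : measurable A ->
  nu A = (\int[mu]_(u in A) (dens u)%:E)%E.
Proof. by []. Qed.

Let nu_lebesgue (q : R -> R) : measurable_fun setT q ->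
  (\int[nu]_u (q u)%:E = \int[mu]_u (q u * dens u)%:E)%E.
Proof.
move=> mq; have mqe : measurable_fun setT (EFin \o q) by exact/measurable_EFinP.
by rewrite (integral_density (levy_density_ge0 alpha m1 m2)
  (measurable_levy_density alpha m1 m2) densP mqe).
Qed.

Variables (W : R -> R -> R) (K : R).
Hypothesis mW : measurable_fun setT (fun p : R * R => W p.1 p.2).
Hypothesis WK : forall t u, 0 <= t -> `|W t u| <= K * expR (- (dlt * t)) * dom u.
Hypothesis mIW : measurable_fun setT (fun u => \int[mu]_(t in ray) W t u).

Let mWt t : measurable_fun setT (W t).
Proof. exact: (measurable_fun_pair2 (f := fun p : R * R => W p.1 p.2)). Qed.

Let mWu u : measurable_fun setT (W ^~ u).
Proof. exact: (measurable_fun_pair1 (f := fun p : R * R => W p.1 p.2)). Qed.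

Let g1 (t : R) : R := \1_ray t * (K * expR (- (dlt * t))).
Let g2 (u : R) : R := dom u * dens u.

Let ig1 : mu.-integrable setT (EFin \o g1).
Proof.
have i : mu.-integrable ray (fun t => (K * expR (- (dlt * t)))%:E).
  by apply: integrableZlR => //; exact: integrable_time.
apply: eq_integrable (integrable_patchR _ i) => // t _.
by rewrite /= /g1 patchE indicE; case: ifP => _; rewrite ?mul1r ?mul0r.
Qed.

Let ig2 : mu.-integrable setT (EFin \o g2).
Proof.
have mdom : measurable_fun setT (fun u => (dom u)%:E).
  by apply/measurable_EFinP; exact: measurable_levy_dom.
have := integrable_levy_dom_nu m1 m2 alpha02 dltalpha dlt1.
move/(integrable_density (levy_density_ge0 alpha m1 m2)
  (measurable_levy_density alpha m1 m2) densP mdom).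
by apply: eq_integrable.
Qed.

Let H (p : R * R) : R := \1_ray p.1 * (W p.1 p.2 * dens p.2).

Let mH : measurable_fun setT H.
Proof.
apply: measurable_funM.
  by apply: (measurableT_comp (measurable_indic (measurable_itv _))); exact: measurable_fst.
apply: measurable_funM => //.
by apply: (measurableT_comp (measurable_levy_density _ _ _)); exact: measurable_snd.
Qed.

Let mG : measurable_fun setT (fun p : R * R => g1 p.1 * g2 p.2).
Proof.
have mg1 : measurable_fun setT g1.
  by apply/measurable_EFinP; exact: measurable_int ig1.
have mg2 : measurable_fun setT g2.
  by apply/measurable_EFinP; exact: measurable_int ig2.
by apply: measurable_funM; [apply: (measurableT_comp mg1); exact: measurable_fst|
  apply: (measurableT_comp mg2); exact: measurable_snd].
Qed.

Let iG : (mu \x mu)%E.-integrable setT (fun p : R * R => (g1 p.1 * g2 p.2)%:E).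
Proof.
have mGe : measurable_fun setT (fun p : R * R => (g1 p.1 * g2 p.2)%:E).
  by apply/measurable_EFinP; exact: mG.
apply/(@integrable12ltyP _ _ _ _ R mu mu _ mGe).
have /integrableP[mg1 i1] := ig1.
have /integrableP[mg2 i2] := ig2.
have E t : (\int[mu]_u `|(g1 t * g2 u)%:E| = `|(g1 t)%:E| * \int[mu]_u `|(g2 u)%:E|)%E.
  under eq_integral do rewrite EFinM abseM.
  by rewrite ge0_integralZl//; exact: measurableT_comp.
under eq_integral do rewrite /= E.
have I2 : (\int[mu]_u `|(g2 u)%:E|)%E \is a fin_num.
  by rewrite ge0_fin_numE// integral_ge0.
rewrite -(fineK I2) ge0_integralZr//; last 2 first.
- exact: measurableT_comp.
- by rewrite lee_fin fine_ge0// integral_ge0.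
by apply: lte_mul_pinfty => //; [exact: integral_ge0|rewrite ge0_fin_numE// integral_ge0|exact: ltry].
Qed.

Let iH : (mu \x mu)%E.-integrable setT (EFin \o H).
Proof.
apply: le_integrable iG => //; first by apply/measurable_EFinP; exact: mH.
move=> [t u] _ /=; rewrite lee_fin /H /g1 /g2 /= indicE.
case: (boolP (t \in ray)) => [|_]; last by rewrite !mul0r normr0.
rewrite inE/= in_itv/= andbT => t0; rewrite !mul1r mulrA !(normrM _ (dens u)) ler_wpM2r//.
by rewrite (le_trans (WK u t0))// ler_norm.
Qed.

(** The domination is by a product of an integrable function of t and one of u,
    and the density of nu reduces the exchange to the product of two Lebesgue
    measures. *)
Lemma levy_Fubini :
  \int[nu]_u (\int[mu]_(t in ray) W t u) = \int[mu]_(t in ray) \int[nu]_u W t u.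
Proof.
have iW t : 0 <= t -> nu.-integrable setT (fun u => (W t u)%:E).
  move=> t0; apply: (levy_split m1 m2 alpha02 dltalpha dlt1 (k := W t)
    (C := K * expR (- (dlt * t))) _ _).1 => //.
  by move=> u; exact: WK.
have HE u : (\int[mu]_t (H (t, u))%:E = ((\int[mu]_(t in ray) W t u) * dens u)%:E)%E.
  have [|iu _] := @time_integral_bound _ _ dlt0 (W ^~ u) (K * dom u) (measurable_funTS (mWu u)).
    by move=> t t0; rewrite mulrAC WK.
  have ip : mu.-integrable setT (EFin \o ((fun t => dens u * W t u) \_ ray)).
    by apply: integrable_patchR => //; exact: integrableZlR.
  rewrite mulrC -(RintegralZl _ _ iu)// Rintegral_mkcond /Rintegral fineK; last first.
    exact: (integrable_fin_num _ ip).
  apply: eq_integral => t _; rewrite patchE /H /= indicE.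
  by case: ifP => _; rewrite ?mul0r// mul1r mulrC.
have HE' t : (\int[mu]_u (H (t, u))%:E = (((fun t => \int[nu]_u W t u) \_ ray) t)%:E)%E.
  rewrite patchE /H /= indicE; case: (boolP (t \in ray)) => [|_]; last first.
    by under eq_integral do rewrite mul0r; rewrite integral0.
  rewrite inE/= in_itv/= andbT => t0.
  under eq_integral do rewrite mul1r.
  rewrite -nu_lebesgue// /Rintegral fineK//.
  by apply: integrable_fin_num => //; exact: iW.
rewrite [LHS]/Rintegral nu_lebesgue//.
under eq_integral do rewrite -HE.
rewrite -(Fubini iH).
under eq_integral do rewrite HE'.
by rewrite [RHS]Rintegral_mkcond.
Qed.

End levy_Fubini.

(** * The Stein identity for cosines *)

(** For bounded functions the Hoelder condition comes for free, by interpolation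
    between the bound and the Lipschitz bound. *)
Lemma tame_bounded {R : realType} (dlt B C D : R) (f f' : R -> R) :
  0 <= dlt <= 1 -> (forall x, `|f x| <= B) ->
  (forall x : R, is_derive x 1 f (f' x)) -> (forall x, `|f' x| <= C) ->
  (forall x y, `|f' y - f' x| <= D * `|y - x|) ->
  tame dlt (2 * B + C + D) f.
Proof.
move=> d01 fB df fC fD.
have dE : derive1 f = f' by apply/funext => x; rewrite derive1E; have [_ ->] := df x.
have B0 : 0 <= B by exact: le_trans (fB 0).
have C0 : 0 <= C by exact: le_trans (fC 0).
have D0 : 0 <= D by have := fD 0 1; rewrite subr0 normr1 mulr1; exact: le_trans.
split; rewrite ?dE.
- by move=> x; have [] := df x.
- by move=> x; rewrite (le_trans (fC x))//; lra.
- by move=> x y; rewrite (le_trans (fD x y))// ler_wpM2r//; lra.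
- move=> x y; have [y1|y1] := leP `|y - x| 1.
    have [->|yx] := eqVneq y x.
      by rewrite subrr normr0 mulr_ge0// ?powR_ge0//; lra.
    rewrite (le_trans (ler_lipschitz df fC x y))// ler_pM//; first by lra.
    by apply: ger1_powR; [rewrite normr_gt0 subr_eq0 yx|case/andP: d01].
  rewrite (le_trans (ler_normB _ _))// (@le_trans _ _ (2 * B + C + D))//.
    by have := fB x; have := fB y; lra.
  rewrite -[leLHS]mulr1 ler_wpM2l//; first by lra.
  by rewrite -(powRr0 `|y - x|) ler_powR ?(ltW y1)//; case/andP: d01.
Qed.

Section stein_identity.
Context {R : realType}.
Notation mu := (@lebesgue_measure R).
Notation ray := (`[0%R, +oo[%classic : set R).
Notation trunc := (\1_[set v : R | `|v| <= 1] : R -> R).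
Variables (alpha beta : R) (m1 m2 : {nonneg R}).
Variables (d : measure_display) (T : measurableType d) (P : probability T R).
Variables (X : {RV P >-> R}) (F : R -> probability R R).
Notation nu := (levy_measure alpha m1 m2).

(** The Stein equation before integration by parts. In this form the right-hand
    side is dominated in terms of the tameness constant of f, which makes limits
    possible; measurability of the means is established along the same limits. *)
Definition stein_identity (f : R -> R) : Prop :=
  [/\ measurable_means F f, P.-integrable setT (fun w => (f (X w))%:E) &
  forall x, f x - \int[P]_w f (X w) =
    (- x + beta - (m1%:num - m2%:num)) * stein_sol F f x +
    alpha * \int[nu]_u (stein_incr F f x u - u * trunc u * stein_sol F f x)].

Variable dlt : R.
Hypothesis alpha02 : 0 < alpha < 2.
Hypothesis dlt0 : 0 < dlt.
Hypothesis dltalpha : dlt < alpha.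
Hypothesis dlt1 : dlt <= 1.
Hypothesis hX : is_stable alpha beta m1 m2 P X.
Hypothesis hF : self_decomp_laws P X F.

Section cosine.
Variables z th : R.
Notation f := (fun x => cos (z * x + th)).

Let dlt01 : 0 <= dlt <= 1. Proof. by rewrite (ltW dlt0) dlt1. Qed.

Let is_derive_f (x : R) : is_derive x 1 f (- z * sin (z * x + th)).
Proof.
apply: is_derive_eq; rewrite /GRing.scale/=; ring.
Qed.

Lemma tame_cos : exists C, tame dlt C f.
Proof.
exists (2 * 1 + `|z| + `|z| * `|z|); apply: (tame_bounded dlt01 _ is_derive_f).
- by move=> x; exact: cos_le1n.
- by move=> x; rewrite normrM normrN ler_piMr// sin_le1n.
- move=> x y; rewrite -mulrBr normrM normrN -mulrA ler_wpM2l//.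
  rewrite (le_trans (lipschitz_sin _ _))// -normrM.
  by rewrite (_ : z * y + th - _ = z * (y - x))//; ring.
Qed.

Let derive1_f : derive1 f = (fun x => - z * sin (z * x + th)).
Proof. by apply/funext => x; rewrite derive1E; have [_ ->] := is_derive_f x. Qed.

Let V (s : R) : R := if alpha == 1 then ln s else (1 - alpha)^-1 * s `^ (1 - alpha).

Let dV (s : R) : 0 < s -> is_derive s 1 V (s `^ (- alpha)).
Proof.
move=> s0; rewrite /V; case: eqVneq => [->|a1].
  by rewrite powR_inv1 ?ltW//; exact: is_derive1_ln.
have h := is_derive1_powR (1 - alpha) s0.
apply: is_derive_eq; rewrite /GRing.scale /=.
by rewrite (_ : 1 - alpha - 1 = - alpha); [|ring]; rewrite mulrA mulVf ?mul1r// subr_eq0 eq_sym.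
Qed.

(** Put s = exp (- t). Then [ps t] and [si t] are the real part of the exponent
    and the sine integral at s z, while [am t] and [ph x t] are the amplitude and
    the phase of the mean of cos (z (u + x s) + th) under F_t. *)
Let ps (t : R) := expR (- (alpha * t)) * exponent_re alpha m1 m2 z.
Let si (t : R) := expR (- (alpha * t)) * (sinint alpha z + z * (V 1 - V (expR (- t)))).
Let am (t : R) := expR (exponent_re alpha m1 m2 z - ps t).
Let ph (x t : R) := exponent_im alpha beta m1 m2 z
   - (expR (- t) * z * beta + (m1%:num - m2%:num) * si t) + (z * x * expR (- t) + th).

Let expR_pow (t : R) : expR (- t) `^ alpha = expR (- (alpha * t)).
Proof. by rewrite -expRM mulNr mulrC. Qed.

Let psE t : exponent_re alpha m1 m2 (expR (- t) * z) = ps t.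
Proof. by rewrite /exponent_re cosint_scale ?expR_gt0// expR_pow /ps /exponent_re; ring. Qed.

Let siE t : sinint alpha (expR (- t) * z) = si t.
Proof. by rewrite (sinint_scale alpha02 dV) ?expR_gt0// expR_pow. Qed.

Let mean_cos (x t y : R) : 0 <= t ->
  \int[F t]_u cos (z * (u + x * expR (- t)) + th + y) = am t * cos (ph x t + y).
Proof.
move=> t0; under eq_Rintegral => u _.
  rewrite (_ : _ + y = z * u + (z * x * expR (- t) + th + y)); last by ring.
  over.
rewrite (cos_law_F alpha02 hX hF)// psE /exponent_im siE -/(am t).
by congr (_ * cos _); rewrite /ph /exponent_im; ring.
Qed.

Let dps (t : R) : is_derive t 1 ps (- (alpha * ps t)).
Proof. by rewrite /ps; apply: is_derive_eq; rewrite /GRing.scale/=; ring. Qed.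

(** The linear differential equation behind the identity: the derivative of V
    cancels the power of s and leaves z s, a pure drift. *)
Let dsi (t : R) : is_derive t 1 si (- (alpha * si t) + z * expR (- t)).
Proof.
have dVe : is_derive t 1 (V \o (fun t => expR (- t))) (expR (- t) `^ (- alpha) * - expR (- t)).
  apply: is_derive1_comp; first exact/dV/expR_gt0.
  by apply: is_derive_eq; rewrite /GRing.scale/=; ring.
rewrite /si; apply: is_derive_eq; rewrite /GRing.scale/=.
have -> : expR (- t) `^ (- alpha) = (expR (- (alpha * t)))^-1.
  by rewrite powRN expR_pow.
have e0 : expR (- (alpha * t)) != 0 by rewrite gt_eqF ?expR_gt0.
by field.
Qed.

Let dam (t : R) : is_derive t 1 am (alpha * ps t * am t).
Proof. by rewrite /am; apply: is_derive_eq; rewrite /GRing.scale/= /ps; ring. Qed.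

(** This is where the drift beta - (m1 - m2) - x of the Stein operator appears. *)
Let dph (x t : R) : is_derive t 1 (ph x)
  (z * (beta - (m1%:num - m2%:num) - x) * expR (- t) + alpha * (m1%:num - m2%:num) * si t).
Proof.
have H (S : R -> R) (s' c k : R) : is_derive t 1 S s' -> is_derive t 1
    (fun t => c - (expR (- t) * z * beta + k * S t) + (z * x * expR (- t) + th))
    (z * beta * expR (- t) - k * s' - z * x * expR (- t)).
  by move=> hS; apply: is_derive_eq; rewrite /GRing.scale/=; ring.
have := H _ _ (exponent_im alpha beta m1 m2 z) (m1%:num - m2%:num) (dsi t).
by move=> h; apply: is_derive_eq; ring.
Qed.

(** The derivative of the mean, arranged so that the first term is alpha times the
    jump integral and the second a multiple of the integrand of the Stein
    solution. *)
Let dmain (x t : R) : R :=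
  alpha * am t * (ps t * cos (ph x t) - (m1%:num - m2%:num) * si t * sin (ph x t))
  + (x - beta + (m1%:num - m2%:num)) * (expR (- t) * (z * am t * sin (ph x t))).

Let is_derive_main (x t : R) :
  is_derive t 1 (fun t => am t * cos (ph x t)) (dmain x t).
Proof.
have H (A B : R -> R) (a' b' : R) : is_derive t 1 A a' -> is_derive t 1 B b' ->
    is_derive t 1 (fun t => A t * cos (B t)) (a' * cos (B t) - A t * sin (B t) * b').
  by move=> hA hB; apply: is_derive_eq; rewrite /GRing.scale/=; ring.
have h := H _ _ _ _ (dam t) (dph x t).
by apply: is_derive_eq; rewrite /dmain; ring.
Qed.

Let continuous_of_derive (q q' : R -> R) : (forall t : R, is_derive t 1 q (q' t)) -> continuous q.
Proof.
by move=> dq t; apply/differentiable_continuous/derivable1_diffP; have [] := dq t.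
Qed.

Let cps : continuous ps. Proof. exact: continuous_of_derive dps. Qed.
Let csi : continuous si. Proof. exact: continuous_of_derive dsi. Qed.
Let cam : continuous am. Proof. exact: continuous_of_derive dam. Qed.
Let cph x : continuous (ph x). Proof. exact: continuous_of_derive (dph x). Qed.
Let cexpN : continuous (fun t : R => expR (- t)).
Proof. by move=> t; apply: continuous_comp; [exact: continuousN|exact: continuous_expR]. Qed.
Let ccos x : continuous (fun t => cos (ph x t)).
Proof. by move=> t; apply: continuous_comp; [exact: cph|exact: continuous_cos]. Qed.
Let csin x : continuous (fun t => sin (ph x t)).
Proof. by move=> t; apply: continuous_comp; [exact: cph|exact: continuous_sin]. Qed.

Let cmain x : continuous (dmain x).
Proof.
move=> t; rewrite /continuous_at /dmain; apply: cvgD; apply: cvgM.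
- by apply: cvgM; [exact: cvg_cst|exact: cam].
- apply: cvgB; first by apply: cvgM; [exact: cps|exact: ccos].
  by apply: cvgM; [apply: cvgM; [exact: cvg_cst|exact: csi]|exact: csin].
- exact: cvg_cst.
- apply: cvgM; first exact: cexpN.
  by apply: cvgM; [apply: cvgM; [exact: cvg_cst|exact: cam]|exact: csin].
Qed.

Let mean_deriveE (x t : R) : 0 <= t -> mean_derive F f x t = - z * am t * sin (ph x t).
Proof.
move=> t0; rewrite /mean_derive derive1_f.
under eq_Rintegral => u _.
  rewrite (_ : - z * _ = z * cos (z * (u + x * expR (- t)) + th + pi / 2)); last first.
    by rewrite cosDpihalf; ring.
  over.
have m : measurable_fun setT (fun u : R => cos (z * (u + x * expR (- t)) + th + pi / 2)).
  apply: (measurableT_comp (continuous_measurable_fun (@continuous_cos R))).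
  by do 2!apply: measurable_funD => //; apply: measurable_funM => //; exact: measurable_funD.
have i : (F t).-integrable setT
    (fun u : R => (cos (z * (u + x * expR (- t)) + th + pi / 2))%:E).
  by apply: (@integrable_bounded _ _ _ _ _ 1) => // u; exact: cos_le1n.
rewrite RintegralZl// mean_cos// cosDpihalf; ring.
Qed.

Let mean_incrE (x v t : R) : 0 <= t -> mean_incr F f x v t =
  am t * (cos (ph x t) * (cos (expR (- t) * z * v) - 1)
          - sin (ph x t) * sin (expR (- t) * z * v)).
Proof.
move=> t0; rewrite /mean_incr.
have i y : (F t).-integrable setT
    (fun u : R => (cos (z * (u + y * expR (- t)) + th))%:E).
  apply: (@integrable_bounded _ _ _ _ _ 1) => [|u]; last exact: cos_le1n.
  apply: (measurableT_comp (continuous_measurable_fun (@continuous_cos R))).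
  by apply: measurable_funD => //; apply: measurable_funM => //; exact: measurable_funD.
rewrite (RintegralB _ (i (x + v)) (i x)); last by [].
have h y := mean_cos y 0 t0.
have {}h y : \int[F t]_u cos (z * (u + y * expR (- t)) + th) = am t * cos (ph y t).
  by rewrite -[X in _ = _ * cos X]addr0 -h; apply: eq_Rintegral => u _; rewrite addr0.
rewrite !h (_ : ph (x + v) t = ph x t + expR (- t) * z * v); last by rewrite /ph; ring.
by rewrite cosD; ring.
Qed.

Lemma measurable_means_cos : measurable_means F f.
Proof.
have contm (q : R -> R) : continuous q -> measurable_fun ray q.
  by move=> cq; apply: measurable_funTS; exact: continuous_measurable_fun.
split=> [x|x v].
- apply: (eq_measurable_fun (fun t => - z * am t * sin (ph x t))).
    by move=> t; rewrite inE/= in_itv/= andbT => t0; rewrite mean_deriveE.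
  apply: contm => t; apply: cvgM; last exact: csin.
  by apply: cvgM; [exact: cvg_cst|exact: cam].
- apply: (eq_measurable_fun (fun t => am t * (cos (ph x t) * (cos (expR (- t) * z * v) - 1)
          - sin (ph x t) * sin (expR (- t) * z * v)))).
    by move=> t; rewrite inE/= in_itv/= andbT => t0; rewrite mean_incrE.
  have ce : continuous (fun t : R => expR (- t) * z * v).
    by move=> t; apply: cvgM; [apply: cvgM; [exact: cexpN|exact: cvg_cst]|exact: cvg_cst].
  apply: contm => t; apply: cvgM; first exact: cam.
  apply: cvgB; apply: cvgM; [exact: ccos| |exact: csin|].
    apply: cvgB; last exact: cvg_cst.
    exact: (@continuous_comp _ _ _ (fun t : R => expR (- t) * z * v) cos t (ce t) (@continuous_cos R _)).
  exact: (@continuous_comp _ _ _ (fun t : R => expR (- t) * z * v) sin t (ce t) (@continuous_sin R _)).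
Qed.

Variable x : R.

(** The compensated increment at time t, written with the explicit amplitude and
    phase so that it is visibly measurable in (t, u). *)
Let W (t u : R) : R := am t * (cos (ph x t) * (cos (expR (- t) * z * u) - 1)
  - sin (ph x t) * (sin (expR (- t) * z * u) - expR (- t) * z * u * trunc u)).

Let WE t u : 0 <= t ->
  W t u = mean_incr F f x u t - u * trunc u * (expR (- t) * mean_derive F f x t).
Proof. by move=> t0; rewrite /W mean_incrE// mean_deriveE//; ring. Qed.

Let mW : measurable_fun setT (fun p : R * R => W p.1 p.2).
Proof.
have m1' (q : R -> R) : continuous q -> measurable_fun setT (fun p : R * R => q p.1).
  by move=> cq; apply: (measurableT_comp (continuous_measurable_fun cq)); exact: measurable_fst.
have me : measurable_fun setT (fun p : R * R => expR (- p.1) * z * p.2).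
  apply: measurable_funM; last exact: measurable_snd.
  by apply: measurable_funM => //; exact: (m1' _ cexpN).
have mc := m1' (fun t : R => cos (ph x t)) (@ccos x).
have ms := m1' (fun t : R => sin (ph x t)) (@csin x).
apply: measurable_funM; first exact: (m1' _ cam).
apply: measurable_funB; apply: measurable_funM; [exact: mc| |exact: ms|].
  apply: measurable_funB => //.
  exact: (measurableT_comp (continuous_measurable_fun (@continuous_cos R))).
apply: measurable_funB.
  exact: (measurableT_comp (continuous_measurable_fun (@continuous_sin R))).
apply: measurable_funM => //.
by apply: (measurableT_comp (measurable_trunc 1)); exact: measurable_snd.
Qed.

Let main_term (t : R) := am t * (cos (ph x t) * ps t
  - sin (ph x t) * ((m1%:num - m2%:num) * si t)).

Let levy_W t : \int[nu]_u W t u = main_term t.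
Proof.
have [ic cE] := levy_cosint m1 m2 alpha02 dlt0 dltalpha dlt1 (expR (- t) * z).
have [iS sE] := levy_sinint m1 m2 alpha02 dlt0 dltalpha dlt1 (expR (- t) * z).
rewrite siE in sE.
rewrite -/(exponent_re _ _ _ _) psE in cE.
rewrite /main_term -cE -sE.
have i1 := integrableZlR measurableT (cos (ph x t)) ic.
have i2 := integrableZlR measurableT (sin (ph x t)) iS.
rewrite -(RintegralZl _ _ ic)// -(RintegralZl _ _ iS)//.
rewrite -(RintegralB _ i1 i2)// -RintegralZl//.
by have := integrableB measurableT i1 i2; apply: eq_integrable.
Qed.

Lemma exponential_bound_si : exists K, forall t, 0 <= t -> `|si t| <= K * expR (- (dlt * t)).
Proof.
set D := \int[mu]_(u in `]0%R, +oo[) (levy_dom dlt u * levy_weight alpha u).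
have D0 : 0 <= D.
  by apply: Rintegral_ge0 => u _; rewrite mulr_ge0 ?levy_dom_ge0 ?levy_weight_ge0.
exists ((z ^+ 2 + 2 * `|z| `^ dlt) * D) => t t0; rewrite -siE.
rewrite (le_trans (sinint_bound alpha02 dlt0 dltalpha dlt1 _))// -/D mulrAC ler_wpM2r//.
rewrite normrM powRM// (ger0_norm (expR_ge0 _)) -expRM mulNr (mulrC t) exprMn.
rewrite [leRHS]mulrDl lerD//; last by rewrite mulrAC mulrA.
rewrite mulrC ler_wpM2l ?sqr_ge0// (le_trans _ (expR_time dlt1 t0))//.
rewrite expr2 ger_pMr ?expR_gt0//.
by rewrite -expR0 ler_expR oppr_le0.
Qed.

(** The fundamental theorem of calculus for the mean t |-> am t * cos (ph x t),
    which is f x at t = 0 and tends to E f(X). *)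
Lemma stein_identity_cos_at : f x - \int[P]_w f (X w) =
    (- x + beta - (m1%:num - m2%:num)) * stein_sol F f x +
    alpha * \int[nu]_u (stein_incr F f x u - u * trunc u * stein_sol F f x).
Proof.
have [C tf] := tame_cos; have mf := measurable_means_cos.
have C0 := tame_ge0 tf.
have WK t u : 0 <= t -> `|W t u| <= C * expR (- (dlt * t)) * levy_dom dlt u.
  move=> t0; apply: le_levy_dom => //; first by rewrite mulr_ge0// expR_ge0.
    move=> u1; rewrite WE// truncE u1 mulr1.
    by rewrite (le_trans (mean_taylor F dlt1 tf x u t0))// mulrAC.
  move=> u1; rewrite WE// truncE (leNgt `|u| 1) u1/= mulr0 mul0r subr0.
  by rewrite (le_trans (mean_incrP F tf x u t).2)// mulrAC.
have incrE u : stein_incr F f x u - u * trunc u * stein_sol F f x =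
    - \int[mu]_(t in ray) W t u.
  have [i1 _] := stein_incrP dlt0 tf mf x u; have [i2 _] := stein_solP dlt0 dlt1 tf mf x.
  have -> : \int[mu]_(t in ray) W t u = \int[mu]_(t in ray)
      (mean_incr F f x u t - u * trunc u * (expR (- t) * mean_derive F f x t)).
    by apply: eq_Rintegral => t; rewrite inE/= in_itv/= andbT => t0; rewrite WE.
  rewrite (RintegralB _ i1 (integrableZlR _ _ i2))// (RintegralZl _ _ i2)//.
  by rewrite stein_solE /stein_incr; ring.
have mIW : measurable_fun setT (fun u => \int[mu]_(t in ray) W t u).
  have := measurable_compensated dlt0 dlt1 tf mf x => mc.
  rewrite (_ : (fun u => _) = (fun u => - (stein_incr F f x u - u * trunc u * stein_sol F f x))).
    exact: measurable_funN.
  by apply/funext => u; rewrite incrE opprK.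
have iW t : 0 <= t -> nu.-integrable setT (fun u => (W t u)%:E).
  move=> t0; apply: (levy_split m1 m2 alpha02 dltalpha dlt1 (k := W t)
    (C := C * expR (- (dlt * t))) _ _).1.
    exact: (measurable_fun_pair2 (f := fun p : R * R => W p.1 p.2)).
  by move=> u; exact: WK.
have idom := integrable_levy_dom_nu m1 m2 alpha02 dltalpha dlt1.
set Dn := \int[nu]_u levy_dom dlt u.
have contm (q : R -> R) : continuous q -> measurable_fun ray q.
  by move=> cq; apply: measurable_funTS; exact: continuous_measurable_fun.
have [||i1 _] := @time_integral_bound _ _ dlt0 main_term (C * Dn).
- apply: contm => t; apply: cvgM; first exact: cam.
  apply: cvgB; apply: cvgM; [exact: ccos|exact: cps|exact: csin|].
  by apply: cvgM; [exact: cvg_cst|exact: csi].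
- move=> t t0; rewrite -levy_W mulrAC -(RintegralZl _ _ idom)//.
  apply: ler_norm_Rintegral => //.
  - exact: (measurable_fun_pair2 (f := fun p : R * R => W p.1 p.2)).
  - exact: integrableZlR.
  - by move=> u _; exact: WK.
have [i2 _] := stein_solP dlt0 dlt1 tf mf x.
have levyE : \int[nu]_u (stein_incr F f x u - u * trunc u * stein_sol F f x) =
    - \int[mu]_(t in ray) main_term t.
  have iI : nu.-integrable setT (fun u => (\int[mu]_(t in ray) W t u)%:E).
    apply: (levy_split m1 m2 alpha02 dltalpha dlt1
      (k := fun u => \int[mu]_(t in ray) W t u) (C := C * time_mass dlt) mIW _).1.
    move=> u; rewrite -normrN -incrE.
    exact: levy_dom_compensated.
  under eq_Rintegral do rewrite incrE.
  transitivity (- \int[nu]_u (\int[mu]_(t in ray) W t u)).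
    rewrite -mulN1r -(RintegralZl _ _ iI)//.
    by apply: eq_Rintegral => u _; rewrite mulN1r.
  rewrite (levy_Fubini m1 m2 alpha02 dlt0 dltalpha dlt1 mW WK mIW); congr (- _).
  by apply: eq_Rintegral => t _; exact: levy_W.
have mainE t : t \in ray -> dmain x t =
    alpha * main_term t - (x - beta + (m1%:num - m2%:num)) *
      (expR (- t) * mean_derive F f x t).
  rewrite inE/= in_itv/= andbT => t0.
  by rewrite mean_deriveE// /dmain /main_term; ring.
have j1 : mu.-integrable ray (fun t => (alpha * main_term t)%:E) by exact: integrableZlR.
have j2 : mu.-integrable ray (fun t => ((x - beta + (m1%:num - m2%:num)) *
      (expR (- t) * mean_derive F f x t))%:E) by exact: integrableZlR.
have idm : mu.-integrable ray (EFin \o dmain x).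
  have j : mu.-integrable ray ((fun t => (alpha * main_term t)%:E) \-
      (fun t => ((x - beta + (m1%:num - m2%:num)) *
      (expR (- t) * mean_derive F f x t))%:E))%E by exact: integrableB.
  by apply: eq_integrable j => // t tr; rewrite /= mainE.
have limE (q : R) : 0 < q -> expR (- (q * (0 + n.+1%:R))) @[n --> \oo] --> (0 : R).
  move=> q0; apply: (cvg_pinftyP (fun x : R => expR (- x)) 0).1; first exact: cvgr_expR.
  apply/cvgryPge => A; near=> n; rewrite add0r mulrC -ler_pdivrMr//.
  rewrite (@le_trans _ _ n%:R) ?ler_nat//; near: n; exact: nbhs_infty_ger.
have lps : ps (0 + n.+1%:R) @[n --> \oo] --> (0 : R).
  rewrite -[X in _ --> X](mul0r (exponent_re alpha m1 m2 z)); apply: cvgM; last exact: cvg_cst.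
  by apply: limE; case/andP: alpha02.
have lsi : si (0 + n.+1%:R) @[n --> \oo] --> (0 : R).
  have [K siK] := exponential_bound_si.
  apply: (@squeeze_cvgr _ _ _ _ (fun n => - (K * expR (- (dlt * (0 + n.+1%:R)))))
    (fun n => K * expR (- (dlt * (0 + n.+1%:R))))).
  - by apply: nearW => n; rewrite -ler_norml siK// add0r.
  - by rewrite -[X in _ --> X]oppr0 -[X in _ --> - X](mulr0 K); apply: cvgN; apply: cvgM; [exact: cvg_cst|exact: limE].
  - by rewrite -[X in _ --> X](mulr0 K); apply: cvgM; [exact: cvg_cst|exact: limE].
have le1 : expR (- (0 + n.+1%:R)) @[n --> \oo] --> (0 : R).
  by have := limE 1 ltr01; under eq_cvg do rewrite mul1r.
have lmain : am (0 + n.+1%:R) * cos (ph x (0 + n.+1%:R)) @[n --> \oo] -->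
    expR (exponent_re alpha m1 m2 z) * cos (exponent_im alpha beta m1 m2 z + th).
  have lre : exponent_re alpha m1 m2 z - ps (0 + n.+1%:R) @[n --> \oo] -->
      exponent_re alpha m1 m2 z.
    by rewrite -[X in _ --> X]subr0; apply: cvgB; [exact: cvg_cst|exact: lps].
  have lph : ph x (0 + n.+1%:R) @[n --> \oo] --> exponent_im alpha beta m1 m2 z + th.
    rewrite [X in _ --> X](_ : _ = exponent_im alpha beta m1 m2 z
     - (0 * z * beta + (m1%:num - m2%:num) * 0) + (z * x * 0 + th)); last by ring.
    apply: cvgD.
      apply: cvgB; first exact: cvg_cst.
      apply: cvgD; last by apply: cvgM; [exact: cvg_cst|exact: lsi].
      by apply: cvgM; [apply: cvgM; [exact: le1|exact: cvg_cst]|exact: cvg_cst].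
    by apply: cvgD; [apply: cvgM; [exact: cvg_cst|exact: le1]|exact: cvg_cst].
  apply: cvgM.
    exact: (cvg_comp _ _ lre (@continuous_expR R _)).
  exact: (cvg_comp _ _ lph (@continuous_cos R _)).
have I := FTCy (c := -1) (fun t _ => is_derive_main x t) (fun t _ => @cmain x t) (ltrN10 _) idm lmain.
rewrite (@eq_Rintegral _ _ _ mu ray _ _ mainE) (RintegralB _ j1 j2)// in I.
move: I; rewrite (RintegralZl _ _ i1)// (RintegralZl _ _ i2)// => I.
have am0 : am 0 = 1.
  by rewrite /am /ps mulr0 oppr0 expR0 mul1r subrr expR0.
have ph0 : ph x 0 = z * x + th.
  rewrite /ph /si mulr0 !oppr0 !expR0 subrr mulr0 addr0 /exponent_im; ring.
rewrite am0 ph0 mul1r in I.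
rewrite levyE (cos_law_X alpha02 hX) stein_solE.
apply: oppr_inj; rewrite opprB -I; ring.
Unshelve. all: by end_near. Qed.

End cosine.

Lemma stein_identity_cos z th : stein_identity (fun x => cos (z * x + th)).
Proof.
split; [exact: measurable_means_cos| |by move=> x; exact: stein_identity_cos_at].
apply: (@integrable_bounded _ _ _ _ _ 1) => [|u]; last exact: cos_le1n.
apply: (measurableT_comp (continuous_measurable_fun (@continuous_cos R))).
by apply: measurable_funD => //; exact: measurable_funM.
Qed.

End stein_identity.

(** * Limits and linear combinations *)

(** Pointwise convergence forces that of the derivatives, because the Taylor
    remainders are uniform: r is chosen so that both remainders, divided by r,
    stay below e / 4. *)
Lemma cvg_derive_tame {R : realType} (dlt C : R) (f_ : nat -> R -> R) (f : R -> R) :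
  (forall n, tame dlt C (f_ n)) -> tame dlt C f ->
  (forall x, f_ n x @[n --> \oo] --> f x) ->
  forall x, derive1 (f_ n) x @[n --> \oo] --> derive1 f x.
Proof.
move=> tn tf cf x; apply/cvgrPdist_le => /= e e0.
have C0 := tame_ge0 tf; pose r := e / (4 * (C + 1)).
have C1 : 0 < C + 1 by rewrite ltr_wpDl.
have r0 : 0 < r by rewrite divr_gt0// mulr_gt0.
have : (f_ n (x + r) - f_ n x - (f (x + r) - f x)) @[n --> \oo] --> (0 : R).
  rewrite -[X in _ --> X](subrr (f (x + r) - f x)).
  by apply: cvgB; [apply: cvgB; exact: cf|exact: cvg_cst].
move=> /cvgr0Pnorm_le /(_ (e * r / 2)) h.
have {}h : \forall n \near \oo, `|f_ n (x + r) - f_ n x - (f (x + r) - f x)| <= e * r / 2.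
  by apply: h; rewrite divr_gt0// mulr_gt0.
near=> n; have hn : `|f_ n (x + r) - f_ n x - (f (x + r) - f x)| <= e * r / 2 by near: n.
have t1 := tame_taylor (tn n) x r; have t2 := tame_taylor tf x r.
rewrite -(ler_pM2r r0) -{1}(gtr0_norm r0) -normrM.
have -> : (derive1 f x - derive1 (f_ n) x) * r =
    (f_ n (x + r) - f_ n x - r * derive1 (f_ n) x)
    - (f (x + r) - f x - r * derive1 f x)
    - (f_ n (x + r) - f_ n x - (f (x + r) - f x)) by ring.
rewrite (le_trans (ler_normB _ _))// (le_trans (lerD (ler_normB _ _) (lexx _)))//.
have Cr : C * r ^+ 2 <= e * r / 4.
  rewrite expr2 mulrA [leRHS]mulrAC ler_pM2r// /r mulrA ler_pdivrMr ?mulr_gt0//.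
  rewrite (_ : e / 4 * _ = e * (C + 1)); last by field.
  by rewrite mulrC ler_pM2l// lerDl.
by move: t1 t2 hn Cr; lra.
Unshelve. all: by end_near. Qed.

Lemma Rintegral_lin d (T : measurableType d) (R : realType)
    (mu : {measure set T -> \bar R}) (D : set T) (f g : T -> R) (a : R) :
  measurable D -> mu.-integrable D (EFin \o f) -> mu.-integrable D (EFin \o g) ->
  \int[mu]_(x in D) (a * f x + g x) =
  a * \int[mu]_(x in D) f x + \int[mu]_(x in D) g x.
Proof.
move=> mD fi gi; have afi := integrableZlR mD a fi.
by rewrite (RintegralD mD afi gi) (RintegralZl a mD fi).
Qed.

Section closure.
Context {R : realType}.
Notation mu := (@lebesgue_measure R).
Notation ray := (`[0%R, +oo[%classic : set R).
Notation trunc := (\1_[set v : R | `|v| <= 1] : R -> R).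
Variables (alpha beta : R) (m1 m2 : {nonneg R}).
Variables (d : measure_display) (T : measurableType d) (P : probability T R).
Variables (X : {RV P >-> R}) (F : R -> probability R R).
Notation nu := (levy_measure alpha m1 m2).
Notation stein_identity := (stein_identity alpha beta m1 m2 X F).
Variable dlt : R.
Hypothesis alpha02 : 0 < alpha < 2.
Hypothesis dlt0 : 0 < dlt.
Hypothesis dltalpha : dlt < alpha.
Hypothesis dlt1 : dlt <= 1.

Section limit.
Variables (f_ : nat -> R -> R) (f : R -> R) (C : R).
Hypothesis tn : forall n, tame dlt C (f_ n).
Hypothesis tf : tame dlt C f.
Hypothesis cf : forall x, f_ n x @[n --> \oo] --> f x.

Let cst_integrable (Q : probability R R) (c : R) : Q.-integrable setT (EFin \o cst c).
Proof. exact: finite_measure_integrable_cst. Qed.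

Let cvg_mean_derive x t : mean_derive F (f_ n) x t @[n --> \oo] --> mean_derive F f x t.
Proof.
apply: (cvg_dominated_Rintegral measurableT (g := cst C) _ _ (cst_integrable _ _) _).2.
- move=> n; have [i _] := mean_deriveP F (tn n) x t.
  by apply/measurable_EFinP; exact: measurable_int i.
- by move=> u _; exact: (cvg_derive_tame tn tf cf).
- by move=> n u _; case: (tn n).
Qed.

Let cvg_mean_incr x v t : mean_incr F (f_ n) x v t @[n --> \oo] --> mean_incr F f x v t.
Proof.
pose y := (x + v) * expR (- t) - x * expR (- t).
apply: (cvg_dominated_Rintegral measurableT (g := cst (C * `|y| `^ dlt)) _ _
  (cst_integrable _ _) _).2.
- move=> n; have [i _] := mean_incrP F (tn n) x v t.
  by apply/measurable_EFinP; exact: measurable_int i.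
- by move=> u _; apply: cvgB; exact: cf.
- move=> n u _; case: (tn n) => _ _ _ /(_ (u + x * expR (- t))) h.
  by rewrite (le_trans (h _))// (_ : _ - _ = y)// /y; ring.
Qed.

Hypothesis sn : forall n, stein_identity (f_ n).
Hypothesis iX : P.-integrable setT (fun w => (f (X w))%:E).
Hypothesis cX : \int[P]_w f_ n (X w) @[n --> \oo] --> \int[P]_w f (X w).

Let mn n : measurable_means F (f_ n). Proof. by case: (sn n). Qed.

Let mf : measurable_means F f.
Proof.
split=> [x|x v].
- apply: (measurable_fun_cvg (h := fun n => mean_derive F (f_ n) x)).
    by move=> n; exact: (mn n).1.
  by move=> t _; exact: cvg_mean_derive.
- apply: (measurable_fun_cvg (h := fun n => mean_incr F (f_ n) x v)).
    by move=> n; exact: (mn n).2.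
  by move=> t _; exact: cvg_mean_incr.
Qed.

Let rayP (t : R) : ray t -> 0 <= t. Proof. by rewrite /= in_itv/= andbT. Qed.

Let itime c : mu.-integrable ray (fun t => (c * expR (- (dlt * t)))%:E).
Proof. by apply: integrableZlR => //; exact: integrable_time. Qed.

Let cvg_stein_sol x : stein_sol F (f_ n) x @[n --> \oo] --> stein_sol F f x.
Proof.
apply: cvgN; apply: (cvg_dominated_Rintegral _ _ _ (itime C) _).2 => //.
- move=> n; have [i _] := stein_solP dlt0 dlt1 (tn n) (mn n) x.
  by apply/measurable_EFinP; exact: measurable_int i.
- by move=> t _; apply: cvgM; [exact: cvg_cst|exact: cvg_mean_derive].
- move=> n t /rayP t0; rewrite normrM (ger0_norm (expR_ge0 _)) mulrC.
  by apply: ler_pM; rewrite ?expR_ge0//; [exact: (mean_deriveP F (tn n) x t).2|exact: expR_time].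
Qed.

Let cvg_stein_incr x v : stein_incr F (f_ n) x v @[n --> \oo] --> stein_incr F f x v.
Proof.
apply: cvgN; apply: (cvg_dominated_Rintegral _ _ _ (itime (C * `|v| `^ dlt)) _).2 => //.
- by move=> n; exact: (mn n).2.
- by move=> n t _; exact: (mean_incrP F (tn n) x v t).2.
Qed.

Lemma stein_identity_lim : stein_identity f.
Proof.
split; [exact: mf|exact: iX|move=> x].
have idom : nu.-integrable setT (fun u => (C * time_mass dlt * levy_dom dlt u)%:E).
  by apply: integrableZlR => //; exact: integrable_levy_dom_nu.
have cI : \int[nu]_u (stein_incr F (f_ n) x u - u * trunc u * stein_sol F (f_ n) x)
    @[n --> \oo] --> \int[nu]_u (stein_incr F f x u - u * trunc u * stein_sol F f x).
  apply: (cvg_dominated_Rintegral _ _ _ idom _).2 => //.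
  - by move=> n; exact: (measurable_compensated dlt0 dlt1 (tn n) (mn n)).
  - move=> u _; apply: cvgB; first exact: cvg_stein_incr.
    by apply: cvgM; [exact: cvg_cst|exact: cvg_stein_sol].
  - by move=> n u _; exact: (levy_dom_compensated dlt0 dlt1 (tn n) (mn n)).
have cL : f_ n x - \int[P]_w f_ n (X w) @[n --> \oo] --> f x - \int[P]_w f (X w).
  by apply: cvgB; [exact: cf|exact: cX].
have cR : f_ n x - \int[P]_w f_ n (X w) @[n --> \oo] -->
    (- x + beta - (m1%:num - m2%:num)) * stein_sol F f x +
    alpha * \int[nu]_u (stein_incr F f x u - u * trunc u * stein_sol F f x).
  have -> : (fun n => f_ n x - \int[P]_w f_ n (X w)) =
    (fun n => (- x + beta - (m1%:num - m2%:num)) * stein_sol F (f_ n) x +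
      alpha * \int[nu]_u (stein_incr F (f_ n) x u - u * trunc u * stein_sol F (f_ n) x)).
    by apply/funext => n; case: (sn n) => _ _ /(_ x) ->.
  by apply: cvgD; apply: cvgM; [exact: cvg_cst|exact: cvg_stein_sol|exact: cvg_cst|exact: cI].
exact: cvg_unique cL cR.
Qed.

End limit.

Section linear.
Variables (f g : R -> R) (C C' a : R).
Hypothesis tf : tame dlt C f.
Hypothesis tg : tame dlt C' g.
Notation h := (fun x => a * f x + g x).

Let derive1_lin (x : R) : is_derive x 1 h (a * derive1 f x + derive1 g x).
Proof.
have df := tame_is_derive tf x; have dg := tame_is_derive tg x.
by apply: is_derive_eq; rewrite /GRing.scale/=; ring.
Qed.

Let derive1E_lin : derive1 h = fun x => a * derive1 f x + derive1 g x.
Proof. by apply/funext => x; rewrite derive1E; have [_ ->] := derive1_lin x. Qed.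

Lemma tame_lin : tame dlt (`|a| * C + C') h.
Proof.
case: (tf) => _ f1 f2 f3; case: (tg) => _ g1 g2 g3.
have lin (u v c c' : R) : `|u| <= c -> `|v| <= c' -> `|a * u + v| <= `|a| * c + c'.
  move=> uc vc; rewrite (le_trans (ler_normD _ _))// normrM lerD// ler_wpM2l//.
split; rewrite ?derive1E_lin.
- by move=> x; have [] := derive1_lin x.
- by move=> x; apply: lin.
- move=> x y; rewrite (_ : _ - _ = a * (derive1 f y - derive1 f x)
    + (derive1 g y - derive1 g x)); last by ring.
  by rewrite mulrDl -mulrA; apply: lin.
- move=> x y; rewrite (_ : _ - _ = a * (f y - f x) + (g y - g x)); last by ring.
  by rewrite mulrDl -mulrA; apply: lin.
Qed.

Hypothesis sf : stein_identity f.
Hypothesis sg : stein_identity g.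

Let mf : measurable_means F f. Proof. by case: sf. Qed.
Let mg : measurable_means F g. Proof. by case: sg. Qed.

Let mean_derive_lin x t :
  mean_derive F h x t = a * mean_derive F f x t + mean_derive F g x t.
Proof.
have [i1 _] := mean_deriveP F tf x t; have [i2 _] := mean_deriveP F tg x t.
by rewrite /mean_derive derive1E_lin -(Rintegral_lin a measurableT i1 i2).
Qed.

Let mean_incr_lin x v t :
  mean_incr F h x v t = a * mean_incr F f x v t + mean_incr F g x v t.
Proof.
have [i1 _] := mean_incrP F tf x v t; have [i2 _] := mean_incrP F tg x v t.
rewrite /mean_incr -(Rintegral_lin a measurableT i1 i2).
by apply: eq_Rintegral => u _; ring.
Qed.

Let stein_sol_lin x : stein_sol F h x = a * stein_sol F f x + stein_sol F g x.
Proof.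
rewrite !stein_solE mulrN -opprD -Rintegral_lin; first last.
- exact: (stein_solP dlt0 dlt1 tg mg x).1.
- exact: (stein_solP dlt0 dlt1 tf mf x).1.
- by [].
congr (- _); apply: eq_Rintegral => t _; rewrite mean_derive_lin.
by rewrite mulrDr mulrCA.
Qed.

Let stein_incr_lin x v : stein_incr F h x v = a * stein_incr F f x v + stein_incr F g x v.
Proof.
rewrite /stein_incr mulrN -opprD -Rintegral_lin; first last.
- exact: (stein_incrP dlt0 tg mg x v).1.
- exact: (stein_incrP dlt0 tf mf x v).1.
- by [].
by congr (- _); apply: eq_Rintegral => t _; rewrite mean_incr_lin.
Qed.

Let compensated_integrable q c x : tame dlt c q -> measurable_means F q ->
  nu.-integrable setT (fun u => (stein_incr F q x u - u * trunc u * stein_sol F q x)%:E).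
Proof.
move=> tq mq.
apply: (levy_split m1 m2 alpha02 dltalpha dlt1
  (measurable_compensated dlt0 dlt1 tq mq x)
  (levy_dom_compensated dlt0 dlt1 tq mq x)).1.
Qed.

Lemma stein_identity_lin : stein_identity h.
Proof.
case: (sf) => _ iXf ef; case: (sg) => _ iXg eg; split.
- split=> [x|x v].
    rewrite (funext (mean_derive_lin x)).
    by apply: measurable_funD; [apply: measurable_funM => //; exact: mf.1|exact: mg.1].
  rewrite (funext (mean_incr_lin x v)).
  by apply: measurable_funD; [apply: measurable_funM => //; exact: mf.2|exact: mg.2].
- by apply: integrableDR => //; exact: integrableZlR.
- move=> x.
  have nuE : \int[nu]_u (stein_incr F h x u - u * trunc u * stein_sol F h x) =
      a * \int[nu]_u (stein_incr F f x u - u * trunc u * stein_sol F f x)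
      + \int[nu]_u (stein_incr F g x u - u * trunc u * stein_sol F g x).
    rewrite -(Rintegral_lin a measurableT (compensated_integrable x tf mf)
      (compensated_integrable x tg mg)).
    apply: eq_Rintegral => u _; rewrite stein_incr_lin stein_sol_lin.
    move: (stein_incr F f x u) (stein_incr F g x u) (stein_sol F f x)
      (stein_sol F g x) (trunc u) => A B A' B' c.
    ring.
  rewrite nuE (Rintegral_lin a measurableT iXf iXg) stein_sol_lin {nuE}.
  have alg (k A A' B B' u v : R) : u = k * A' + alpha * A -> v = k * B' + alpha * B ->
      a * u + v = k * (a * A' + B') + alpha * (a * A + B).
    by move=> -> ->; ring.
  rewrite opprD addrACA -mulrBr.
  exact: alg (ef x) (eg x).
Qed.

End linear.
End closure.

(** * Bernstein polynomials *)
Section bernstein.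
Context {R : realType}.
Implicit Types (a b : nat -> R) (p : R) (n : nat).

(** De Casteljau's recursion for the polynomial sum_k 'C(n, k) p^k (1 - p)^(n - k)
    a k; all the properties below are then inductions without binomials. *)
Fixpoint bernstein n a p : R :=
  if n is m.+1 then (1 - p) * bernstein m a p + p * bernstein m (fun k => a k.+1) p
  else a 0%N.

Lemma bernsteinB n a b p :
  bernstein n (fun k => a k - b k) p = bernstein n a p - bernstein n b p.
Proof. by elim: n a b => [//|n IH] a b /=; rewrite !IH; ring. Qed.

Lemma bernstein_affine n a (c e p : R) :
  bernstein n (fun k => c + e * a k) p = c + e * bernstein n a p.
Proof. by elim: n a => [//|n IH] a /=; rewrite !IH; ring. Qed.

Lemma bernstein_cst n (c p : R) : bernstein n (fun=> c) p = c.
Proof. by elim: n => [//|n IH] /=; rewrite IH; ring. Qed.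

Lemma bernstein_norm_le n a b p : 0 <= p <= 1 -> (forall k, `|a k| <= b k) ->
  `|bernstein n a p| <= bernstein n b p.
Proof.
move=> /andP[p0 p1]; have q0 : 0 <= 1 - p by rewrite subr_ge0.
elim: n a b => [|n IH] a b ab /=; first exact: ab.
rewrite (le_trans (ler_normD _ _))// !normrM (ger0_norm q0) (ger0_norm p0).
by apply: lerD; rewrite ler_wpM2l//; apply: IH.
Qed.

Lemma bernstein_bound n a (c p : R) : 0 <= p <= 1 -> (forall k, `|a k| <= c) ->
  `|bernstein n a p| <= c.
Proof.
move=> p01 ac; rewrite (le_trans (bernstein_norm_le n p01 ac))//.
by rewrite bernstein_cst.
Qed.

Lemma is_derive_bernstein n a p :
  is_derive p 1 (bernstein n.+1 a) (n.+1%:R * bernstein n (fun k => a k.+1 - a k) p).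
Proof.
elim: n a => [|n IH] a.
  apply: is_derive_eq.
  by rewrite /GRing.scale/=; ring.
have h1 := IH a; have h2 := IH (fun k => a k.+1).
have H (A B : R -> R) (A' B' : R) : is_derive p 1 A A' -> is_derive p 1 B B' ->
    is_derive p 1 (fun q => (1 - q) * A q + q * B q)
      ((1 - p) * A' + p * B' + (B p - A p)).
  by move=> hA hB; apply: is_derive_eq; rewrite /GRing.scale/=; ring.
have := H _ _ _ _ h1 h2; rewrite -bernsteinB => h.
apply: is_derive_eq => /=; rewrite -[n.+2%:R]natr1; ring.
Qed.

(** The second moment around c of the binomial law, i.e. its variance plus the
    squared bias. *)
Lemma bernstein_second_moment n (c p : R) :
  bernstein n (fun k => (k%:R - c) ^+ 2) p =
  n%:R * p * (1 - p) + (n%:R * p - c) ^+ 2.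
Proof.
elim: n c => [|n IH] c /=; first by ring.
rewrite IH.
have -> : (fun k => (k.+1%:R - c) ^+ 2) = (fun k => (k%:R - (c - 1)) ^+ 2).
  by apply/funext => k; rewrite -natr1; ring.
by rewrite IH -natr1; ring.
Qed.

(** Bernstein's argument: |t| <= e + t^2 / e turns the variance bound into an
    error bound for Lipschitz functions. *)
Lemma bernstein_error n (H : R -> R) (L e p : R) : 0 <= p <= 1 -> 0 < e ->
  (forall x y, `|H y - H x| <= L * `|y - x|) ->
  `|bernstein n.+1 (fun k => H (k%:R / n.+1%:R)) p - H p| <= L * (e + (n.+1%:R * e)^-1).
Proof.
move=> p01 e0 HL.
have L0 : 0 <= L by have := HL 0 1; rewrite subr0 normr1 mulr1; exact: le_trans.
set N : R := n.+1%:R; have N0 : 0 < N by rewrite ltr0n.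
have -> : bernstein n.+1 (fun k => H (k%:R / N)) p - H p =
    bernstein n.+1 (fun k => H (k%:R / N) - H p) p.
  by rewrite bernsteinB bernstein_cst.
have b k : `|H (k%:R / N) - H p| <= L * e + L / (N ^+ 2 * e) * (k%:R - N * p) ^+ 2.
  rewrite (le_trans (HL _ _))// -mulrA -mulrDr ler_wpM2l//.
  have -> : (N ^+ 2 * e)^-1 * (k%:R - N * p) ^+ 2 = (k%:R / N - p) ^+ 2 / e.
    by field; rewrite !gt_eqF.
  set t := _ - p; have [te|te] := leP `|t| e.
    by rewrite (le_trans te)// lerDl divr_ge0 ?sqr_ge0// ltW.
  rewrite (@le_trans _ _ (t ^+ 2 / e)) ?lerDr ?(ltW e0)//.
  rewrite ler_pdivlMr// -[t ^+ 2]ger0_norm ?sqr_ge0// normrX expr2.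
  by rewrite ler_wpM2l// ltW.
rewrite (le_trans (bernstein_norm_le n.+1 p01 b))// bernstein_affine.
rewrite bernstein_second_moment -/N subrr expr0n/= addr0 [leRHS]mulrDr lerD2l.
have -> : L / (N ^+ 2 * e) * (N * p * (1 - p)) = L / (N * e) * (p * (1 - p)).
  by field; rewrite !gt_eqF.
case/andP: p01 => p0 p1.
by rewrite ler_piMr ?divr_ge0 ?mulr_ge0 ?(ltW e0) ?(ltW N0)//; nra.
Qed.

Lemma cvg_bernstein (H : R -> R) (L p : R) : 0 <= p <= 1 ->
  (forall x y, `|H y - H x| <= L * `|y - x|) ->
  bernstein n.+1 (fun k => H (k%:R / n.+1%:R)) p @[n --> \oo] --> H p.
Proof.
move=> p01 HL.
have L0 : 0 <= L by have := HL 0 1; rewrite subr0 normr1 mulr1; exact: le_trans.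
have L1 : 0 < L + 1 by rewrite ltr_wpDl.
apply/cvgrPdist_le => /= e e0.
have [r r0 rE] : exists2 r, 0 < r & (L + 1) * (r + r) = e.
  by exists (e / (2 * (L + 1))); [rewrite divr_gt0// mulr_gt0|field; rewrite gt_eqF].
near=> n.
rewrite distrC (le_trans (bernstein_error n p01 r0 HL))//.
rewrite -rE; apply: ler_pM => //; first by rewrite addr_ge0 ?(ltW r0)// invr_ge0 mulr_ge0 ?(ltW r0).
  by rewrite lerDl.
rewrite lerD2l -[leRHS]invrK lef_pV2 ?posrE ?invr_gt0 ?mulr_gt0//.
rewrite -ler_pdivrMr// (@le_trans _ _ n%:R) ?ler_nat//.
by near: n; exact: nbhs_infty_ger.
Unshelve. all: by end_near. Qed.

End bernstein.

(** * Approximation by trigonometric polynomials *)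
Section trigonometric_polynomials.
Context {R : realType}.

(** The phases th make sines available as cosines and let products be linearized
    without a separate sine case. *)
Inductive trigpoly : (R -> R) -> Prop :=
| trigpoly_cos z th : trigpoly (fun x => cos (z * x + th))
| trigpoly_lin a f g : trigpoly f -> trigpoly g -> trigpoly (fun x => a * f x + g x).

Lemma trigpolyZ a f : trigpoly f -> trigpoly (fun x => a * f x).
Proof.
move=> tf; have := trigpoly_lin (a - 1) tf tf.
by congr trigpoly; apply/funext => x; ring.
Qed.

Lemma trigpolyM_cos z th f : trigpoly f -> trigpoly (fun x => cos (z * x + th) * f x).
Proof.
elim=> [w ph|a g h _ IHg _ IHh].
  have := trigpoly_lin 2^-1 (trigpoly_cos (z + w) (th + ph))
    (trigpolyZ 2^-1 (trigpoly_cos (z - w) (th - ph))).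
  congr trigpoly; apply/funext => x.
  have -> : (z + w) * x + (th + ph) = (z * x + th) + (w * x + ph) by ring.
  have -> : (z - w) * x + (th - ph) = (z * x + th) - (w * x + ph) by ring.
  by rewrite cosD cosB; field.
have := trigpoly_lin a IHg IHh.
by congr trigpoly; apply/funext => x; ring.
Qed.

(** A parametrization of [0, 1] by a trigonometric polynomial: substituted into a
    Bernstein polynomial, it gives a trigonometric polynomial. *)
Definition sinparam (w x : R) : R := (1 + sin (w * x)) / 2.

Lemma trigpolyM_sinparam w f : trigpoly f -> trigpoly (fun x => sinparam w x * f x).
Proof.
move=> tf; have := trigpoly_lin 2^-1 (trigpolyM_cos w (- (pi / 2)) tf) (trigpolyZ 2^-1 tf).
congr trigpoly; apply/funext => x.
by rewrite /sinparam cosBpihalf; field.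
Qed.

Lemma trigpoly_bernstein n a w : trigpoly (fun x => bernstein n a (sinparam w x)).
Proof.
elim: n a => [a|n IH a] /=.
  have := trigpolyZ (a 0%N) (trigpoly_cos 0 0).
  by congr trigpoly; apply/funext => x; rewrite mul0r add0r cos0 mulr1.
have := trigpoly_lin (- 1) (trigpolyM_sinparam w (IH a))
  (trigpoly_lin 1 (IH a) (trigpolyM_sinparam w (IH (fun k => a k.+1)))).
by congr trigpoly; apply/funext => x; ring.
Qed.

Lemma sinparam01 w x : 0 <= sinparam w x <= 1.
Proof.
have a := sin_geN1 (w * x); have b := sin_le1 (w * x).
by rewrite /sinparam; apply/andP; split; lra.
Qed.

Section approximation.
Variables (f : R -> R) (C w : R).
Hypothesis df : forall x : R, is_derive x 1 f (derive1 f x).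
Hypothesis f1 : forall x, `|derive1 f x| <= C.
Hypothesis f2 : forall x y, `|derive1 f y - derive1 f x| <= C * `|y - x|.
Hypothesis w0 : 0 < w.

(** The Bernstein polynomial of q |-> f ((2 q - 1) / w) at q = sinparam w x, where
    (2 q - 1) / w = sin (w x) / w. The degree is at least 2 because two
    derivatives are controlled. *)
Definition sinapprox n x : R :=
  bernstein n.+2 (fun k => f ((2 * (k%:R / n.+2%:R) - 1) / w)) (sinparam w x).

Let C0 : 0 <= C. Proof. exact: le_trans (f1 0). Qed.

Let lip x y : `|f y - f x| <= C * `|y - x|. Proof. exact: ler_lipschitz f1 x y. Qed.

Lemma cvg_sinapprox x : sinapprox n x @[n --> \oo] --> f (sin (w * x) / w).
Proof.
pose H q := f ((2 * q - 1) / w).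
have HL p q : `|H q - H p| <= (2 * C / w) * `|q - p|.
  rewrite (le_trans (lip _ _))// -mulrBl (_ : 2 * q - 1 - _ = 2 * (q - p)); last by ring.
  rewrite 2!normrM normfV (gtr0_norm w0) ger0_norm// le_eqVlt; apply/orP; left; apply/eqP.
  ring.
have -> : f (sin (w * x) / w) = H (sinparam w x).
  by rewrite /H /sinparam; congr f; field; rewrite gt_eqF.
have := cvg_bernstein (sinparam01 w x) HL.
by rewrite -(cvg_shiftS (fun n => bernstein n.+1 _ _)).
Qed.

Lemma sinapprox_bound B n x : (forall x, `|f x| <= B) -> `|sinapprox n x| <= B.
Proof. by move=> fB; apply: bernstein_bound => //; exact: sinparam01. Qed.

Let a n k := f ((2 * (k%:R / n.+2%:R) - 1) / w).
Let b n k := a n k.+1 - a n k.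
Let step n : R := 2 / (n.+2%:R * w).

Let step0 n : 0 < step n. Proof. by rewrite divr_gt0// mulr_gt0// ltr0n. Qed.

Let aS n k : a n k.+1 = f ((2 * (k%:R / n.+2%:R) - 1) / w + step n).
Proof.
rewrite /a /step -natr1; congr f; field.
by rewrite gt_eqF//= pnatr_eq0.
Qed.

Let b_le n k : `|b n k| <= C * step n.
Proof. by rewrite /b aS (le_trans (lip _ _))// addrAC subrr add0r gtr0_norm. Qed.

(** A second difference of f, bounded through two Taylor expansions at the middle
    point; this controls the second derivative of the approximant although f'' need
    not exist. *)
Let Db_le n k : `|b n k.+1 - b n k| <= 2 * C * step n ^+ 2.
Proof.
rewrite /b (aS n k.+1); have := aS n k; set t := (_ - 1) / w => E.
have -> : (2 * (k.+1%:R / n.+2%:R) - 1) / w = t + step n.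
  by rewrite /t /step -[k.+1%:R]natr1; field; rewrite gt_eqF//= pnatr_eq0.
rewrite E -/(a n k) -[a n k]/(f t).
have h1 := ler_taylor1 df f2 (t + step n) (step n).
have h2 := ler_taylor1 df f2 (t + step n) (- step n).
rewrite addrK sqrrN mulNr opprK in h2.
set x := f (t + step n + step n) in h1 *.
have -> : x - f (t + step n) - (f (t + step n) - f t) =
  (x - f (t + step n) - step n * derive1 f (t + step n)) +
  (f t - f (t + step n) + step n * derive1 f (t + step n)) by ring.
by rewrite (le_trans (ler_normD _ _))// -mulrA mulr_natl mulr2n lerD.
Qed.

Let is_derive_sinparam (x : R) : is_derive x 1 (sinparam w) (cos (w * x) * w / 2).
Proof.
have h : is_derive x 1 (fun x => (1 + sin (w * x)) / 2) (cos (w * x) * w / 2).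
  by apply: is_derive_eq; rewrite /GRing.scale/=; field.
exact: h.
Qed.

Let u n x := n.+2%:R * bernstein n.+1 (b n) (sinparam w x).
Let u' n x := n.+2%:R * (n.+1%:R * bernstein n (fun k => b n k.+1 - b n k) (sinparam w x)
  * (cos (w * x) * w / 2)).
Let v x := cos (w * x) * w / 2.
Let v' x := - (sin (w * x) * w ^+ 2 / 2).

Let du n (x : R) : is_derive x 1 (u n) (u' n x).
Proof.
have h := is_derive1_comp (is_derive_bernstein n (b n) (sinparam w x)) (is_derive_sinparam x).
have : is_derive x 1 (n.+2%:R *: (bernstein n.+1 (b n) \o sinparam w)) (u' n x).
  by apply: is_deriveZ.
by [].
Qed.

Let dv (x : R) : is_derive x 1 v (v' x).
Proof.
have h : is_derive x 1 (fun x => cos (w * x) * w / 2) (v' x).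
  by apply: is_derive_eq; rewrite /GRing.scale/= /v'; field.
exact: h.
Qed.

Let dsinapprox n (x : R) : is_derive x 1 (sinapprox n) (u n x * v x).
Proof.
have h := is_derive1_comp (is_derive_bernstein n.+1 (a n) (sinparam w x)) (is_derive_sinparam x).
exact: h.
Qed.

Let step_natr n : n.+2%:R * step n = 2 / w.
Proof. by rewrite /step; field; rewrite gt_eqF//= pnatr_eq0. Qed.

Let u_le n x : `|u n x| <= 2 * C / w.
Proof.
rewrite /u normrM ger0_norm//.
rewrite (@le_trans _ _ (n.+2%:R * (C * step n)))//.
  by rewrite ler_wpM2l// bernstein_bound ?sinparam01.
by rewrite mulrCA step_natr le_eqVlt; apply/orP; left; apply/eqP; ring.
Qed.

Let u'_le n x : `|u' n x| <= 4 * C / w.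
Proof.
have cw : `|cos (w * x) * w / 2| <= w / 2.
  rewrite -mulrA normrM [X in _ * X]ger0_norm ?(divr_ge0 (ltW w0))//.
  by rewrite ler_piMl ?cos_le1n// divr_ge0 ?ltW.
rewrite /u' mulrA normrM (@le_trans _ _ (n.+2%:R * (n.+2%:R * (2 * C * step n ^+ 2)) * (w / 2)))//.
  apply: ler_pM => //; rewrite !normrM !(ger0_norm (ler0n _ _)) ler_wpM2l// ler_pM ?ler_nat//.
  by rewrite bernstein_bound ?sinparam01.
have -> : n.+2%:R * (n.+2%:R * (2 * C * step n ^+ 2)) = 2 * C * (n.+2%:R * step n) ^+ 2 by ring.
by rewrite step_natr le_eqVlt; apply/orP; left; apply/eqP; field; rewrite gt_eqF.
Qed.

Let v_le x : `|v x| <= w / 2.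
Proof.
rewrite /v -mulrA normrM [X in _ * X]ger0_norm ?(divr_ge0 (ltW w0))//.
by rewrite ler_piMl ?cos_le1n// divr_ge0 ?ltW.
Qed.

Let v'_le x : `|v' x| <= w ^+ 2 / 2.
Proof.
rewrite /v' normrN -mulrA normrM [X in _ * X]ger0_norm ?(divr_ge0 (sqr_ge0 w))//.
by rewrite ler_piMl ?sin_le1n// divr_ge0 ?sqr_ge0.
Qed.

(** Bernstein polynomials inherit the bounds on f, f' and the Lipschitz constant
    of f', uniformly in the degree. *)
Lemma tame_sinapprox dlt B n : 0 <= dlt <= 1 -> (forall x, `|f x| <= B) ->
  tame dlt (2 * B + C + (2 * C + C * w)) (sinapprox n).
Proof.
move=> d01 fB; apply: (tame_bounded d01 _ (dsinapprox n)).
- by move=> x; exact: sinapprox_bound.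
- move=> x; rewrite normrM (le_trans (ler_pM _ _ (u_le n x) (v_le x)))//.
  by rewrite le_eqVlt; apply/orP; left; apply/eqP; field; rewrite gt_eqF.
- have duv (x : R) : is_derive x 1 (fun x => u n x * v x) (u' n x * v x + u n x * v' x).
    have h1 := du n x; have h2 := dv x.
    have := is_deriveM h1 h2; rewrite /GRing.scale/= addrC (mulrC (v x)).
    exact.
  apply: ler_lipschitz duv _ => x.
  have -> : 2 * C + C * w = 4 * C / w * (w / 2) + 2 * C / w * (w ^+ 2 / 2).
    by field; rewrite gt_eqF.
  apply: le_trans (ler_normD _ _) _; apply: lerD; rewrite normrM; apply: ler_pM => //.
Qed.

Lemma tame_comp_sin dlt B : 0 <= dlt <= 1 -> (forall x, `|f x| <= B) ->
  tame dlt (2 * B + C + (2 * C + C * w)) (fun x => f (sin (w * x) / w)).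
Proof.
move=> d01 fB.
have ds (x : R) : is_derive x 1 (fun x => sin (w * x) / w) (cos (w * x)).
  by apply: is_derive_eq; rewrite /GRing.scale/=; field; rewrite gt_eqF.
have dfs (x : R) : is_derive x 1 (fun x => f (sin (w * x) / w))
    (derive1 f (sin (w * x) / w) * cos (w * x)).
  exact: is_derive1_comp (df _) (ds x).
apply: (tame_bounded d01 _ dfs).
- by move=> x; exact: fB.
- move=> x; rewrite normrM -[leRHS]mulr1.
  by apply: ler_pM => //; exact: cos_le1n.
- move=> x y.
  have -> : derive1 f (sin (w * y) / w) * cos (w * y)
      - derive1 f (sin (w * x) / w) * cos (w * x) =
    (derive1 f (sin (w * y) / w) - derive1 f (sin (w * x) / w)) * cos (w * y)
    + derive1 f (sin (w * x) / w) * (cos (w * y) - cos (w * x)) by ring.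
  rewrite [leRHS]mulrDl; apply: le_trans (ler_normD _ _) _; apply: lerD; rewrite normrM.
    rewrite -[leRHS]mulr1; apply: ler_pM => //; last exact: cos_le1n.
    rewrite (le_trans (f2 _ _))//.
    have h := ler_lipschitz ds (fun x => cos_le1n _) x y.
    rewrite mul1r in h.
    rewrite (@le_trans _ _ (C * `|y - x|)) ?ler_wpM2l//.
    by rewrite ler_wpM2r// ler_peMl// ler1n.
  rewrite -mulrA; apply: ler_pM => //.
  by rewrite (le_trans (lipschitz_cos _ _))// -mulrBr normrM gtr0_norm.
Qed.

End approximation.
End trigonometric_polynomials.

(** * Smooth truncations *)
Section tame_composition.
Context {R : realType}.
Variables (dlt C L : R) (f phi phi' : R -> R).
Hypothesis dlt01 : 0 <= dlt <= 1.
Hypothesis tf : tame dlt C f.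
Hypothesis dphi : forall x : R, is_derive x 1 phi (phi' x).
Hypothesis phi1 : forall x, `|phi' x| <= 1.
Hypothesis phi2 : forall x y, `|phi' y - phi' x| <= L * `|y - x|.

Lemma tame_outer : tame dlt (C + L * C * C) (phi \o f).
Proof.
have C0 := tame_ge0 tf.
have L0 : 0 <= L by have := phi2 0 1; rewrite subr0 normr1 mulr1; exact: le_trans.
have LC : 0 <= L * C * C by rewrite !mulr_ge0.
case: (tf) => _ f1 f2 f3.
have lf := ler_lipschitz (tame_is_derive tf) f1.
have lphi := ler_lipschitz dphi phi1.
have dc (x : R) : is_derive x 1 (phi \o f) (phi' (f x) * derive1 f x).
  exact: (is_derive1_comp (dphi (f x)) (tame_is_derive tf x)).
have dE : derive1 (phi \o f) = (fun x => phi' (f x) * derive1 f x).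
  by apply/funext => x; rewrite derive1E; have [_ ->] := dc x.
split; rewrite ?dE.
- by move=> x; have [] := dc x.
- move=> x; rewrite normrM (@le_trans _ _ (1 * C)) ?ler_pM// mul1r lerDl//.
- move=> x y.
  have -> : phi' (f y) * derive1 f y - phi' (f x) * derive1 f x =
    phi' (f y) * (derive1 f y - derive1 f x) + (phi' (f y) - phi' (f x)) * derive1 f x by ring.
  rewrite [leRHS]mulrDl; apply: le_trans (ler_normD _ _) _; apply: lerD; rewrite normrM.
    by rewrite -[leRHS]mul1r; apply: ler_pM.
  rewrite [leRHS]mulrAC; apply: ler_pM => //.
  by rewrite (le_trans (phi2 _ _))// -mulrA ler_wpM2l.
- move=> x y /=; rewrite (le_trans (lphi _ _))// mul1r (le_trans (f3 x y))//.
  by rewrite ler_wpM2r ?powR_ge0// lerDl.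
Qed.

End tame_composition.

Section smooth_norm.
Context {R : realType}.

(** A smooth substitute for |y|, in order to bound E |f(X)| by the Stein identity
    of a tame function. *)
Definition smooth_norm (y : R) : R := Num.sqrt (1 + y ^+ 2).

Lemma smooth_norm_gt0 y : 0 < smooth_norm y.
Proof. by rewrite sqrtr_gt0 ltr_pwDl// sqr_ge0. Qed.

Lemma sqr_smooth_norm y : smooth_norm y ^+ 2 = 1 + y ^+ 2.
Proof. by rewrite sqr_sqrtr// addr_ge0// sqr_ge0. Qed.

Lemma ler_smooth_norm y : `|y| <= smooth_norm y.
Proof. by rewrite -sqrtr_sqr ler_sqrt ?addr_ge0 ?sqr_ge0// lerDr. Qed.

Lemma smooth_norm_ge1 y : 1 <= smooth_norm y.
Proof. by rewrite -[leLHS]sqrtr1 ler_sqrt ?addr_ge0 ?sqr_ge0// lerDl sqr_ge0. Qed.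

Lemma smooth_norm_le y : smooth_norm y <= 1 + `|y|.
Proof.
rewrite -(@ler_pXn2r _ 2)// ?nnegrE ?(ltW (smooth_norm_gt0 _)) ?addr_ge0//.
by rewrite sqr_smooth_norm sqrrD expr1n mul1r real_normK ?num_real// lerD2r lerDl mulrn_wge0.
Qed.

Lemma is_derive_smooth_norm (y : R) : is_derive y 1 smooth_norm (y / smooth_norm y).
Proof.
have h : 0 < 1 + y ^+ 2 by rewrite ltr_pwDl// sqr_ge0.
have d1 := is_derive1_sqrt h.
have d2 : is_derive y 1 (fun y : R => 1 + y ^+ 2) (2 * y).
  by apply: is_derive_eq; rewrite /GRing.scale/=; ring.
have := is_derive1_comp (g := fun y : R => 1 + y ^+ 2) d1 d2.
rewrite -/(smooth_norm y) (_ : _^-1 * _ = y / smooth_norm y)//.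
by field; rewrite gt_eqF// smooth_norm_gt0.
Qed.

Let slope_le (y : R) : `|y / smooth_norm y| <= 1.
Proof.
rewrite normrM normfV (gtr0_norm (smooth_norm_gt0 y)) ler_pdivrMr ?smooth_norm_gt0//.
by rewrite mul1r ler_smooth_norm.
Qed.

Let slope_lip (x y : R) : `|y / smooth_norm y - x / smooth_norm x| <= 2 * `|y - x|.
Proof.
have sx := smooth_norm_gt0 x; have sy := smooth_norm_gt0 y.
have l := ler_lipschitz is_derive_smooth_norm slope_le x y; rewrite mul1r in l.
have -> : y / smooth_norm y - x / smooth_norm x =
    (y - x) / smooth_norm x + (y / smooth_norm y) * ((smooth_norm x - smooth_norm y) / smooth_norm x).
  by field; rewrite !gt_eqF.
have inv1 : `|(smooth_norm x)^-1| <= 1.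
  by rewrite gtr0_norm ?invr_gt0// invf_le1// smooth_norm_ge1.
rewrite mulr_natl mulr2n; apply: le_trans (ler_normD _ _) _; apply: lerD.
  by rewrite normrM ler_piMr.
rewrite normrM -[leRHS]mul1r; apply: ler_pM => //.
rewrite normrM -[leRHS]mulr1; apply: ler_pM => //.
by rewrite distrC.
Qed.

Lemma tame_smooth_norm (dlt C : R) (f : R -> R) : 0 <= dlt <= 1 -> tame dlt C f ->
  tame dlt (C + 2 * C * C) (smooth_norm \o f).
Proof.
by move=> d01 tf; apply: tame_outer tf is_derive_smooth_norm slope_le slope_lip.
Qed.

End smooth_norm.

Section smooth_truncation.
Context {R : realType}.

(** M sin (y / M) with M = m + 1: bounded by M, at most |y|, and with slope at
    most 1. It serves both on the argument of f and on its values. *)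
Definition smooth_trunc (m : nat) (y : R) : R := sin (m.+1%:R^-1 * y) / m.+1%:R^-1.

Let w0 (m : nat) : 0 < m.+1%:R^-1 :> R. Proof. by rewrite invr_gt0. Qed.

Let is_derive_smooth_trunc m (y : R) :
  is_derive y 1 (smooth_trunc m) (cos (m.+1%:R^-1 * y)).
Proof.
have h w : w != 0 -> is_derive y 1 (fun y => sin (w * y) / w) (cos (w * y)).
  by move=> w1; apply: is_derive_eq; rewrite /GRing.scale/=; field.
by apply: h; rewrite gt_eqF.
Qed.

Lemma smooth_trunc_bound m y : `|smooth_trunc m y| <= m.+1%:R.
Proof.
rewrite /smooth_trunc invrK normrM [X in _ * X]ger0_norm//.
by rewrite ler_piMl// sin_le1n.
Qed.

Lemma smooth_trunc_le m y : `|smooth_trunc m y| <= `|y|.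
Proof.
have := ler_lipschitz (@is_derive_smooth_trunc m) (fun x => cos_le1n _) 0 y.
by rewrite /smooth_trunc mulr0 sin0 mul0r !subr0 mul1r.
Qed.

Lemma smooth_trunc_error m y : `|smooth_trunc m y - y| <= m.+1%:R^-1 * y ^+ 2.
Proof.
have w0m := w0 m; rewrite /smooth_trunc; set w := _^-1 in w0m *.
have -> : sin (w * y) / w - y = (sin (w * y) - w * y) / w by field; rewrite gt_eqF.
rewrite normrM normfV (gtr0_norm w0m) ler_pdivrMr// (le_trans (ler_norm_sinB _))//.
by rewrite le_eqVlt; apply/orP; left; apply/eqP; ring.
Qed.

Lemma cvg_smooth_trunc y : smooth_trunc m y @[m --> \oo] --> y.
Proof.
have h : (y - m.+1%:R^-1 * y ^+ 2) @[m --> \oo] --> y.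
  rewrite -[X in _ --> X]subr0 -[X in _ --> _ - X](mul0r (y ^+ 2)).
  by apply: cvgB; [exact: cvg_cst|apply: cvgM; [exact: cvg_harmonic|exact: cvg_cst]].
have h' : (y + m.+1%:R^-1 * y ^+ 2) @[m --> \oo] --> y.
  rewrite -[X in _ --> X]addr0 -[X in _ --> _ + X](mul0r (y ^+ 2)).
  by apply: cvgD; [exact: cvg_cst|apply: cvgM; [exact: cvg_harmonic|exact: cvg_cst]].
apply: squeeze_cvgr h h'; apply: nearW => m.
by rewrite -ler_distl smooth_trunc_error.
Qed.

Lemma tame_smooth_trunc (dlt C : R) (f : R -> R) m : 0 <= dlt <= 1 -> tame dlt C f ->
  tame dlt (C + C * C) (smooth_trunc m \o f).
Proof.
move=> d01 tf; have C0 := tame_ge0 tf.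
have l (x y : R) : `|cos (m.+1%:R^-1 * y) - cos (m.+1%:R^-1 * x)| <= 1 * `|y - x|.
  rewrite (le_trans (lipschitz_cos _ _))// -mulrBr normrM ler_wpM2r//.
  by rewrite gtr0_norm// invf_le1// ler1n.
have := tame_outer tf (@is_derive_smooth_trunc m) (fun x => cos_le1n _) l.
by rewrite mul1r.
Qed.

End smooth_truncation.

(** * The Stein identity for tame functions *)
Section stein_identity_tame.
Context {R : realType}.
Notation mu := (@lebesgue_measure R).
Notation trunc := (\1_[set v : R | `|v| <= 1] : R -> R).
Variables (alpha beta : R) (m1 m2 : {nonneg R}).
Variables (d : measure_display) (T : measurableType d) (P : probability T R).
Variables (X : {RV P >-> R}) (F : R -> probability R R).
Notation nu := (levy_measure alpha m1 m2).
Notation stein_identity := (stein_identity alpha beta m1 m2 X F).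
Variable dlt : R.
Hypothesis alpha02 : 0 < alpha < 2.
Hypothesis dlt0 : 0 < dlt.
Hypothesis dltalpha : dlt < alpha.
Hypothesis dlt1 : dlt <= 1.
Hypothesis hX : is_stable alpha beta m1 m2 P X.
Hypothesis hF : self_decomp_laws P X F.

Let dlt01 : 0 <= dlt <= 1. Proof. by rewrite (ltW dlt0) dlt1. Qed.

Lemma stein_identity_trigpoly f : trigpoly f ->
  (exists C, tame dlt C f) /\ stein_identity f.
Proof.
elim=> [z th|a g h _ [[C tg] sg] _ [[C' th] sh]].
  split; first exact: tame_cos.
  exact: (stein_identity_cos alpha02 dlt0 dltalpha dlt1 hX hF).
split; first by exists (`|a| * C + C'); exact: tame_lin.
exact: (stein_identity_lin alpha02 dlt0 dltalpha dlt1 a tg th sg sh).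
Qed.

Let measurable_law (f : R -> R) : continuous f -> measurable_fun setT (fun w => f (X w)).
Proof.
by move=> cf; apply: (measurableT_comp (continuous_measurable_fun cf)).
Qed.

Section bounded.
Variables (f : R -> R) (B C : R).
Hypothesis tf : tame dlt C f.
Hypothesis fB : forall x, `|f x| <= B.

Let C0 : 0 <= C. Proof. exact: tame_ge0 tf. Qed.

Let lip x y : `|f y - f x| <= C * `|y - x|.
Proof. by apply: (ler_lipschitz (tame_is_derive tf)); case: tf. Qed.

Let cvg_bounded_mean (f_ : nat -> R -> R) (g : R -> R) c c' :
  (forall n, tame dlt c (f_ n)) -> tame dlt c' g ->
  (forall n x, `|f_ n x| <= B) -> (forall x, f_ n x @[n --> \oo] --> g x) ->
  P.-integrable setT (fun w => (g (X w))%:E) /\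
  \int[P]_w f_ n (X w) @[n --> \oo] --> \int[P]_w g (X w).
Proof.
move=> tn tg fnB cf.
apply: (cvg_dominated_Rintegral measurableT (g := cst B)).
- by move=> n; exact: measurable_law (tame_continuous (tn n)).
- by move=> w _; exact: cf.
- exact: finite_measure_integrable_cst.
- by move=> n w _; exact: fnB.
Qed.

Lemma stein_identity_comp_sin w : 0 < w -> stein_identity (fun x => f (sin (w * x) / w)).
Proof.
move=> w0; case: (tf) => _ f1 f2 _; have df := tame_is_derive tf.
have tn n := tame_sinapprox df f1 f2 w0 n dlt01 fB.
have tl := tame_comp_sin df f1 f2 w0 dlt01 fB.
have cn x := @cvg_sinapprox _ _ _ _ df f1 w0 x.
have [iX cX] := cvg_bounded_mean tn tl (fun n x => sinapprox_bound w n x fB) cn.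
apply: (stein_identity_lim alpha02 dlt0 dltalpha dlt1 tn tl cn) => // n.
exact: (stein_identity_trigpoly (trigpoly_bernstein _ _ _)).2.
Qed.

Lemma stein_identity_bounded : stein_identity f.
Proof.
case: (tf) => _ f1 f2 _; have df := tame_is_derive tf.
pose f_ m x := f (smooth_trunc m x).
have w0 m : 0 < m.+1%:R^-1 :> R by rewrite invr_gt0.
have B0 : 0 <= B by exact: le_trans (fB 0).
have tn m : tame dlt (2 * B + C + (2 * C + C)) (f_ m).
  apply: tame_le (tame_comp_sin df f1 f2 (w0 m) dlt01 fB).
  by rewrite !lerD2l ler_piMr// invf_le1// ler1n.
have tl : tame dlt (2 * B + C + (2 * C + C)) f.
  by apply: tame_le tf; move: B0 C0 => ? ?; lra.
have cn x : f_ m x @[m --> \oo] --> f x.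
  exact: (cvg_comp _ _ (@cvg_smooth_trunc R x) (@tame_continuous _ _ _ _ tf x)).
have [iX cX] := cvg_bounded_mean tn tl (fun n x => fB _) cn.
apply: (stein_identity_lim alpha02 dlt0 dltalpha dlt1 tn tl cn) => // m.
exact: stein_identity_comp_sin.
Qed.

End bounded.

(** The bound involves f only through C, which makes the moment bound of
    [integrable_tame] uniform in the truncation. *)
Lemma stein_rhs_bound f C x : tame dlt C f -> measurable_means F f ->
  `|alpha * \int[nu]_u (stein_incr F f x u - u * trunc u * stein_sol F f x)| <=
  alpha * (C * time_mass dlt * \int[nu]_u levy_dom dlt u).
Proof.
move=> tf mf; have a0 : 0 < alpha by case/andP: alpha02.
rewrite normrM (gtr0_norm a0) ler_wpM2l ?(ltW a0)//.
have idom := integrable_levy_dom_nu m1 m2 alpha02 dltalpha dlt1.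
rewrite -(RintegralZl (C * time_mass dlt) measurableT idom).
apply: (ler_norm_Rintegral measurableT).
- exact: (measurable_compensated dlt0 dlt1 tf mf).
- exact: integrableZlR.
- by move=> u _; exact: (levy_dom_compensated dlt0 dlt1 tf mf).
Qed.

Section unbounded.
Variables (f : R -> R) (C : R).
Hypothesis tf : tame dlt C f.

Let tn m := tame_smooth_trunc m dlt01 tf.
Let tr m := tame_smooth_norm dlt01 (tn m).

(** At x = 0 the identity for the smooth norm of the truncated f bounds its mean
    by its value at 0 plus a constant independent of the truncation, which
    Fatou's lemma then removes. *)
Lemma integrable_tame : P.-integrable setT (fun w => (f (X w))%:E).
Proof.
(* C' and C2 are the tameness constants of the truncation and of its smooth norm. *)
pose C' := C + C * C.
pose C2 := C' + 2 * C' * C'.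
pose Q := 1 + `|f 0| + (`|beta - (m1%:num - m2%:num)| * (C2 * time_mass dlt) +
  alpha * (C2 * time_mass dlt * \int[nu]_u levy_dom dlt u)).
have mean_le m : \int[P]_w `|smooth_trunc m (f (X w))| <= Q.
  have gB x : `|(smooth_norm \o (smooth_trunc m \o f)) x| <= 1 + m.+1%:R.
    rewrite ger0_norm ?(ltW (smooth_norm_gt0 _))// (le_trans (smooth_norm_le _))//.
    by rewrite lerD2l smooth_trunc_bound.
  have [mm iX /(_ 0)] := stein_identity_bounded (tr m) gB.
  rewrite oppr0 add0r => E.
  have b1 := stein_rhs_bound 0 (tr m) mm.
  have [_ b2] := stein_solP dlt0 dlt1 (tr m) mm 0.
  apply: (@le_trans _ _ (\int[P]_w (smooth_norm \o (smooth_trunc m \o f)) (X w))).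
    apply: le_Rintegral => //; last by move=> w _; exact: ler_smooth_norm.
    apply: (@integrable_bounded _ _ _ _ _ m.+1%:R).
      by apply: measurableT_comp => //; exact: measurable_law (tame_continuous (tn m)).
    by move=> w; rewrite normr_id smooth_trunc_bound.
  have g0 : (smooth_norm \o (smooth_trunc m \o f)) 0 <= 1 + `|f 0|.
    by rewrite (le_trans (smooth_norm_le _))// lerD2l smooth_trunc_le.
  have alg (G I k a g kb ab : R) : G - I = k + a -> G <= g -> `|k| <= kb -> `|a| <= ab ->
      I <= g + (kb + ab).
    by rewrite !ler_norml => E1 Gg /andP[k1 k2] /andP[a1 a2]; lra.
  apply: alg E g0 _ b1.
  by rewrite normrM ler_wpM2l.
have mabs m : measurable_fun setT (fun w => `|smooth_trunc m (f (X w))|).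
  by apply: measurableT_comp => //; exact: measurable_law (tame_continuous (tn m)).
apply/integrableP; split.
  by apply/measurable_EFinP; exact: measurable_law (tame_continuous tf).
apply: (@le_lt_trans _ _ Q%:E); last exact: ltry.
have lim_abs w : limn_einf (fun m => `|smooth_trunc m (f (X w))|%:E) = `|(f (X w))%:E|%E.
  apply: (cvg_limn_einf_sup _).1; apply: cvg_EFin; first exact: nearW.
  exact: cvg_norm (@cvg_smooth_trunc R _).
under eq_integral do rewrite -lim_abs.
apply: le_trans (fatou P measurableT _ _) _.
- by move=> m; apply/measurable_EFinP.
- by move=> m w _; rewrite lee_fin.
rewrite limn_einf_lim; apply: lime_le; first exact: is_cvg_einfs.
apply: nearW => m; apply: (@le_trans _ _ (\int[P]_w `|smooth_trunc m (f (X w))|%:E)%E).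
  by apply: ereal_inf_lbound; exists m => /=.
have im : P.-integrable setT (fun w => `|smooth_trunc m (f (X w))|%:E).
  apply: (@integrable_bounded _ _ _ _ _ m.+1%:R) => // w.
  by rewrite normr_id smooth_trunc_bound.
by rewrite -[leLHS]fineK ?lee_fin ?mean_le//; exact: integrable_fin_num.
Qed.

Lemma stein_identity_tame : stein_identity f.
Proof.
have C0 := tame_ge0 tf.
have tl : tame dlt (C + C * C) f by apply: tame_le tf; rewrite lerDl mulr_ge0.
have cn x : (smooth_trunc m \o f) x @[m --> \oo] --> f x by exact: cvg_smooth_trunc.
have sn m := stein_identity_bounded (tn m) (fun x => smooth_trunc_bound m (f x)).
apply: (stein_identity_lim alpha02 dlt0 dltalpha dlt1 tn tl cn sn integrable_tame).
apply: (cvg_dominated_Rintegral measurableT (g := fun w => `|f (X w)|) _ _ _ _).2.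
- by move=> m; exact: measurable_law (tame_continuous (tn m)).
- by move=> w _; exact: cn.
- by have := integrable_norm integrable_tame; apply: eq_integrable.
- by move=> m w _; exact: smooth_trunc_le.
Qed.

End unbounded.

End stein_identity_tame.

(** * Integration by parts against the Levy weight *)
Section power_limits.
Context {R : realType}.

Lemma cvg_powR_harmonic (p : R) : 0 < p -> (n.+1%:R^-1 : R) `^ p @[n --> \oo] --> (0 : R).
Proof.
move=> p0; apply: (cvg_at_rightP (fun x : R => x `^ p) 0 0).1; first exact: powR_cvg0.
by split; [move=> n; rewrite invr_gt0|exact: cvg_harmonic].
Qed.

Lemma cvg_dominated_powR (q : nat -> R) (A p : R) : 0 < p ->
  (forall n, `|q n| <= A * (n.+1%:R^-1) `^ p) -> q n @[n --> \oo] --> (0 : R).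
Proof.
move=> p0 qA.
have l : A * (n.+1%:R^-1 : R) `^ p @[n --> \oo] --> (0 : R).
  by rewrite -[X in _ --> X](mulr0 A); apply: cvgM; [exact: cvg_cst|exact: cvg_powR_harmonic].
apply: (@squeeze_cvgr _ _ _ _ (fun n => - (A * (n.+1%:R^-1) `^ p))
  (fun n => A * (n.+1%:R^-1) `^ p)) => //.
- by apply: nearW => n; rewrite -ler_norml.
- by rewrite -[X in _ --> X]oppr0; exact: cvgN.
Qed.

End power_limits.

Section levy_by_parts.
Context {R : realType}.
Notation mu := (@lebesgue_measure R).
Notation half := (`]0%R, +oo[%classic : set R).
Notation trunc := (\1_[set v : R | `|v| <= 1] : R -> R).
Variables (alpha dlt : R).
Hypothesis alpha02 : 0 < alpha < 2.
Hypothesis dlt0 : 0 < dlt.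
Hypothesis dltalpha : dlt < alpha.
Hypothesis dlt1 : dlt <= 1.
Notation wt := (levy_weight alpha).
Variables (D k : R -> R) (A : R).
Hypothesis dD : forall u : R, is_derive u 1 D (k u).
Hypothesis ck : continuous k.
Hypothesis D_dom : forall u, `|D u - u * trunc u * k 0| <= A * levy_dom dlt u.
Hypothesis k_dom : forall u, `|u * (k u - k 0 * trunc u)| <= A * levy_dom dlt u.

Let cD : continuous D.
Proof.
by move=> u; apply/differentiable_continuous/derivable1_diffP; have [] := dD u.
Qed.

Let A0 : 0 <= A.
Proof.
have := D_dom 1; rewrite levy_dom_small ?normr1// expr1n mulr1.
exact: le_trans.
Qed.

Let p (u : R) := u * (k u - k 0 * trunc u).
Let q (u : R) := D u - u * trunc u * k 0.

Let ip : mu.-integrable half (fun u => (p u * wt u)%:E).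
Proof.
apply: (half_integrable alpha02 dltalpha dlt1 (k := p) (C := A)) => [|u _]; last exact: k_dom.
apply: measurable_funM => //; apply: measurable_funB.
  exact: continuous_measurable_fun.
by apply: measurable_funM => //; exact: measurable_trunc.
Qed.

Let iq : mu.-integrable half (fun u => (q u * wt u)%:E).
Proof.
apply: (half_integrable alpha02 dltalpha dlt1 (k := q) (C := A)) => [|u _]; last exact: D_dom.
apply: measurable_funB; first exact: continuous_measurable_fun.
by apply: measurable_funM => //; apply: measurable_funM => //; exact: measurable_trunc.
Qed.

(** A primitive of the difference of the two integrands of [levy_by_parts], with
    c = k 0 on ]0, 1], where the truncation is active, and c = 0 on ]1, +oo[. *)
Let G (c u : R) := (D u - c * u) * u `^ (- alpha).
Let G' (c u : R) := (k u - c) * u `^ (- alpha) + (D u - c * u) * (- alpha * u `^ (- alpha - 1)).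

Let dG c (u : R) : 0 < u -> is_derive u 1 (G c) (G' c u).
Proof.
move=> u0; have h1 := dD u; have h2 := is_derive1_powR (- alpha) u0.
have H : is_derive u 1 (fun u => (D u - c * u) * u `^ (- alpha)) (G' c u).
  by apply: is_derive_eq; rewrite /GRing.scale/= /G'; ring.
exact: H.
Qed.

Let cG c (u : R) : 0 < u -> {for u, continuous (G' c)}.
Proof.
move=> u0; have c1 := @continuous_powR_gt0 R (- alpha) u u0.
have c2 := @continuous_powR_gt0 R (- alpha - 1) u u0.
have cDc : D x - c * x @[x --> u] --> D u - c * u.
  by apply: cvgB; [exact: cD|apply: cvgM; [exact: cvg_cst|exact: cvg_id]].
rewrite /continuous_at /G'; apply: cvgD; apply: cvgM => //.
- by apply: cvgB; [exact: ck|exact: cvg_cst].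
- by apply: cvgM; [exact: cvg_cst|exact: c2].
Qed.

Let wtE (u : R) : wt u = u `^ (- alpha - 1).
Proof. by rewrite /levy_weight opprD addrC. Qed.

Let uwt (u : R) : 0 < u -> u * wt u = u `^ (- alpha).
Proof.
move=> u0; rewrite wtE powRD; last by rewrite (gt_eqF u0) implybT.
by rewrite powR_inv1 ?(ltW u0)// mulrCA divff ?mulr1// gt_eqF.
Qed.

Let H (u : R) := p u * wt u - alpha * (q u * wt u).

Let iH : mu.-integrable half (EFin \o H).
Proof.
have iaq : mu.-integrable half (fun u => (alpha * (q u * wt u))%:E) by exact: integrableZlR.
have j : mu.-integrable half ((fun u => (p u * wt u)%:E) \-
    (fun u => (alpha * (q u * wt u))%:E))%E by exact: integrableB.
exact: eq_integrable j.
Qed.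

Let H_small (u : R) : u \in (`]0%R, 1%R]%classic : set R) -> H u = G' (k 0) u.
Proof.
rewrite inE/= in_itv/= => /andP[u0 u1].
rewrite /H /p /q /G' truncE (gtr0_norm u0) u1 !mulr1 -(uwt u0) wtE; ring.
Qed.

Let H_large (u : R) : u \in (`]1%R, +oo[%classic : set R) -> H u = G' 0 u.
Proof.
rewrite inE/= in_itv/= andbT => u1; have u0 : 0 < u := lt_trans ltr01 u1.
rewrite /H /p /q /G' truncE (gtr0_norm u0) (leNgt u 1) u1 /= -(uwt u0) wtE; ring.
Qed.

Let int_small : \int[mu]_(u in `]0%R, 1%R]) H u = D 1 - k 0.
Proof.
have iG : mu.-integrable `]0%R, 1%R] (EFin \o G' (k 0)).
  have iHs : mu.-integrable `]0%R, 1%R] (EFin \o H).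
    by apply: integrableS iH => // u /=; rewrite !in_itv/= => /andP[->].
  by apply: eq_integrable iHs => // u us; rewrite /= H_small.
rewrite (@eq_Rintegral _ _ _ mu _ _ _ H_small).
rewrite (FTC0 (@dG (k 0)) (@cG (k 0)) iG (l := 0)).
  by rewrite subr0 /G powR1 !mulr1.
have a2 : 0 < 2 - alpha by move: alpha02 => ?; lra.
apply: (cvg_dominated_powR (A := A) a2) => n.
set u : R := n.+2%:R^-1.
have u0 : 0 < u by rewrite invr_gt0.
have un : u <= n.+1%:R^-1 by rewrite lef_pV2 ?posrE// ler_nat.
have u1 : u <= 1 by rewrite invf_le1// ler1n.
have := D_dom u; rewrite truncE (gtr0_norm u0) u1 mulr1 levy_dom_small ?(gtr0_norm u0)// => Du.
rewrite /G normrM (mulrC (k 0)) (ger0_norm (powR_ge0 _ _)).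
rewrite (@le_trans _ _ (A * u ^+ 2 * u `^ (- alpha)))//.
  by rewrite ler_wpM2r ?powR_ge0.
rewrite -mulrA ler_wpM2l// -powR_mulrn ?(ltW u0)// -powRD; last by rewrite (gt_eqF u0) implybT.
by apply: ge0_ler_powR; rewrite ?nnegrE ?(ltW a2) ?(ltW u0)// invr_ge0.
Qed.

Let int_large : \int[mu]_(u in `]1%R, +oo[) H u = - D 1.
Proof.
have iHs : mu.-integrable `]1%R, +oo[ (EFin \o H).
  apply: integrableS iH => // u /=; rewrite !in_itv/= !andbT; exact: lt_trans.
have iG : mu.-integrable `]1%R, +oo[ (EFin \o G' 0).
  by apply: eq_integrable iHs => // u us; rewrite /= H_large.
rewrite (@eq_Rintegral _ _ _ mu _ _ _ H_large) Rintegral_itv_obnd_cbnd//.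
have iG' : mu.-integrable `[1%R, +oo[ (EFin \o G' 0).
  have -> : `[1%R, +oo[%classic = [set (1 : R)] `|` `]1%R, +oo[ by rewrite setU1itv.
  apply: integrable_setUR => //.
    by apply/disj_setPS => x [] /= ->; rewrite in_itv/= ltxx.
  by apply/integrableP; split; [exact: measurable_fun_set1|rewrite integral_set1 ltry].
rewrite (FTCy (c := 0) (@dG 0) (@cG 0) ltr01 iG' (L := 0)).
  by rewrite sub0r /G powR1 !mul0r subr0 mulr1.
have ad : 0 < alpha - dlt by rewrite subr_gt0.
apply: (cvg_dominated_powR (A := A) ad) => n.
set u : R := 1 + n.+1%:R.
have u1 : 1 < u by rewrite ltrDl.
have u0 : 0 < u := lt_trans ltr01 u1.
have := D_dom u; rewrite truncE (gtr0_norm u0) (leNgt u 1) u1 /= mulr0 mul0r subr0.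
rewrite levy_dom_large ?(gtr0_norm u0) ?(ltW u1)// => Du.
rewrite /G mul0r subr0 normrM (ger0_norm (powR_ge0 _ _)).
rewrite (@le_trans _ _ (A * u `^ dlt * u `^ (- alpha)))//.
  by rewrite ler_wpM2r ?powR_ge0.
rewrite -mulrA ler_wpM2l// -powRD; last by rewrite (gt_eqF u0) implybT.
have -> : u `^ (dlt + - alpha) = u^-1 `^ (alpha - dlt).
  by rewrite -(powR_inv1 (ltW u0)) -powRrM mulN1r opprB.
apply: ge0_ler_powR; rewrite ?nnegrE ?invr_ge0 ?(ltW ad) ?(ltW u0)//.
by rewrite lef_pV2 ?posrE// lerDr.
Qed.

(** The boundary terms vanish at 0 since D u - u k 0 is quadratic and alpha < 2,
    and at +oo since D grows like u^dlt with dlt < alpha. At u = 1 the two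
    primitives differ by k 0, because the compensator jumps there. *)
Lemma levy_by_parts :
  \int[mu]_(u in half) (u * (k u - k 0 * trunc u) * wt u) =
  - k 0 + alpha * \int[mu]_(u in half) ((D u - u * trunc u * k 0) * wt u).
Proof.
have E : \int[mu]_(u in half) H u = - k 0.
  have hE : half = `]0%R, 1%R] `|` `]1%R, +oo[.
    by rewrite -itv_bndbnd_setU//= bnd_simp.
  have iH' := iH; rewrite hE in iH' *.
  rewrite Rintegral_setU// ?int_small ?int_large; first by ring.
  by apply/disj_setPS => x [] /=; rewrite !in_itv/= => /andP[_ x1] /andP[]; rewrite ltNge x1.
move: E; rewrite /H (RintegralB _ ip (integrableZlR _ alpha iq))// (RintegralZl _ _ iq)//.
by move=> E; rewrite -E /p /q; ring.
Qed.

End levy_by_parts.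

(** * The Stein equation *)
Section stein_solution.
Context {R : realType}.
Notation mu := (@lebesgue_measure R).
Notation half := (`]0%R, +oo[%classic : set R).
Notation trunc := (\1_[set v : R | `|v| <= 1] : R -> R).
Variables (alpha beta : R) (m1 m2 : {nonneg R}).
Variables (d : measure_display) (T : measurableType d) (P : probability T R).
Variables (X : {RV P >-> R}) (F : R -> probability R R).
Notation nu := (levy_measure alpha m1 m2).
Notation wt := (levy_weight alpha).
Variable dlt : R.
Hypothesis alpha02 : 0 < alpha < 2.
Hypothesis dlt0 : 0 < dlt.
Hypothesis dltalpha : dlt < alpha.
Hypothesis dlt1 : dlt <= 1.
Variables (f : R -> R) (C : R).
Hypothesis tf : tame dlt C f.
Hypothesis sf : stein_identity alpha beta m1 m2 X F f.
Notation g := (stein_sol F f).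

Let mf : measurable_means F f. Proof. by case: sf. Qed.
Let CK := C * time_mass dlt.
Let CK0 : 0 <= CK. Proof. by rewrite mulr_ge0 ?(tame_ge0 tf) ?time_mass_ge0. Qed.

(** Solve the identity at y for y g y: every other term is bounded, except f y,
    which grows at most like |y|^dlt. *)
Lemma stein_sol_decay : exists2 Q, 0 <= Q & forall y, `|y * g y| <= Q + C * `|y| `^ dlt.
Proof.
pose b := beta - (m1%:num - m2%:num).
pose V := alpha * (CK * \int[nu]_u levy_dom dlt u).
have V0 : 0 <= V by exact: le_trans (normr_ge0 _) (stein_rhs_bound m1 m2 alpha02 dlt0 dltalpha dlt1 0 tf mf).
exists (`|f 0| + `|\int[P]_w f (X w)| + `|b| * CK + V).
  by rewrite !addr_ge0// mulr_ge0.
move=> y; case: sf => _ _ /(_ y); rewrite -addrA -/b => E.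
have b1 := stein_rhs_bound m1 m2 alpha02 dlt0 dltalpha dlt1 y tf mf.
have b2 : `|b * g y| <= `|b| * CK.
  by rewrite normrM ler_wpM2l// (stein_solP dlt0 dlt1 tf mf y).2.
have b3 : `|f y - f 0| <= C * `|y| `^ dlt.
  by case: tf => _ _ _ /(_ 0 y); rewrite subr0.
have alg (fy f0 I G a W B D : R) : fy - I = (- y + b) * G + a -> `|a| <= W ->
    `|b * G| <= B -> `|fy - f0| <= D -> `|y * G| <= `|f0| + `|I| + B + W + D.
  move=> E' h1 h2 h3.
  have -> : y * G = I + b * G + a - (fy - f0) - f0.
    have -> : fy = (- y + b) * G + a + I by rewrite -E' subrK.
    by ring.
  have := ler_norm f0; have := ler_norm (- f0); have := ler_norm I; have := ler_norm (- I).
  rewrite !normrN; move: h1 h2 h3; rewrite !ler_norml.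
  by move=> /andP[? ?] /andP[? ?] /andP[? ?] ? ? ? ?; apply/andP; split; lra.
exact: (alg _ _ _ _ _ _ _ _ E b1 b2 b3).
Qed.

(** Near 0 because g is Lipschitz; for |u| > 1, u g (x + u) is compared with
    (x + u) g (x + u), which [stein_sol_decay] controls. *)
Lemma levy_dom_stein_integrand x : exists2 A, CK <= A &
  forall u, `|stein_integrand g x u| <= A * levy_dom dlt u.
Proof.
have C0 := tame_ge0 tf; have [Q Q0 yg] := stein_sol_decay.
pose E := Q + C * (`|x| + 1) `^ dlt + `|x| * CK.
have E0 : 0 <= E by rewrite !addr_ge0 ?(mulr_ge0 C0) ?(mulr_ge0 (normr_ge0 x)) ?powR_ge0.
exists (CK + E); first by rewrite lerDl.
move=> u.
rewrite /stein_integrand truncE; apply: le_levy_dom => //; first by rewrite addr_ge0.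
  move=> -> /=; rewrite mulr1 normrM.
  have := stein_sol_lipschitz dlt0 dlt1 tf mf x (x + u).
  have -> : x + u - x = u by ring.
  move=> h.
  rewrite (@le_trans _ _ (`|u| * (CK * `|u|)))// ?ler_wpM2l//.
  rewrite mulrCA -normrM -expr2 ger0_norm ?sqr_ge0// ler_wpM2r ?sqr_ge0//.
  by rewrite lerDl.
move=> u1; rewrite (leNgt `|u| 1) u1 /= mulr0 subr0.
have u0 : 0 < `|u| := lt_trans ltr01 u1.
have ud : 1 <= `|u| `^ dlt.
  by rewrite -(powRr0 `|u|) ler_powR ?(ltW u1)// ltW.
have xu : `|x + u| `^ dlt <= (`|x| + 1) `^ dlt * `|u| `^ dlt.
  rewrite -powRM ?addr_ge0//; apply: ge0_ler_powR; rewrite ?nnegrE ?(ltW dlt0) ?mulr_ge0 ?addr_ge0//.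
  rewrite (le_trans (ler_normD _ _))// mulrDl mul1r lerD2r ler_peMr// ltW//.
have -> : u * g (x + u) = (x + u) * g (x + u) - x * g (x + u).
  by move: (g _) => a; ring.
rewrite (le_trans (ler_normB _ _))//.
have h1 : `|x * g (x + u)| <= `|x| * CK.
  by rewrite normrM ler_wpM2l// (stein_solP dlt0 dlt1 tf mf _).2.
have h2 := le_trans (yg (x + u)) (lerD (lexx Q) (ler_wpM2l C0 xu)).
apply: (le_trans (lerD h2 h1)).
have alg (q c a b l k : R) : 0 <= q -> 0 <= l -> 0 <= k -> 1 <= b ->
    q + c * (a * b) + l <= (k + (q + c * a + l)) * b.
  move=> q0 l0 k0 b1; have w0 : 0 <= b - 1 by rewrite subr_ge0.
  have b0 : 0 <= b by rewrite (le_trans _ b1).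
  move: (mulr_ge0 q0 w0) (mulr_ge0 l0 w0) (mulr_ge0 k0 b0).
  by rewrite mulrA !mulrDl !mulrBr; lra.
by apply: alg => //; rewrite mulr_ge0.
Qed.

Lemma measurable_stein_integrand x : measurable_fun setT (stein_integrand g x).
Proof.
apply: measurable_funM => //; apply: measurable_funB.
  apply: (measurableT_comp (continuous_measurable_fun (stein_sol_continuous dlt0 dlt1 tf mf))).
  exact: measurable_funD.
by apply: measurable_funM => //; exact: measurable_trunc.
Qed.

(** Integration by parts for u |-> stein_incr F f x u on the positive jumps and
    for u |-> stein_incr F f x (- u), of derivative - g (x - u), on the negative
    ones. *)
Lemma stein_integrandP x :
  nu.-integrable setT (fun u => (stein_integrand g x u)%:E) /\
  \int[nu]_u stein_integrand g x u = - (m1%:num - m2%:num) * g x +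
    alpha * \int[nu]_u (stein_incr F f x u - u * trunc u * g x).
Proof.
have [A CKA ilA] := levy_dom_stein_integrand x.
have [i1 E1] := levy_split m1 m2 alpha02 dltalpha dlt1 (measurable_stein_integrand x) ilA.
split=> //; rewrite E1.
have [_ ->] := levy_split m1 m2 alpha02 dltalpha dlt1
  (measurable_compensated dlt0 dlt1 tf mf x) (levy_dom_compensated dlt0 dlt1 tf mf x).
have cmp u : `|stein_incr F f x u - u * trunc u * g x| <= A * levy_dom dlt u.
  rewrite (le_trans (levy_dom_compensated dlt0 dlt1 tf mf x u))//.
  by rewrite ler_wpM2r ?levy_dom_ge0.
have cg := stein_sol_continuous dlt0 dlt1 tf mf.
have truncN u : trunc (- u) = trunc u by rewrite !truncE normrN.
have cgx : continuous (fun u => g (x + u)).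
  by move=> u; apply: continuous_comp; [exact: cvgD (cvg_cst _) cvg_id|exact: cg].
have cgxN : continuous (fun u => - g (x - u)).
  suff c : continuous (fun u => g (x - u)) by move=> u; exact: cvgN (c u).
  move: (g) cg => G cG u; apply: (cvg_comp (fun u : R => x - u) G _ (@cG (x - u))).
  by apply: cvgB; [exact: cvg_cst|exact: cvg_id].
have dN (u : R) : is_derive u 1 (fun u => stein_incr F f x (- u)) (- g (x - u)).
  have h := is_derive_stein_incr dlt0 dlt1 tf mf x (- u).
  have := @is_derive1_comp _ (stein_incr F f x) -%R u _ _ h (is_deriveN (is_derive_id u 1)).
  by rewrite mulrN1.
have p1 : \int[mu]_(u in half) (stein_integrand g x u * wt u) =
    - g x + alpha * \int[mu]_(u in half) ((stein_incr F f x u - u * trunc u * g x) * wt u).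
  have := @levy_by_parts R alpha dlt alpha02 dltalpha dlt1 (stein_incr F f x)
    (fun u => g (x + u)) A (is_derive_stein_incr dlt0 dlt1 tf mf x) cgx.
  by rewrite (addr0 x); apply.
have p2 : \int[mu]_(u in half) (stein_integrand g x (- u) * wt u) =
    g x + alpha * \int[mu]_(u in half)
      ((stein_incr F f x (- u) - (- u) * trunc (- u) * g x) * wt u).
  have := @levy_by_parts R alpha dlt alpha02 dltalpha dlt1 (fun u => stein_incr F f x (- u))
    (fun u => - g (x - u)) A dN cgxN.
  rewrite (subr0 x) (opprK (g x)) => H.
  have e1 (u : R) : stein_integrand g x (- u) = u * (- g (x - u) - - g x * trunc u).
    by rewrite /stein_integrand truncN; move: (g _) (g _) (trunc u) => a b c; ring.
  have e2 (u : R) : stein_incr F f x (- u) - (- u) * trunc (- u) * g x =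
      stein_incr F f x (- u) - u * trunc u * - g x.
    by rewrite truncN; move: (stein_incr _ _ _ _) (g x) (trunc u) => a b c; ring.
  transitivity (\int[mu]_(u in half) (u * (- g (x - u) - - g x * trunc u) * wt u)).
    by apply: eq_Rintegral => u _; rewrite e1.
  rewrite H.
  - by congr (_ + _ * _); apply: eq_Rintegral => u _; rewrite e2.
  - by move=> u; rewrite -e2 -(levy_domN dlt u).
  - by move=> u; rewrite -e1 -(levy_domN dlt u).
have alg (a1 a2 G al I1 I2 J1 J2 : R) : I1 = - G + al * J1 -> I2 = G + al * J2 ->
    a1 * I1 + a2 * I2 = - (a1 - a2) * G + al * (a1 * J1 + a2 * J2).
  by move=> -> ->; ring.
exact: alg p1 p2.
Qed.

Lemma stein_sol_defined_tame : stein_sol_defined F f.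
Proof.
move=> x; split=> [t _|]; first exact: (mean_deriveP F tf x t).1.
exact: (stein_solP dlt0 dlt1 tf mf x).1.
Qed.

Lemma solves_stein_tame : solves_stein alpha beta m1 m2 P X f g.
Proof.
case: (sf) => _ iX E; split => // x; have [i1 E1] := stein_integrandP x.
split=> //; rewrite /stein_op E1.
have -> : fine 'E_P[f \o X] = \int[P]_w f (X w) by rewrite unlock.
have alg (y b m G a : R) : (- y + b) * G + (- m * G + a) = (- y + b - m) * G + a by ring.
by rewrite E; exact: alg.
Qed.

End stein_solution.

(** * The two classes of test functions *)
Section test_functions.
Context {R : realType}.
Implicit Types (h : R -> R) (delta : R).

Lemma lipschitz_derive1 h (c : R) : (forall x : R, derivable h x 1) ->
  (forall x y, `|h y - h x| <= c * `|y - x|) -> forall x, `|derive1 h x| <= c.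
Proof.
move=> dh hc x; have := dh x; rewrite derive1E => /cvg_norm dx.
apply: (cvgr_to_le dx); near=> t.
have t0 : t != 0 by near: t; exact: nbhs_dnbhs_neq.
rewrite normrM normfV ler_pdivrMl ?normr_gt0//.
rewrite (le_trans (hc _ _))//= addrK [t *: 1]mulr1 mulrC//.
Unshelve. all: by end_near. Qed.

Lemma tame_H_delta delta h : H_delta delta h -> tame delta 1 h.
Proof.
case=> dh hd.
have lip k x y : (k <= 1)%N -> `|derive1n k h y - derive1n k h x| <= 1 * `|y - x|.
  by move=> k1; rewrite mul1r (le_trans (hd k k1 y x))// ge_min lexx.
split => // [|x y|x y].
- exact: lipschitz_derive1 (fun x y => lip 0%N x y isT).
- exact: lip 1%N x y isT.
- by rewrite mul1r (le_trans (hd 0%N isT y x))// ge_min lexx orbT.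
Qed.

Lemma tame_H_2 delta h : 0 <= delta <= 1 -> H_2 h -> tame delta 4 h.
Proof.
move=> d01 [dh dh' _ hn].
have sup k x : (k <= 2)%N -> `|derive1n k h x| <= 1.
  move=> /hn; rewrite -lee_fin; apply: le_trans.
  by apply: ereal_sup_ubound; exists x.
have -> : 4 = 2 * 1 + 1 + 1 :> R by ring.
apply: (@tame_bounded _ _ _ _ _ h (derive1 h)) => // [x|x|x|x y].
- exact: (sup 0%N).
- by rewrite derive1E; exact/derivableP.
- exact: (sup 1%N).
- apply: (@ler_lipschitz _ _ (derive1n 2 h)) => z; last exact: sup.
  by rewrite /= [derive1 (derive1 h) z]derive1E; exact/derivableP.
Qed.

End test_functions.

Theorem theorem3p12 (R : realType) (alpha beta : R) (m1 m2 : {nonneg R})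
  (d : measure_display) (T : measurableType d) (P : probability T R)
  (X : {RV P >-> R}) (F : R -> probability R R)
  (halpha : 0 < alpha < 2) (hm : 0 < m1%:num + m2%:num)
  (hX : is_stable alpha beta m1 m2 P X)
  (hF : self_decomp_laws P X F) :
  (alpha <= 1 -> forall (delta : R) (h : R -> R),
     0 < delta < alpha -> H_delta delta h ->
     stein_sol_defined F h /\
     solves_stein alpha beta m1 m2 P X h (stein_sol F h)) /\
  (1 < alpha -> forall h : R -> R, H_2 h ->
     stein_sol_defined F h /\
     solves_stein alpha beta m1 m2 P X h (stein_sol F h)).
Proof.
have main dlt C h : 0 < dlt -> dlt < alpha -> dlt <= 1 -> tame dlt C h ->
    stein_sol_defined F h /\ solves_stein alpha beta m1 m2 P X h (stein_sol F h).
  move=> d0 da d1 th.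
  have sh := stein_identity_tame halpha d0 da d1 hX hF th.
  split; first exact: (stein_sol_defined_tame d0 d1 th sh).
  exact: (solves_stein_tame halpha d0 da d1 th sh).
split=> [a1 delta h /andP[d0 da] /tame_H_delta|a1 h /tame_H_2 th].
  by apply: main => //; exact: ltW (lt_le_trans da a1).
apply: (main 2^-1 4) => //.
- by rewrite (lt_trans _ a1)// invf_lt1// ltr1n.
- by rewrite invf_le1// ler1n.
- by apply: th; rewrite invr_ge0 ler0n invf_le1// ler1n.
Qed.
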